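(* Let $\mathcal{A}\mathbb{T}_{pin}=\overline{\bigcup_{N\ge0}\mathcal{A}_N}\subset C^\ast(R_{punc})$ be the $\mathcal{A}\mathbb{T}$-algebra of the Pinwheel Tiling, where $\mathcal{A}_N$ is the closed linear span of the functions $z^k\cdot e_N(p_i,t,t')$ with $i\in\{0,1\}$, $t,t'\in\omega^N(p_i)$, $k\in\mathbb{Z}$, and $\omega$ is the pinwheel substitution. Then $\mathcal{A}\mathbb{T}_{pin}$ is simple.
   Context: **Tilings.** A tiling of $\mathbb{R}^2$ is a countable collection of closed polygonal subsets (tiles) covering $\mathbb{R}^2$ such that distinct tiles have disjoint interiors. A patch in a tiling is a finite subset of its tiles; $T\cap B(x,r)$ denotes the patch of tiles of $T$ completely contained in the open ball $B(x,r)$. $\Gamma=\mathbb{R}^2\rtimes \mathcal{S}^1$ is the group of orientation preserving isometries of $\mathbb{R}^2$, where $\mathcal{S}^1=SO(2,\mathbb{R})$ consists of the rotations $R_\theta$ about the origin; $(x,R_\theta)\in\Gamma$ acts on a tiling $T$ by $R_\theta(T+x)$. Put $d((x,R_\theta),(y,R_\phi))=|x-y|+\|R_\theta-R_\phi\|_{F}$ (Frobenius norm). **Tiling metric.** For $0<\varepsilon<1$, say $T,T'$ are within $\varepsilon$ if there are $(x,R_\theta),(x',R_{\theta'})\in\Gamma$, each at $d$-distance $<\varepsilon$ from the identity, with $R_\theta(T+x)\cap B(0,\varepsilon^{-1})=R_{\theta'}(T'+x')\cap B(0,\varepsilon^{-1})$. Then $d_\Gamma(T,T')$ is the infimum of all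 such $\varepsilon$, or $1$ if there are none. The continuous hull $\Omega_T$ of $T$ is the completion of $\{T+x:x\in\mathbb{R}^2\}$ in $d_\Gamma$; its elements are tilings. **Pinwheel substitution.** Let $\lambda=\sqrt5$ and let $\Delta$ be the triangle with vertices $(0,0),(5,0),(1,2)$. It is the union of the five $(1,2,\sqrt5)$-right triangles with vertices $\{(0,0),(1,0),(1,2)\}$, $\{(1,1),(3,1),(1,2)\}$, $\{(1,0),(1,1),(3,1)\}$, $\{(1,0),(3,0),(3,1)\}$, $\{(3,0),(5,0),(3,1)\}$, which have disjoint interiors. Fix an interior point $c$ of $\lambda^{-1}\Delta$. Proto-tiles: $p_0=\lambda^{-1}\Delta-c$, a $(1,2,\sqrt5)$-right triangle, and $p_1=F(p_0)$, where $F(x,y)=(-x,y)$; both have the origin as puncture, $x(p_0)=x(p_1)=0$. $\omega(p_0)$ is the set of the five triangles above translated by $-\lambda c$, so its union is $\lambda p_0$, and $\omega(p_1)=F(\omega(p_0))$. (The third and fourth triangles are, up to translation, $R_\theta(p_0)$ and $R_{\theta+\pi}(p_0)$ with $\theta=\arctan(1/2)$, an irrational multiple of $2\pi$; the other three are images of $p_1$ under $\Gamma$.) Every tile is $t=R_\phi(p_i)+v$ for a unique such expression; put $x(t)=v$, $\angle t=\phi$ (mod $2\pi$), and $\omega(t)=R_\phi(\omega(p_i))+\lambda v$; $\omega$ is applied to patches and tilings tile by tile, $\omega^0(p_i)=\{p_i\}$. **Hull.** $T$ is a Pinwheel Tiling, i.e. a tiling by images of $p_0,p_1$ under $\Gamma$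 produced by iterating $\omega$ (every patch of $T$ is contained in some $\gamma(\omega^m(p_j))$, $\gamma\in\Gamma$). Known facts taken as part of the setting: $\Omega_T$ is invariant under all rotations; it has finite local complexity with respect to $\Gamma$ (for each $r>0$ the patches $T'\cap B(x,r)$, $T'\in\Omega_T$, $x\in\mathbb{R}^2$, are finitely many modulo $\Gamma$); it is strongly aperiodic ($T'+x\neq T'$ for $T'\in\Omega_T$, $x\ne0$); and $\omega:\Omega_T\to\Omega_T$ is a continuous bijection. Put $\Omega_{punc}=\{T'\in\Omega_T:\text{some } t\in T' \text{ has } x(t)=0\}$, and for $T'\in\Omega_{punc}$ let $T'(0)$ be the tile of $T'$ containing the origin. **$C^\ast$-algebra.** $R_{punc}=\{(T',T'-x(t)):T'\in\Omega_{punc},\ t\in T'\}$ has the topology of the metric $d_R((T_1,T_1-x(t_1)),(T_2,T_2-x(t_2)))=d_\Gamma(T_1,T_2)+|x(t_1)-x(t_2)|$; $[T']$ is the equivalence class of $T'$. $C_c(R_{punc})$ is a $\ast$-algebra with $f\cdot g(T_1,T_2)=\sum_{T_3\in[T_1]}f(T_1,T_3)g(T_3,T_2)$ and $f^\ast(T_1,T_2)=\overline{f(T_2,T_1)}$. For $T_0\in\Omega_{punc}$, $\pi_{T_0}$ is the representation on $\ell^2([T_0])$ with $(\pi_{T_0}(f)\xi)(T_1)=\sum_{T_2\in[T_0]}f(T_1,T_2)\xi(T_2)$. $C^\ast(R_{punc})$ is the completion of $C_c(R_{punc})$ in $\|f\|_{red}=\sup_{T_0}\|\pi_{T_0}(f)\|$.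 **The functions.** $z(T_1,T_2)=e^{i\angle T_1(0)}$ if $T_1=T_2$ and $0$ otherwise, with $z^k$ its $k$-th power (as a unitary). For $N\ge0$ and $t,t'\in\omega^N(p_i)$, $e_N(p_i,t,t')$ is the characteristic function of $$V_N(p_i,t,t')=\{(\omega^N(T_1)-R_\phi(x(t)),\ \omega^N(T_1)-R_\phi(x(t'))) : T_1\in\Omega_T,\ R_\phi\in\mathcal{S}^1,\ R_\phi(p_i)\in T_1\}\subset R_{punc}.$$ The $\mathcal{A}_N$ are $C^\ast$-subalgebras of $C^\ast(R_{punc})$ with $\mathcal{A}_N\subseteq\mathcal{A}_{N+1}$. *)

(* Defs.v *)
From HB Require Import structures.
From mathcomp Require Import all_boot all_order all_algebra.
From mathcomp Require Import complex.
From mathcomp Require Import all_classical all_reals all_analysis.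

Set Implicit Arguments.
Unset Strict Implicit.
Unset Printing Implicit Defensive.

Import Order.TTheory GRing.Theory Num.Theory numFieldNormedType.Exports.

Local Open Scope ring_scope.
Local Open Scope complex_scope.
Local Open Scope classical_set_scope.

Notation planeOf R := 'cV[R]_2.
Notation tileOf R := (set (planeOf R)).
(* Tilings and patches alike. *)
Notation tilesetOf R := (set (tileOf R)).

Section Plane.
Context {R : realType}.

Local Notation plane := (planeOf R).
Local Notation tile := (tileOf R).
Local Notation tileset := (tilesetOf R).

Definition pt (x y : R) : plane := \col_(i < 2) (if i == 0 then x else y).

(* The Frobenius norm; on columns it is the Euclidean norm. *)
Definition fnorm m n (A : 'M[R]_(m, n)) : R :=
  Num.sqrt (\sum_i \sum_j A i j ^+ 2).

Definition eball (x : plane) (r : R) : set plane := [set y | fnorm (y - x) < r].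

Definition rotmx (th : R) : 'M[R]_2 :=
  \matrix_(i < 2, j < 2)
    (if i == j then cos th else if i == 0 then - sin th else sin th).

Definition translate (T : tileset) (x : plane) : tileset :=
  [set [set p + x | p in t] | t in T].

(* R_th (T + x), the action of (x, R_th) in the group Gamma. *)
Definition gact (x : plane) (th : R) (T : tileset) : tileset :=
  [set [set rotmx th *m (p + x) | p in t] | t in T].

(* d((x, R_th), (y, R_ph)) *)
Definition gdist (x : plane) (th : R) (y : plane) (ph : R) : R :=
  fnorm (x - y) + fnorm (rotmx th - rotmx ph).

Definition inball (T : tileset) (x : plane) (r : R) : tileset :=
  [set t | T t /\ t `<=` eball x r].

Definition within (e : R) (T T' : tileset) : Prop :=
  exists x th x' th',
    [/\ gdist x th 0 0 < e, gdist x' th' 0 0 < e &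
        inball (gact x th T) 0 e^-1 = inball (gact x' th' T') 0 e^-1].

(* The values e are all < 1, so adding 1 to the set only matters when there
   are none. *)
Definition dGamma (T T' : tileset) : R :=
  inf ([set e | 0 < e < 1 /\ within e T T'] `|` [set 1]).

Definition triangle (a b c : plane) : tile :=
  [set p | exists x y z : R,
    [/\ 0 <= x, 0 <= y, 0 <= z, x + y + z = 1 &
        p = x *: a + y *: b + z *: c]].

Definition reflF (p : plane) : plane := pt (- p 0 0) (p 1 0).

Definition lambda : R := Num.sqrt 5.

Definition Delta : tile := triangle (pt 0 0) (pt 5 0) (pt 1 2).

Definition scaledDelta : tile := [set lambda^-1 *: p | p in Delta].

Definition five_triangles : tileset :=
  [set triangle (pt 0 0) (pt 1 0) (pt 1 2)] `|`
  [set triangle (pt 1 1) (pt 3 1) (pt 1 2)] `|`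
  [set triangle (pt 1 0) (pt 1 1) (pt 3 1)] `|`
  [set triangle (pt 1 0) (pt 3 0) (pt 3 1)] `|`
  [set triangle (pt 3 0) (pt 5 0) (pt 3 1)].

End Plane.

Section Pinwheel.
Context {R : realType}.

Local Notation plane := (planeOf R).
Local Notation tile := (tileOf R).
Local Notation tileset := (tilesetOf R).

(* The chosen interior point of lambda^-1 Delta. *)
Variable c : plane.

(* false codes the index 0 and true the index 1. *)
Definition proto (i : bool) : tile :=
  let p0 := [set p - c | p in scaledDelta] in
  if i then [set reflF p | p in p0] else p0.

Definition omega_proto (i : bool) : tileset :=
  let w0 := translate five_triangles (- (lambda *: c)) in
  if i then [set [set reflF p | p in s] | s in w0] else w0.

Definition placed (i : bool) (ph : R) (v : plane) : tile :=
  [set rotmx ph *m p + v | p in proto i].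

(* x(t) and a representative of the angle of t; the values 0 are junk, taken
   only when t is not an image of a proto-tile. *)
Definition puncture (t : tile) : plane :=
  xget 0 [set v | exists i ph, t = placed i ph v].

Definition angle (t : tile) : R :=
  xget 0 [set ph | exists i v, t = placed i ph v].

Definition omega_tile (t : tile) : tileset :=
  [set s | exists i ph v, t = placed i ph v /\
    exists2 s0, omega_proto i s0 &
      s = [set rotmx ph *m p + lambda *: v | p in s0]].

Definition omega (P : tileset) : tileset := \bigcup_(t in P) omega_tile t.

Definition omega_iter_proto (m : nat) (i : bool) : tileset :=
  iter m omega [set proto i].

Definition tiling (T : tileset) : Prop :=
  [/\ countable T,
      forall t, T t -> exists i ph v, t = placed i ph v,
      \bigcup_(t in T) t = [set: plane] &
      forall s t, T s -> T t -> s <> t -> interior s `&` interior t = set0].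

Definition pinwheel_tiling (T : tileset) : Prop :=
  tiling T /\
  forall P, P `<=` T -> finite_set P ->
    exists m j x th, P `<=` gact x th (omega_iter_proto m j).

Variable T : tileset.

(* The completion of the translates of T, realised by the tilings which are
   limits of such translates. *)
Definition hull : set tileset :=
  [set T' | tiling T' /\
    forall e : R, 0 < e -> exists x, dGamma (translate T x) T' < e].

Definition hull_rotation_invariant : Prop :=
  forall T' th, hull T' -> hull (gact 0 th T').

Definition hull_flc : Prop :=
  forall r : R, 0 < r ->
    exists2 F : set tileset, finite_set F &
      forall T' x, hull T' ->
        exists P y th, F P /\ inball T' x r = gact y th P.

Definition hull_strongly_aperiodic : Prop :=
  forall T' x, hull T' -> x <> 0 -> translate T' x <> T'.

Definition omega_hull_continuous : Prop :=
  forall T1, hull T1 -> forall e : R, 0 < e ->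
    exists2 d : R, 0 < d & forall T2, hull T2 ->
      dGamma T1 T2 < d -> dGamma (omega T1) (omega T2) < e.

Definition hull_punc : set tileset :=
  [set T' | hull T' /\ exists2 t, T' t & puncture t = 0].

(* T'(0) *)
Definition tile0 (T' : tileset) : tile := xget set0 [set t | T' t /\ t 0].

Definition Rpunc : set (tileset * tileset) :=
  [set p | hull_punc p.1 /\
    exists2 t, p.1 t & p.2 = translate p.1 (- puncture t)].

(* The x(t) with T2 = T1 - x(t); unique by strong aperiodicity. *)
Definition displacement (p : tileset * tileset) : plane :=
  xget 0 [set v | exists t,
    [/\ p.1 t, v = puncture t & p.2 = translate p.1 (- v)]].

Definition dR (p q : tileset * tileset) : R :=
  dGamma p.1 q.1 + fnorm (displacement p - displacement q).

Definition eqclass (T' : tileset) : set tileset := [set T'' | Rpunc (T', T'')].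

Definition rpunc : Type := set_type Rpunc.

HB.instance Definition _ := Choice.on rpunc.

Definition rpunc_open (U : set rpunc) : Prop :=
  forall p, U p -> exists2 d : R, 0 < d &
    forall q, dR (val p) (val q) < d -> U q.

Lemma rpunc_openT : rpunc_open setT.
Proof. by move=> p _; exists 1. Qed.

Lemma rpunc_openI : setI_closed rpunc_open.
Proof.
move=> U V oU oV p [/oU[d d0 dU] /oV[d' d'0 dV]].
exists (Num.min d d'); first by rewrite lt_min d0.
by move=> q; rewrite lt_min => /andP[/dU ? /dV].
Qed.

Lemma rpunc_open_bigU (I : Type) (U : I -> set rpunc) :
  (forall i, rpunc_open (U i)) -> rpunc_open (\bigcup_i U i).
Proof.
move=> oU p [i _ /oU[d d0 dU]]; exists d => // q /dU Uq.
by exists i.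
Qed.

HB.instance Definition _ :=
  isOpenTopological.Build rpunc rpunc_openT rpunc_openI rpunc_open_bigU.

(* Functions on Rpunc are encoded as functions on all pairs vanishing outside
   Rpunc, so that sums over equivalence classes can be written directly. *)
Definition pairfun := tileset * tileset -> R[i].

Definition Cc : set pairfun :=
  [set f | [/\ forall p, ~ Rpunc p -> f p = 0,
    continuous (fun p : rpunc => f (val p) : R[i]^o) &
    compact (closure [set p : rpunc | f (val p) <> 0])]].

(* For f, g in Cc the sum has finitely many nonzero terms. *)
Definition conv (f g : pairfun) : pairfun := fun p =>
  \sum_(T3 \in eqclass p.1) f (p.1, T3) * g (T3, p.2).

Definition l2norm (T0 : tileset) (xi : tileset -> R[i]) : \bar R :=
  sqrte (\esum_(T1 in eqclass T0) ((Normc.normc (xi T1)) ^+ 2)%:E).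

Definition piT (T0 : tileset) (f : pairfun) (xi : tileset -> R[i]) :
    tileset -> R[i] :=
  fun T1 => \sum_(T2 \in eqclass T0) f (T1, T2) * xi T2.

Definition opnorm (T0 : tileset) (f : pairfun) : \bar R :=
  ereal_sup [set l2norm T0 (piT T0 f xi) | xi in
    [set xi | (l2norm T0 xi <= 1)%E]].

Definition rednorm (f : pairfun) : \bar R :=
  ereal_sup [set opnorm T0 f | T0 in hull_punc].

Definition kadd (f g : pairfun) : pairfun := fun p => f p + g p.
Definition ksub (f g : pairfun) : pairfun := fun p => f p - g p.
Definition kscale (a : R[i]) (f : pairfun) : pairfun := fun p => a * f p.
Definition kzero : pairfun := fun=> 0.

Definition cauchy_seq (u : nat -> pairfun) : Prop :=
  (forall n, Cc (u n)) /\
  forall e : R, 0 < e -> exists N, forall m n, (N <= m)%N -> (N <= n)%N ->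
    (rednorm (ksub (u m) (u n)) < e%:E)%E.

Definition seq_dist (u v : nat -> pairfun) : \bar R :=
  limn (fun n => rednorm (ksub (u n) (v n))).

Definition seq_class (u : nat -> pairfun) : set (nat -> pairfun) :=
  [set v | cauchy_seq v /\
    rednorm (ksub (u n) (v n)) @[n --> \oo] --> 0%E].

(* The completion C^*(R_punc): Cauchy sequences in Cc modulo null sequences. *)
Definition cstar : Type :=
  {A : set (nat -> pairfun) | exists2 u, cauchy_seq u & A = seq_class u}.

Definition crepr (a : cstar) : nat -> pairfun := projT1 (cid2 (projT2 a)).

Lemma rednorm0_le : (rednorm kzero <= 0)%E.
Proof.
apply: ub_ereal_sup => _ [T0 _ <-]; apply: ub_ereal_sup => _ [xi _ <-].
rewrite /l2norm esum1 ?sqrte0// => T1 _.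
rewrite /piT fsbig1 => [|T2 _]; last by rewrite /kzero mul0r.
by rewrite Normc.normc0 expr0n.
Qed.

Lemma Cc0 : Cc kzero.
Proof.
split=> //; first exact: cst_continuous.
rewrite (_ : [set _ | _] = set0) ?closure0; first exact: compact0.
by apply/seteqP; split=> p.
Qed.

Lemma cauchy_seq0 : cauchy_seq (fun=> kzero).
Proof.
split=> [_|e e0]; first exact: Cc0.
exists 0%N => m n _ _; rewrite (_ : ksub _ _ = kzero); last first.
  by apply/funext => p; rewrite /ksub subr0.
by apply: le_lt_trans rednorm0_le _; rewrite lte_fin.
Qed.

Definition czero : cstar :=
  exist _ (seq_class (fun=> kzero)) (ex_intro2 _ _ _ cauchy_seq0 erefl).

(* The element represented by u; junk when u is not a Cauchy sequence. *)
Definition cclass (u : nat -> pairfun) : cstar :=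
  match pselect (cauchy_seq u) with
  | left h => exist _ (seq_class u) (ex_intro2 _ _ _ h erefl)
  | right _ => czero
  end.

Definition cembed (f : pairfun) : cstar := cclass (fun=> f).

Definition cadd (a b : cstar) : cstar :=
  cclass (fun n => kadd (crepr a n) (crepr b n)).
Definition cscale (k : R[i]) (a : cstar) : cstar :=
  cclass (fun n => kscale k (crepr a n)).
Definition cmul (a b : cstar) : cstar :=
  cclass (fun n => conv (crepr a n) (crepr b n)).

Definition cdist (a b : cstar) : \bar R := seq_dist (crepr a) (crepr b).

Definition cclosure (S : set cstar) : set cstar :=
  [set a | forall e : R, 0 < e -> exists2 b, S b & (cdist a b < e%:E)%E].

Definition closed_ideal (S I : set cstar) : Prop :=
  [/\ I `<=` S,
      [/\ I czero,
          forall a b, I a -> I b -> I (cadd a b) &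
          forall k a, I a -> I (cscale k a)],
      forall s a, S s -> I a -> I (cmul s a) /\ I (cmul a s) &
      cclosure I `<=` I].

Definition simple_algebra (S : set cstar) : Prop :=
  (exists2 a, S a & a <> czero) /\
  forall I, closed_ideal S I -> I = [set czero] \/ I = S.

Definition expi (x : R) : R[i] := cos x +i* sin x.

(* z^k: z is supported on the diagonal, where convolution powers are pointwise
   powers; z^0 is the unit. *)
Definition zpow (k : int) : pairfun := fun p =>
  if `[< Rpunc p /\ p.1 = p.2 >] then expi (angle (tile0 p.1)) ^ k else 0.

Definition VN (N : nat) (i : bool) (t t' : tile) : set (tileset * tileset) :=
  [set p | exists T1 ph,
    [/\ hull T1, T1 (placed i ph 0) &
        p = (translate (iter N omega T1) (- (rotmx ph *m puncture t)),
             translate (iter N omega T1) (- (rotmx ph *m puncture t')))]].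

Definition eN (N : nat) (i : bool) (t t' : tile) : pairfun :=
  fun p => if `[< VN N i t t' p >] then 1 else 0.

Definition AN_generators (N : nat) : set pairfun :=
  [set f | exists k i t t',
    [/\ omega_iter_proto N i t, omega_iter_proto N i t' &
        f = conv (zpow k) (eN N i t t')]].

Definition kspan (G : set pairfun) : set pairfun :=
  [set f | exists n (a : 'I_n -> R[i]) (g : 'I_n -> pairfun),
    (forall j, G (g j)) /\ f = fun p => \sum_j a j * g j p].

Definition AN (N : nat) : set cstar :=
  cclosure [set cembed f | f in kspan (AN_generators N)].

Definition AT_pin : set cstar := cclosure (\bigcup_N AN N).

End Pinwheel.

(* Main.v *)
(* Let [I] be a closed ideal with a nonzero element [a]. Some value of [a] on [R_punc] is
   nonzero, of modulus [k] say, so an approximant [f] of [a] in the span of the generators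
   of level [N], with error [k / 8], is nonzero on some [V_N(p_i, t, t')], where it is a
   Laurent polynomial in [z], [f = z^(-d) p(z)].

   Every high-level prototile contains copies of [p_i] in orientations that form a long
   arithmetic progression of difference [2 theta], because a path of subtiles may change
   chirality early or late. Fix a subtile [q] of level [L = N + B + 1] and multiply [a] on
   both sides by Laurent multiples of partial isometries that lead from [q] to [t] and [t']
   in the [b]-th copy, with coefficients [conj(p(z))^(M+1)] and [p(z)^M]. The average
   over [b < B] replaces [f] by the average of [|p|^(2M+2)] along an orbit of an irrational
   rotation, which is nearly constant, equal to the sum [S1] of the squared moduli of the
   coefficients of [p^(M+1)]. By Cauchy-Schwarz the error [a - f] contributes at most
   [(k / 8) sqrt(S1 S0)], up to a small factor, with [S0] the same sum for [p^M]. As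
   [sup |p| >= 7 k / 8], some [M] has [S1 / S0] large enough for this to be at most
   [S1 / 4]. Thus the ideal contains an element of the corner of [q] at distance less than
   [1] from the projection [e_L(q, q)], hence this projection by a Neumann series. These
   projections have sum [1], so [I] is everything.

   Membership in the hull and continuity on [R_punc] are handled by ultrafilter limits of
   tilings and by the address of the origin in a supertile of level [N], which is unique since
   [omega] is injective on the hull, and locally constant up to rotation. *)
Require Import Defs.
From HB Require Import structures.
From mathcomp Require Import all_boot all_order all_algebra.
From mathcomp Require Import complex.
From mathcomp Require Import all_classical all_reals all_analysis.
From mathcomp Require Import ring lra zify.

Set Implicit Arguments.
Unset Strict Implicit.
Unset Printing Implicit Defensive.

Import Order.TTheory GRing.Theory Num.Theory numFieldNormedType.Exports.

Local Open Scope ring_scope.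
Local Open Scope classical_set_scope.

(** The obstacle is that [f] is known to be large at one point only; elsewhere it may be smaller
    than the error [k / 8], and no cut-off function near the good point is a Laurent polynomial. The
    quotient [S1 / S0] is the mean of [|p|^2] on the circle for the weight [|p|^(2 M)], and it tends
    to the maximum of [|p|^2] as [M] grows. Powers of [p] thus play the part of peak functions
    inside the span. Their suprema are not controlled, so all estimates on multipliers are made in
    mean square; averaging over the copies makes these means available at every single tiling, with
    a discrepancy that does not grow with [B].

    On the geometric side, finite local complexity holds only modulo isometries, so neighbouring
    tilings agree on a large ball after a small isometry. A puncture at the origin leaves no room
    for a translation, and what remains is a rotation [a] about the origin. Statements of continuity
    therefore carry this [a], which turns displacements, addresses and the index sets of
    convolutions at the same time. *)

Section CauchySchwarz.
Context {R : realDomainType}.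

(** Lagrange's identity: twice the difference of the two sides is the double sum of the squares of
    [a i * b j - a j * b i]. *)
Lemma cauchy_schwarz_sum (I : Type) (s : seq I) (a b : I -> R) :
  (\sum_(i <- s) a i * b i) ^+ 2 <=
  (\sum_(i <- s) a i ^+ 2) * (\sum_(i <- s) b i ^+ 2).
Proof.
have h : 0 <= \sum_(i <- s) \sum_(j <- s) (a i * b j - a j * b i) ^+ 2.
  by apply: sumr_ge0 => i _; apply: sumr_ge0 => j _; exact: sqr_ge0.
have e : \sum_(i <- s) \sum_(j <- s) (a i * b j - a j * b i) ^+ 2 =
    2 * ((\sum_(i <- s) a i ^+ 2) * (\sum_(i <- s) b i ^+ 2)) -
    2 * (\sum_(i <- s) a i * b i) ^+ 2.
  transitivity (\sum_(i <- s) (a i ^+ 2 * (\sum_(j <- s) b j ^+ 2) +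
      b i ^+ 2 * (\sum_(j <- s) a j ^+ 2) -
      2 * (a i * b i) * (\sum_(j <- s) a j * b j))).
    apply: eq_bigr => i _; rewrite !mulr_sumr -big_split -sumrB /=.
    by apply: eq_bigr => j _; ring.
  by rewrite sumrB big_split /= -!mulr_suml -mulr_sumr; ring.
by rewrite e in h; lra.
Qed.

End CauchySchwarz.

(** * Euclidean geometry of the plane and rotations *)

Section PlaneGeometry.
Context {R : realType}.

Local Notation plane := (planeOf R).

Lemma sum_sqr_ge0 (I : Type) (s : seq I) (a : I -> R) :
  0 <= \sum_(i <- s) a i ^+ 2.
Proof. by apply: sumr_ge0 => i _; exact: sqr_ge0. Qed.

Lemma fnorm_ge0 m n (A : 'M[R]_(m, n)) : 0 <= fnorm A.
Proof. exact: sqrtr_ge0. Qed.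

Lemma fnorm_sqr m n (A : 'M[R]_(m, n)) :
  fnorm A ^+ 2 = \sum_i \sum_j A i j ^+ 2.
Proof.
by rewrite sqr_sqrtr// sumr_ge0// => i _; exact: sum_sqr_ge0.
Qed.

Lemma fnorm0 m n : fnorm (0 : 'M[R]_(m, n)) = 0.
Proof.
rewrite /fnorm big1 ?sqrtr0// => i _; rewrite big1// => j _.
by rewrite mxE expr0n.
Qed.

Lemma fnormN m n (A : 'M[R]_(m, n)) : fnorm (- A) = fnorm A.
Proof.
by rewrite /fnorm; congr Num.sqrt; apply: eq_bigr => i _; apply: eq_bigr => j _;
  rewrite mxE sqrrN.
Qed.

Lemma fnormBC m n (A B : 'M[R]_(m, n)) : fnorm (A - B) = fnorm (B - A).
Proof. by rewrite -fnormN opprB. Qed.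

Lemma fnormD m n (A B : 'M[R]_(m, n)) : fnorm (A + B) <= fnorm A + fnorm B.
Proof.
rewrite -(ler_pXn2r (n := 2)) ?nnegrE ?addr_ge0 ?fnorm_ge0//.
rewrite sqrrD !fnorm_sqr !pair_bigA /=.
under eq_bigr => p _ do rewrite mxE sqrrD.
rewrite !big_split /= lerD2r lerD2l -mulr2n lerMn2r /=.
apply: le_trans (ler_norm _) _.
rewrite -(ler_pXn2r (n := 2)) ?nnegrE ?mulr_ge0 ?fnorm_ge0//.
rewrite real_normK ?num_real// exprMn !fnorm_sqr !pair_bigA /=.
exact: cauchy_schwarz_sum.
Qed.

Lemma fnormB_le m n (A B C : 'M[R]_(m, n)) :
  fnorm (A - C) <= fnorm (A - B) + fnorm (B - C).
Proof. by apply: le_trans (fnormD _ _); rewrite addrA subrK. Qed.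

Lemma fnormZ m n a (A : 'M[R]_(m, n)) : fnorm (a *: A) = `|a| * fnorm A.
Proof.
rewrite /fnorm -sqrtr_sqr -sqrtrM ?sqr_ge0//; congr Num.sqrt.
rewrite mulr_sumr; apply: eq_bigr => i _; rewrite mulr_sumr.
by apply: eq_bigr => j _; rewrite mxE exprMn.
Qed.

Lemma fnormM m n p (A : 'M[R]_(m, n)) (B : 'M[R]_(n, p)) :
  fnorm (A *m B) <= fnorm A * fnorm B.
Proof.
rewrite -(ler_pXn2r (n := 2)) ?nnegrE ?mulr_ge0 ?fnorm_ge0//.
rewrite exprMn !fnorm_sqr mulr_suml; apply: ler_sum => i _.
rewrite [X in _ <= _ * X]exchange_big /= mulr_sumr; apply: ler_sum => j _.
rewrite mxE; exact: cauchy_schwarz_sum.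
Qed.

Lemma fnorm_eq0 m n (A : 'M[R]_(m, n)) : fnorm A <= 0 -> A = 0.
Proof.
move=> h; have {h}: fnorm A ^+ 2 = 0.
  by rewrite (le_anti (_ : fnorm A <= 0 <= fnorm A)) ?expr0n// h fnorm_ge0.
rewrite fnorm_sqr pair_bigA /= => /eqP; rewrite psumr_eq0; last first.
  by move=> p _; exact: sqr_ge0.
move=> /allP h; apply/matrixP => i j; rewrite mxE.
have := h (i, j); rewrite mem_index_enum sqrf_eq0 => /(_ isT).
by move/eqP.
Qed.

Lemma fnorm_small_eq m n (A B : 'M[R]_(m, n)) :
  (forall e : R, 0 < e -> fnorm (A - B) < e) -> A = B.
Proof.
move=> h; apply/eqP; rewrite -subr_eq0; apply/eqP/fnorm_eq0.
by apply/ler_addgt0Pr => e e0; rewrite add0r; exact/ltW/h.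
Qed.

Lemma fnorm2_sqr (p : plane) : fnorm p ^+ 2 = p 0 0 ^+ 2 + p 1 0 ^+ 2.
Proof.
rewrite fnorm_sqr !big_ord_recl !big_ord0 /= !addr0.
by congr (_ + p _ _ ^+ 2); apply/val_inj.
Qed.

Lemma coord_le_fnorm (p : plane) i : `|p i 0| <= fnorm p.
Proof.
rewrite -(ler_pXn2r (n := 2)) ?nnegrE ?fnorm_ge0// real_normK ?num_real//.
rewrite fnorm_sqr (bigD1 i)//= big_ord_recl big_ord0 addr0 lerDl.
by apply: sumr_ge0 => j _; exact: sum_sqr_ge0.
Qed.

Lemma fnorm_lt2 (p : plane) a : `|p 0 0| < a -> `|p 1 0| < a -> fnorm p < 2 * a.
Proof.
move=> h0 h1; have a0 : 0 < a by exact: le_lt_trans h0.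
rewrite -(ltr_pXn2r (n := 2)) ?nnegrE ?fnorm_ge0 ?mulr_ge0 ?ltW//.
rewrite fnorm2_sqr -(real_normK (num_real (p 0 0))).
rewrite -(real_normK (num_real (p 1 0))).
have := normr_ge0 (p 0 0); have := normr_ge0 (p 1 0); nra.
Qed.

Lemma planeP (p q : plane) : p 0 0 = q 0 0 -> p 1 0 = q 1 0 -> p = q.
Proof.
move=> h0 h1; apply/matrixP => i j; rewrite ord1 {j}.
case: (unliftP 0 i) => [j ->|->//].
by rewrite ord1 (_ : lift _ _ = 1)//; apply/val_inj.
Qed.

Lemma pt0 (x y : R) : pt x y 0 0 = x. Proof. by rewrite mxE eqxx. Qed.
Lemma pt1 (x y : R) : pt x y 1 0 = y. Proof. by rewrite mxE. Qed.

Lemma rotmx_mul0 th (p : plane) :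
  (rotmx th *m p) 0 0 = cos th * p 0 0 - sin th * p 1 0.
Proof.
rewrite mxE !big_ord_recl big_ord0 addr0 !mxE /= mulNr.
by congr (_ - _ * p _ _); apply/val_inj.
Qed.

Lemma rotmx_mul1 th (p : plane) :
  (rotmx th *m p) 1 0 = sin th * p 0 0 + cos th * p 1 0.
Proof.
rewrite mxE !big_ord_recl big_ord0 addr0 !mxE /=.
by congr (_ + _ * p _ _); apply/val_inj.
Qed.

Lemma mx2P (A B : 'M[R]_2) : (forall p : plane, A *m p = B *m p) -> A = B.
Proof.
move=> h; apply/matrixP => i j.
have /matrixP/(_ i 0) := h (delta_mx j 0).
by rewrite -!colE !mxE.
Qed.

Lemma rotmx0 : rotmx (0 : R) = 1%:M.
Proof.
apply: mx2P => p; rewrite mul1mx; apply: planeP;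
  rewrite ?rotmx_mul0 ?rotmx_mul1 cos0 sin0; ring.
Qed.

Lemma rotmxD (a b : R) : rotmx (a + b) = rotmx a *m rotmx b.
Proof.
apply: mx2P => p; rewrite -mulmxA; apply: planeP;
  rewrite ?(rotmx_mul0, rotmx_mul1) cosD sinD; ring.
Qed.

Lemma rotmxNK (a : R) : rotmx (- a) *m rotmx a = 1%:M.
Proof. by rewrite -rotmxD addNr rotmx0. Qed.

Lemma rotmxKN (a : R) : rotmx a *m rotmx (- a) = 1%:M.
Proof. by rewrite -rotmxD subrr rotmx0. Qed.

Lemma rotNK n (a : R) (p : 'M[R]_(2, n)) : rotmx (- a) *m (rotmx a *m p) = p.
Proof. by rewrite mulmxA rotmxNK mul1mx. Qed.

Lemma rotKN n (a : R) (p : 'M[R]_(2, n)) : rotmx a *m (rotmx (- a) *m p) = p.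
Proof. by rewrite mulmxA rotmxKN mul1mx. Qed.

Lemma rotmx_eqD (a b a' b' : R) : rotmx a = rotmx a' -> rotmx b = rotmx b' ->
  rotmx (a + b) = rotmx (a' + b').
Proof. by rewrite !rotmxD => -> ->. Qed.

Lemma rotmx_addI (a b b' : R) : rotmx (a + b) = rotmx (a + b') -> rotmx b = rotmx b'.
Proof. by rewrite !rotmxD => /(congr1 (mulmx (rotmx (- a)))); rewrite !rotNK. Qed.

Lemma rotmx_cos (a : R) : rotmx a 0 0 = cos a. Proof. by rewrite mxE. Qed.
Lemma rotmx_sin (a : R) : rotmx a 1 0 = sin a. Proof. by rewrite mxE. Qed.

Lemma rotmx_eqP (a b : R) : rotmx a = rotmx b <-> cos a = cos b /\ sin a = sin b.
Proof.
split=> [h|[hc hs]]; last by apply/matrixP => i j; rewrite !mxE hc hs.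
by rewrite -!rotmx_cos -!rotmx_sin h.
Qed.

Lemma fnorm_rot n (a : R) (p : 'M[R]_(2, n)) : fnorm (rotmx a *m p) = fnorm p.
Proof.
rewrite /fnorm; congr Num.sqrt; rewrite exchange_big [RHS]exchange_big /=.
apply: eq_bigr => j _; rewrite !big_ord_recl !big_ord0 !addr0.
rewrite !mxE !big_ord_recl !big_ord0 !addr0 !mxE /=.
have := cos2Dsin2 a.
set c := cos a; set s := sin a; set x := p _ _; set y := p _ _.
move=> h; transitivity ((c ^+ 2 + s ^+ 2) * (x ^+ 2 + y ^+ 2)); first by ring.
by rewrite h mul1r.
Qed.

Lemma fnorm_rotB (a b : R) : fnorm (rotmx a - rotmx b) = fnorm (rotmx (a - b) - 1%:M).
Proof.
by rewrite -(fnorm_rot b (rotmx (a - b) - _)) mulmxBr mulmx1 -rotmxD (addrC b) subrK.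
Qed.

Lemma fnorm_rotN (a : R) : fnorm (rotmx (- a) - 1%:M) = fnorm (rotmx a - 1%:M).
Proof. by rewrite -(add0r (- a)) -fnorm_rotB fnormBC rotmx0. Qed.

Lemma fnorm_rotD (a b : R) :
  fnorm (rotmx (a + b) - 1%:M) <= fnorm (rotmx a - 1%:M) + fnorm (rotmx b - 1%:M).
Proof.
have -> : rotmx (a + b) - 1%:M =
    rotmx a *m (rotmx b - 1%:M) + (rotmx a - 1%:M).
  by rewrite mulmxBr mulmx1 rotmxD addrA subrK.
by apply: le_trans (fnormD _ _) _; rewrite fnorm_rot addrC.
Qed.

Lemma fnorm_rot_sub (a : R) (p : plane) :
  fnorm (rotmx a *m p - p) <= fnorm (rotmx a - 1%:M) * fnorm p.
Proof. by rewrite -{2}(mul1mx p) -mulmxBl; exact: fnormM. Qed.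

Lemma angle_exists (x y : R) : x ^+ 2 + y ^+ 2 = 1 ->
  exists th, cos th = x /\ sin th = y.
Proof.
move=> h; have x1 : -1 <= x <= 1 by apply/andP; split; nra.
have [y0|y0] := leP 0 y.
  exists (acos x); rewrite acosK//; split=> //.
  rewrite sin_acos// (_ : 1 - _ = y ^+ 2); last by rewrite -h; ring.
  by rewrite sqrtr_sqr ger0_norm.
exists (- acos x); rewrite cosN acosK// sinN sin_acos//; split=> //.
rewrite (_ : 1 - _ = y ^+ 2); last by rewrite -h; ring.
by rewrite sqrtr_sqr ltr0_norm// opprK.
Qed.

(** Matrices carry the topology of the largest entry; a Euclidean disc contains the coordinate ball
    of half its radius. *)
Lemma interior_eball (A : set plane) x :
  interior A x <-> exists2 r : R, 0 < r & eball x r `<=` A.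
Proof.
split.
  move=> /nbhs_ballP[r /= r0 h]; exists r => // y xy; apply: h.
  split=> // i j; rewrite ord1 -ball_normE /ball_ /=.
  by apply: le_lt_trans xy; rewrite fnormBC (le_trans _ (coord_le_fnorm _ i))// !mxE.
move=> [r r0 h]; apply/nbhs_ballP; exists (r / 2) => /=; first by rewrite divr_gt0.
move=> y [_ xy]; apply: h; rewrite /eball /= fnormBC.
have -> : r = 2 * (r / 2) by rewrite mulrC divfK ?pnatr_eq0.
by apply: fnorm_lt2; rewrite !mxE; move: (xy 0 0) (xy 1 0); rewrite -!ball_normE.
Qed.

End PlaneGeometry.

(** * Isometries acting on tiles and tilings *)

Section TileAction.
Context {R : realType}.

Local Notation plane := (planeOf R).
Local Notation tile := (tileOf R).
Local Notation tileset := (tilesetOf R).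
Implicit Types (a b th : R) (v w x : plane) (t s : tile) (P T : tileset).

(** Rotation comes before translation, unlike in [gact], so that composition and inverses follow the
    usual semidirect product formulas; [gactE] and [translateE] convert. *)
Definition tact th w t : tile := [set rotmx th *m p + w | p in t].
Definition sact th w T : tileset := [set tact th w t | t in T].

Lemma tact_comp a v b w t :
  tact a v (tact b w t) = tact (a + b) (rotmx a *m w + v) t.
Proof.
apply/seteqP; split=> [_ [_ [p tp <-] <-]|_ [p tp <-]].
  by exists p => //; rewrite mulmxDr mulmxA rotmxD addrA.
exists (rotmx b *m p + w); first by exists p.
by rewrite mulmxDr mulmxA rotmxD addrA.
Qed.

Lemma tact_id t : tact 0 0 t = t.
Proof.
apply/seteqP; split=> [_ [p tp <-]|p tp]; first by rewrite rotmx0 mul1mx addr0.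
by exists p => //; rewrite rotmx0 mul1mx addr0.
Qed.

Lemma tact_rot a b w t : rotmx a = rotmx b -> tact a w t = tact b w t.
Proof. by rewrite /tact => ->. Qed.

Lemma tactK a w t : tact (- a) (- (rotmx (- a) *m w)) (tact a w t) = t.
Proof. by rewrite tact_comp addNr subrr tact_id. Qed.

Lemma tactNK a w t : tact a w (tact (- a) (- (rotmx (- a) *m w)) t) = t.
Proof. by rewrite tact_comp subrr mulmxN rotKN addNr tact_id. Qed.

Lemma tact_inj a w : injective (tact a w).
Proof. by move=> t s /(congr1 (tact (- a) (- (rotmx (- a) *m w)))); rewrite !tactK. Qed.

Lemma sactP a w T t :
  sact a w T t <-> T (tact (- a) (- (rotmx (- a) *m w)) t).
Proof.
split=> [[s Ts <-]|Tt]; first by rewrite tactK.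
by exists (tact (- a) (- (rotmx (- a) *m w)) t) => //; rewrite tactNK.
Qed.

Lemma sact_tact a w T t : sact a w T (tact a w t) <-> T t.
Proof. by rewrite sactP tactK. Qed.

Lemma sact_comp a v b w T :
  sact a v (sact b w T) = sact (a + b) (rotmx a *m w + v) T.
Proof.
apply/seteqP; split=> [_ [_ [p tp <-] <-]|_ [p tp <-]].
  by exists p => //; rewrite tact_comp.
by rewrite -tact_comp; exists (tact b w p) => //; exists p.
Qed.

Lemma sact_id T : sact 0 0 T = T.
Proof.
apply/seteqP; split=> [_ [p tp <-]|p tp]; first by rewrite tact_id.
by exists p => //; rewrite tact_id.
Qed.

Lemma sact_rot a b w T : rotmx a = rotmx b -> sact a w T = sact b w T.
Proof. by rewrite /sact /tact => ->. Qed.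

Lemma sact0D v w T : sact 0 v (sact 0 w T) = sact 0 (w + v) T.
Proof. by rewrite sact_comp addr0 rotmx0 mul1mx. Qed.

Lemma gactE x th T : gact x th T = sact th (rotmx th *m x) T.
Proof.
have e t : [set rotmx th *m (p + x) | p in t] = tact th (rotmx th *m x) t.
  by rewrite /tact; under eq_fun do rewrite mulmxDr.
by rewrite /gact /sact; under eq_fun do rewrite e.
Qed.

Lemma translateE T x : translate T x = sact 0 x T.
Proof.
have e t : [set p + x | p in t] = tact 0 x t.
  by rewrite /tact rotmx0; under [in RHS]eq_fun do rewrite mul1mx.
by rewrite /translate /sact; under eq_fun do rewrite e.
Qed.

Lemma tact_eball a w t x r :
  tact a w t `<=` eball (rotmx a *m x + w) r <-> t `<=` eball x r.
Proof.
have e p : fnorm (rotmx a *m p + w - (rotmx a *m x + w)) = fnorm (p - x).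
  by rewrite opprD addrACA subrr addr0 -mulmxBr fnorm_rot.
split=> [h p tp|h _ [p tp <-]]; rewrite /eball /=.
  by rewrite -e; apply: h; exists p.
by rewrite e; exact: h.
Qed.

Lemma rot_eball a t r : tact a 0 t `<=` eball 0 r <-> t `<=` eball 0 r.
Proof. by rewrite -(tact_eball a 0 t 0) mulmx0 add0r. Qed.

Lemma eball_sub x y (r r' : R) : fnorm (x - y) + r <= r' -> eball x r `<=` eball y r'.
Proof.
move=> h p; rewrite /eball /= => xp; apply: le_lt_trans (fnormB_le p x y) _.
by move: h xp; lra.
Qed.

End TileAction.

(** * The two prototiles and the rigidity of their copies *)

Section Prototiles.
Context {R : realType} (c : planeOf R).

Local Notation plane := (planeOf R).
Local Notation tile := (tileOf R).
Local Notation tileset := (tilesetOf R).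
Local Notation lam := (@lambda R).

Lemma lambda_sqr : lam ^+ 2 = 5.
Proof. by rewrite sqr_sqrtr. Qed.

Lemma lambda_gt1 : 1 < lam.
Proof.
rewrite -(ltr_pXn2r (n := 2)) ?nnegrE ?sqrtr_ge0// lambda_sqr expr1n.
by rewrite ltr1n.
Qed.

Lemma lambda_gt0 : 0 < lam.
Proof. exact: lt_trans lambda_gt1. Qed.

Lemma lambda_neq0 : lam != 0. Proof. exact: lt0r_neq0 lambda_gt0. Qed.

(** The sign of the first coordinate in a prototile of type [i], and of the angles in its
    substitution. *)
Definition orient (i : bool) : R := if i then -1 else 1.

Lemma orient_sqr i : orient i ^+ 2 = 1.
Proof. by case: i; rewrite /orient ?sqrrN expr1n. Qed.

Lemma orientN i : orient (~~ i) = - orient i.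
Proof. by case: i; rewrite /orient ?opprK. Qed.

(* Coordinates along the legs, from the vertex at the right angle: the
   prototile is the image of [x, y >= 0, 2 x + y <= 2]. *)
Definition legpt (i : bool) (x y : R) : plane :=
  pt (orient i * ((1 - x + 2 * y) / lam - c 0 0)) ((2 - 2 * x - y) / lam - c 1 0).

Lemma protoP i p : proto c i p <->
  exists x y, [/\ 0 <= x, 0 <= y, 2 * x + y <= 2 & p = legpt i x y].
Proof.
have h q : [set p - c | p in @scaledDelta R] q <->
    exists x y, [/\ 0 <= x, 0 <= y, 2 * x + y <= 2 & q = legpt false x y].
  split.
    move=> [_ [_ [a [b [d [a0 b0 d0 abd ->]]]] <-] <-].
    exists a, (2 * b); split=> //; [by rewrite mulr_ge0|by lra|].
    have -> : d = 1 - a - b by rewrite -abd; ring.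
    by apply: planeP; rewrite /legpt ?pt0 ?pt1 !mxE /orient /=; field;
      exact: lambda_neq0.
  move=> [x [y [x0 y0 xy ->]]].
  exists (legpt false x y + c); last by rewrite addrK.
  exists (pt (1 - x + 2 * y) (2 - 2 * x - y)).
    exists x, (y / 2), (1 - x - y / 2); split=> //.
    - by rewrite divr_ge0.
    - by lra.
    - by ring.
    - by apply: planeP; rewrite !mxE /=; field.
  by apply: planeP; rewrite /legpt !mxE /orient /=; field; exact: lambda_neq0.
have refl_legpt x y : reflF (legpt false x y) = legpt true x y.
  by apply: planeP; rewrite /reflF /legpt !mxE /orient /=; ring.
case: i; rewrite /proto; last exact: h.
split=> [[_ /h[x [y [x0 y0 xy ->]]] <-]|[x [y [x0 y0 xy ->]]]].
  by exists x, y; rewrite refl_legpt.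
by exists (legpt false x y); rewrite ?refl_legpt//; apply/h; exists x, y.
Qed.

Lemma placedP i ph v p : placed c i ph v p <->
  exists x y, [/\ 0 <= x, 0 <= y, 2 * x + y <= 2 & p = rotmx ph *m legpt i x y + v].
Proof.
split=> [[q /protoP[x [y [x0 y0 xy ->]]] <-]|[x [y [x0 y0 xy ->]]]].
  by exists x, y.
by exists (legpt i x y) => //; apply/protoP; exists x, y.
Qed.

Lemma placedE i ph v : placed c i ph v = tact ph v (proto c i).
Proof. by []. Qed.

Lemma placed_rot i a b v : rotmx a = rotmx b -> placed c i a v = placed c i b v.
Proof. exact: tact_rot. Qed.

Lemma tact_placed a w i ph v :
  tact a w (placed c i ph v) = placed c i (a + ph) (rotmx a *m v + w).
Proof. exact: tact_comp. Qed.

Lemma proto_placed i : proto c i = placed c i 0 0.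
Proof. by rewrite placedE tact_id. Qed.

Lemma legpt_dist i x y x' y' :
  fnorm (legpt i x y - legpt i x' y') ^+ 2 = (x - x') ^+ 2 + (y - y') ^+ 2.
Proof.
rewrite fnorm2_sqr /legpt !mxE /=.
transitivity ((orient i ^+ 2 * ((x' - x) + 2 * (y - y')) ^+ 2 +
    (2 * (x' - x) + (y' - y)) ^+ 2) / lam ^+ 2); first by field; exact: lambda_neq0.
by rewrite orient_sqr lambda_sqr; field.
Qed.

Lemma colD (p q : plane) k : (p + q) k 0 = p k 0 + q k 0.
Proof. by rewrite mxE. Qed.

Lemma colN (p : plane) k : (- p) k 0 = - p k 0.
Proof. by rewrite mxE. Qed.

(** The coordinates range over [[0, 1]] and [[0, 2]], so a squared distance [5 = 1 + 4] is reached
    only between opposite corners of this box. That leaves two placements of the first two points,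
    and the distances to the third one exclude the placement along the diagonal outside the
    triangle. *)
Lemma right_triangle_rigid (x1 y1 x2 y2 x3 y3 : R) :
  0 <= x1 -> 0 <= y1 -> 2 * x1 + y1 <= 2 ->
  0 <= x2 -> 0 <= y2 -> 2 * x2 + y2 <= 2 ->
  0 <= x3 -> 0 <= y3 -> 2 * x3 + y3 <= 2 ->
  (x1 - x2) ^+ 2 + (y1 - y2) ^+ 2 = 5 ->
  (x1 - x3) ^+ 2 + (y1 - y3) ^+ 2 = 1 ->
  (x2 - x3) ^+ 2 + (y2 - y3) ^+ 2 = 4 ->
  [/\ x1 = 1, y1 = 0, x2 = 0, y2 = 2 & x3 = 0 /\ y3 = 0].
Proof.
move=> x10 y10 c1 x20 y20 c2 x30 y30 c3 d12 d13 d23.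
have hx : (x1 - x2) ^+ 2 <= 1 by nra.
have hy : (y1 - y2) ^+ 2 <= 4 by nra.
have ex : (x1 - x2) ^+ 2 = 1 by lra.
have ey : (y1 - y2) ^+ 2 = 4 by lra.
have /eqP : (x1 - x2 - 1) * (x1 - x2 + 1) = 0.
  by transitivity ((x1 - x2) ^+ 2 - 1); [ring|rewrite ex subrr].
rewrite mulf_eq0 => /orP[] /eqP h.
  have ex1 : x1 = 1 by lra.
  have ex2 : x2 = 0 by lra.
  have ey1 : y1 = 0 by lra.
  have ey2 : y2 = 2.
    have /eqP : (y2 - 2) * (y2 + 2) = 0.
      by transitivity (y2 ^+ 2 - 4); [ring|rewrite -ey ey1; ring].
    by rewrite mulf_eq0 => /orP[] /eqP ?; lra.
  subst; have e3 : x3 = 2 * y3 by lra.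
  have /eqP : y3 * (5 * y3 - 4) = 0.
    by rewrite e3 in d13; lra.
  by rewrite mulf_eq0 => /orP[] /eqP hy3; [split=> //; rewrite e3 hy3 mulr0|lra].
have ex1 : x1 = 0 by lra.
have ex2 : x2 = 1 by lra.
have ey2 : y2 = 0 by lra.
have ey1 : y1 = 2.
  have /eqP : (y1 - 2) * (y1 + 2) = 0.
    by transitivity (y1 ^+ 2 - 4); [ring|rewrite -ey ey2; ring].
  by rewrite mulf_eq0 => /orP[] /eqP ?; lra.
subst; have e3 : x3 = 2 * y3 - 3 by lra.
have /eqP : (y3 - 2) * (5 * y3 - 6) = 0.
  by rewrite e3 in d13; lra.
by rewrite mulf_eq0 => /orP[] /eqP hy3; lra.
Qed.

(** [puncture] and [angle] are well defined by this. The vertices of one copy lie in the other at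
    mutual distances [1], [2] and [lambda], so by rigidity they are its vertices in the same order;
    their images determine chirality, rotation and translation. *)
Lemma placed_inj i ph v i' ph' v' :
  placed c i ph v = placed c i' ph' v' ->
  [/\ i = i', rotmx ph = rotmx ph' & v = v'].
Proof.
move=> e.
have lift (x y : R) : 0 <= x -> 0 <= y -> 2 * x + y <= 2 -> exists x' y' : R,
    [/\ 0 <= x', 0 <= y', 2 * x' + y' <= 2 &
      rotmx ph' *m legpt i' x y + v' = rotmx ph *m legpt i x' y' + v].
  by move=> x0 y0 xy; apply/placedP; rewrite e; apply/placedP; exists x, y.
move: e => _.
have dist j th w x y x' y' : fnorm ((rotmx th *m legpt j x y + w) -
    (rotmx th *m legpt j x' y' + w)) ^+ 2 = (x - x') ^+ 2 + (y - y') ^+ 2.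
  by rewrite opprD addrACA subrr addr0 -mulmxBr fnorm_rot legpt_dist.
have [] := lift 1 0; try lra; move=> x1 [y1 [x10 y10 c1 e1]].
have [] := lift 0 2; try lra; move=> x2 [y2 [x20 y20 c2 e2]].
have [] := lift 0 0; try lra; move=> x3 [y3 [x30 y30 c3 e3]].
have d12 : (x1 - x2) ^+ 2 + (y1 - y2) ^+ 2 = 5.
  by rewrite -(dist i ph v) -e1 -e2 dist; ring.
have d13 : (x1 - x3) ^+ 2 + (y1 - y3) ^+ 2 = 1.
  by rewrite -(dist i ph v) -e1 -e3 dist; ring.
have d23 : (x2 - x3) ^+ 2 + (y2 - y3) ^+ 2 = 4.
  by rewrite -(dist i ph v) -e2 -e3 dist; ring.
have [? ? ? ? [? ?]] := right_triangle_rigid x10 y10 c1 x20 y20 c2 x30 y30 c3 d12 d13 d23.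
subst.
have coord (p q : plane) k : p = q -> p k 0 = q k 0 by move=> ->.
have a0 := coord _ _ 0 e1; have a1 := coord _ _ 1 e1.
have b0 := coord _ _ 0 e2; have b1 := coord _ _ 1 e2.
have d0 := coord _ _ 0 e3; have d1 := coord _ _ 1 e3.
move: a0 a1 b0 b1 d0 d1.
rewrite !colD !rotmx_mul0 !rotmx_mul1 /legpt !pt0 !pt1.
have cs := cos2Dsin2 ph; have l0 := lambda_neq0.
set C := cos ph in cs *; set S := sin ph in cs *.
set C' := cos ph'; set S' := sin ph'.
have -> : (1 - 1 + 2 * 0) / lam = 0 by field.
have -> : (2 - 2 * 1 - 0) / lam = 0 by field.
have -> : (1 - 0 + 2 * 2) / lam = 5 / lam by field.
have -> : (2 - 2 * 0 - 2) / lam = 0 by field.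
have -> : (1 - 0 + 2 * 0) / lam = 1 / lam by field.
have -> : (2 - 2 * 0 - 0) / lam = 2 / lam by field.
set il := lam^-1 => a0 a1 b0 b1 d0 d1.
have il0 : il != 0 by rewrite invr_neq0.
have key (u : R) : il * u = 0 -> u = 0.
  by move/eqP; rewrite mulf_eq0 (negbTE il0) => /eqP.
(* If the types differed, the hypotenuses would give [C' = - C] and [S' = - S], and the remaining
   edges would then give [C = S = 0]. *)
have ii : i = i'.
  case: i i' a0 a1 b0 b1 d0 d1 {lift e1 e2 e3} => [] [] //=; rewrite /orient;
    move=> a0 a1 b0 b1 d0 d1; exfalso.
    have h1 : C' = - C by suff : C' + C = 0; [lra|apply: key; lra].
    have h2 : S' = - S by suff : S' + S = 0; [lra|apply: key; lra].
    have h3 : C = 0 by apply: key; nra.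
    have h4 : S = 0 by apply: key; nra.
    by move: cs; rewrite h3 h4 expr0n /=; lra.
  have h1 : C' = - C by suff : C' + C = 0; [lra|apply: key; lra].
  have h2 : S' = - S by suff : S' + S = 0; [lra|apply: key; lra].
  have h3 : C = 0 by apply: key; nra.
  have h4 : S = 0 by apply: key; nra.
  by move: cs; rewrite h3 h4 expr0n /=; lra.
subst i'.
have er : rotmx ph = rotmx ph'.
  apply/rotmx_eqP; rewrite -/C -/C' -/S -/S'.
  by case: i a0 a1 b0 b1 d0 d1 {lift e1 e2 e3}; rewrite /orient;
    move=> a0 a1 b0 b1 d0 d1; (split; [suff : C - C' = 0; [lra|apply: key; lra]|
      suff : S - S' = 0; [lra|apply: key; lra]]).
by split=> //; move: e3; rewrite er => /addrI.
Qed.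

End Prototiles.

Class interior_puncture {R : realType} (c : planeOf R) : Prop :=
  puncture_interior : interior (@scaledDelta R) c.

(** * Convexity, reflection, and the five triangles as tiles *)

Section PlacedTiles.
Context {R : realType} (c : planeOf R).

Local Notation plane := (planeOf R).
Local Notation tile := (tileOf R).
Local Notation lam := (@lambda R).

Lemma placed_convex i ph v p q (s : R) : 0 <= s -> s <= 1 ->
  placed c i ph v p -> placed c i ph v q ->
  placed c i ph v ((1 - s) *: p + s *: q).
Proof.
move=> s0 s1 /placedP[x [y [x0 y0 xy ->]]] /placedP[x' [y' [x0' y0' xy' ->]]].
apply/placedP; exists ((1 - s) * x + s * x'), ((1 - s) * y + s * y'); split.
- by rewrite addr_ge0 ?mulr_ge0 ?subr_ge0.
- by rewrite addr_ge0 ?mulr_ge0 ?subr_ge0.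
- by nra.
have -> : legpt c i ((1 - s) * x + s * x') ((1 - s) * y + s * y') =
    (1 - s) *: legpt c i x y + s *: legpt c i x' y'.
  by apply: planeP; rewrite /legpt !mxE /=; field; exact: lambda_neq0.
rewrite mulmxDr -!scalemxAr !scalerDr addrACA; congr (_ + _).
by rewrite -scalerDl subrK scale1r.
Qed.

Definition reflT (t : tile) : tile := [set reflF p | p in t].

Lemma reflF_legpt i x y : reflF (legpt c i x y) = legpt c (~~ i) x y.
Proof.
apply: planeP; rewrite /reflF /legpt !(pt0, pt1)//.
by rewrite orientN mulNr.
Qed.

Lemma reflF_rot th p : reflF (rotmx th *m p) = rotmx (- th) *m reflF p :> plane.
Proof.
apply: planeP; rewrite /reflF ?pt0 ?pt1 ?rotmx_mul0 ?rotmx_mul1 ?pt0 ?pt1 cosN sinN;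
  ring.
Qed.

Lemma reflFD p q : reflF (p + q) = reflF p + reflF q :> plane.
Proof. by apply: planeP; rewrite /reflF !(colD, pt0, pt1) ?opprD. Qed.

Lemma reflF_K p : reflF (reflF p) = p :> plane.
Proof. by apply: planeP; rewrite /reflF !(pt0, pt1) ?opprK. Qed.

Lemma reflT_placed i ph v : reflT (placed c i ph v) = placed c (~~ i) (- ph) (reflF v).
Proof.
apply/seteqP; split=> [_ [p /placedP[x [y [x0 y0 xy ->]]] <-]|p].
  by apply/placedP; exists x, y; rewrite reflFD reflF_rot reflF_legpt.
move=> /placedP[x [y [x0 y0 xy ->]]].
exists (rotmx ph *m legpt c i x y + v); first by apply/placedP; exists x, y.
by rewrite reflFD reflF_rot reflF_legpt.
Qed.

Lemma triangle_placed (i : bool) ph v (a b d : plane) :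
  a = rotmx ph *m legpt c i 1 0 + v -> b = rotmx ph *m legpt c i 0 2 + v ->
  d = rotmx ph *m legpt c i 0 0 + v -> triangle a b d = placed c i ph v.
Proof.
move=> ea eb ed.
have e x y z : x + y + z = 1 ->
    x *: a + y *: b + z *: d = rotmx ph *m legpt c i x (2 * y) + v.
  move=> xyz; have ez : z = 1 - (x + y) by rewrite -xyz addrAC subrr add0r.
  have -> : legpt c i x (2 * y) = x *: legpt c i 1 0 + y *: legpt c i 0 2 +
      z *: legpt c i 0 0.
    by rewrite ez; apply: planeP; rewrite /legpt !mxE /=; field; exact: lambda_neq0.
  rewrite ea eb ed !mulmxDr -!scalemxAr !scalerDr.
  set A := x *: _; set B := y *: _; set D := z *: _.
  have -> : A + x *: v + (B + y *: v) + (D + z *: v) =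
      A + B + D + (x *: v + y *: v + z *: v).
    by rewrite (addrACA A) (addrACA (A + B)).
  by rewrite -!scalerDl xyz scale1r.
apply/seteqP; split=> p.
  move=> [x [y [z [x0 y0 z0 xyz ->]]]]; apply/placedP; exists x, (2 * y).
  by rewrite e//; split=> //; [rewrite mulr_ge0|lra].
move=> /placedP[x [y [x0 y0 xy ->]]]; exists x, (y / 2), (1 - x - y / 2); split=> //.
- by rewrite divr_ge0.
- by lra.
- by lra.
- by rewrite e; [congr (_ *m legpt _ _ _ _ + _); field|lra].
Qed.

Lemma triangleC12 (a b d : plane) : triangle a b d = triangle b a d.
Proof.
have h (a' b' d' : plane) : triangle a' b' d' `<=` triangle b' a' d'.
  move=> p [x [y [z [x0 y0 z0 xyz ->]]]]; exists y, x, z; split=> //.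
    by rewrite (addrC y).
  by rewrite (addrC (x *: _)).
by apply/seteqP; split; exact: h.
Qed.

Lemma triangleC23 (a b d : plane) : triangle a b d = triangle a d b.
Proof.
have h (a' b' d' : plane) : triangle a' b' d' `<=` triangle a' d' b'.
  move=> p [x [y [z [x0 y0 z0 xyz ->]]]]; exists x, z, y; split=> //.
    by rewrite addrAC.
  by rewrite addrAC.
by apply/seteqP; split; exact: h.
Qed.

(** Here [a b] is the hypotenuse and [d] the right angle. In the prototile of type [i] the edges
    from [a] are [(orient i * lam, 0)] and [(orient i / lam, 2 / lam)]; the hypotheses are these
    vectors turned by [ph]. *)
Lemma triangle_piece (i : bool) ph (a b d : plane) :
  b 0 0 - a 0 0 = orient i * lam * cos ph ->
  b 1 0 - a 1 0 = orient i * lam * sin ph ->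
  d 0 0 - a 0 0 = (orient i * cos ph - 2 * sin ph) / lam ->
  d 1 0 - a 1 0 = (orient i * sin ph + 2 * cos ph) / lam ->
  exists v, triangle a b d = placed c i ph v.
Proof.
move=> b0 b1 d0 d1; exists (a - rotmx ph *m legpt c i 1 0).
have l5 : lam = 5 / lam.
  by rewrite -lambda_sqr; field; exact: lambda_neq0.
have lE (x y : R) (z : R) : x - y = z -> x = z + y by move=> <-; rewrite subrK.
apply: triangle_placed; first by rewrite addrC subrK.
  apply: planeP; rewrite !colD.
    rewrite (lE _ _ _ b0) !colN !rotmx_mul0 /legpt !pt0 !pt1 {1}l5.
    by field; exact: lambda_neq0.
  rewrite (lE _ _ _ b1) !colN !rotmx_mul1 /legpt !pt0 !pt1 {1}l5.
  by field; exact: lambda_neq0.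
apply: planeP; rewrite !colD.
  rewrite (lE _ _ _ d0) !colN !rotmx_mul0 /legpt !pt0 !pt1.
  by field; exact: lambda_neq0.
rewrite (lE _ _ _ d1) !colN !rotmx_mul1 /legpt !pt0 !pt1.
by field; exact: lambda_neq0.
Qed.

Lemma piece_angle (x y : R) : x ^+ 2 + y ^+ 2 = 5 ->
  exists ph, cos ph = x / lam /\ sin ph = y / lam.
Proof.
move=> h; apply: angle_exists; rewrite !expr_div_n -mulrDl h lambda_sqr.
by field.
Qed.

(** Each triangle has a hypotenuse with integer coordinates and squared length [5]. The vertices are
    permuted to put the hypotenuse first, and the numbers given to [aux] are its coordinates times
    [orient i]. *)
Lemma five_placed s : five_triangles s -> exists i ph v, s = placed c i ph v.
Proof.
have l0 := lambda_neq0 (R := R); have l2 := lambda_sqr (R := R).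
have aux (i : bool) (x y : R) (a b d : plane) : x ^+ 2 + y ^+ 2 = 5 ->
    b 0 0 - a 0 0 = orient i * x -> b 1 0 - a 1 0 = orient i * y ->
    d 0 0 - a 0 0 = (orient i * x - 2 * y) / 5 ->
    d 1 0 - a 1 0 = (orient i * y + 2 * x) / 5 ->
    exists j ph v, triangle a b d = placed c j ph v.
  move=> /piece_angle[ph [ec es]] b0 b1 d0 d1; exists i, ph.
  by apply: triangle_piece; rewrite ?(b0, b1, d0, d1) ?ec ?es -?l2; field.
move=> [[[[]|]|]|] ->.
- by rewrite triangleC23; apply: (aux true (-1) (-2)); rewrite ?mxE /= /orient; lra.
- rewrite triangleC23 triangleC12 triangleC23.
  by apply: (aux true (-2) 1); rewrite ?mxE /= /orient; lra.
- by rewrite triangleC23; apply: (aux false 2 1); rewrite ?mxE /= /orient; lra.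
- rewrite triangleC23 triangleC12.
  by apply: (aux false (-2) (-1)); rewrite ?mxE /= /orient; lra.
- rewrite triangleC23 triangleC12 triangleC23.
  by apply: (aux true (-2) 1); rewrite ?mxE /= /orient; lra.
Qed.

End PlacedTiles.

(** * The substitution and the orientations occurring in its iterates *)

Section Substitution.
Context {R : realType} (c : planeOf R).

Local Notation plane := (planeOf R).
Local Notation tile := (tileOf R).
Local Notation tileset := (tilesetOf R).
Local Notation lam := (@lambda R).
Local Notation placed := (placed c).
Local Notation omega := (omega c).
Implicit Types (P T : tileset) (s t : tile) (v w : plane).

Lemma omega_protoF : omega_proto c false = sact 0 (- (lam *: c)) five_triangles.
Proof. exact: translateE. Qed.

Lemma omega_protoT : omega_proto c true = [set reflT s | s in omega_proto c false].
Proof. by []. Qed.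

Definition tiles P := forall t, P t -> exists i ph v, t = placed i ph v.

Lemma tiles_sact a w P : tiles P -> tiles (sact a w P).
Proof.
by move=> h _ [t /h[i [ph [v ->]]] <-]; rewrite tact_placed; do 3 eexists.
Qed.

Lemma tiles_omega_proto i : tiles (omega_proto c i).
Proof.
have hF : tiles (omega_proto c false).
  by rewrite omega_protoF; apply: tiles_sact => s /(five_placed c).
case: i => //; rewrite omega_protoT => _ [s /hF[i [ph [v ->]]] <-].
by rewrite reflT_placed; do 3 eexists.
Qed.

Lemma DeltaP (p : plane) : Delta p <->
  [/\ 0 <= p 1 0, p 1 0 <= 2 * p 0 0 & p 0 0 + 2 * p 1 0 <= 5].
Proof.
split.
  move=> [x [y [z [x0 y0 z0 xyz ->]]]]; rewrite !mxE /=; split; lra.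
move=> [h1 h2 h3]; exists (1 - p 0 0 / 5 - 2 * p 1 0 / 5),
  ((p 0 0 - p 1 0 / 2) / 5), (p 1 0 / 2); split; [lra|lra|lra|lra|].
by apply: planeP; rewrite !mxE /=; field.
Qed.

Lemma five_sub s : five_triangles s -> s `<=` (Delta : set plane).
Proof.
by move=> [[[[]|]|]|] -> p [x [y [z [x0 y0 z0 xyz ->]]]]; apply/DeltaP;
  rewrite !mxE /=; split; lra.
Qed.

Lemma reflFZ a (p : plane) : reflF (a *: p) = a *: reflF p.
Proof. by apply: planeP; rewrite /reflF !mxE /= ?mulrN. Qed.

Lemma omega_proto_sub i s : omega_proto c i s -> s `<=` [set lam *: p | p in proto c i].
Proof.
have hF u : omega_proto c false u -> u `<=` [set lam *: p | p in proto c false].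
  rewrite omega_protoF => -[t ft <-] _ [p tp <-].
  exists (lam^-1 *: p - c).
    by exists (lam^-1 *: p) => //; exists p => //; exact: five_sub tp.
  by rewrite scalerBr scalerA divff ?lambda_neq0// scale1r rotmx0 mul1mx.
case: i; last exact: hF.
rewrite omega_protoT => -[u /hF us <-] _ [p /us[q pq <-] <-].
by exists (reflF q); [exists q|rewrite reflFZ].
Qed.

Lemma finite_omega_proto i : finite_set (omega_proto c i).
Proof.
have hF : finite_set (omega_proto c false).
  rewrite omega_protoF; apply: finite_image.
  by do 4 (rewrite finite_setU; split; last exact: finite_set1); exact: finite_set1.
by case: i => //; rewrite omega_protoT; exact: finite_image.
Qed.

(** The angle [arctan (1/2)] modulo [2 pi]; by [thetaP] the default is never taken. *)
Definition theta : R := xget 0 [set th | cos th = 2 / lam /\ sin th = 1 / lam].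

Lemma thetaP : cos theta = 2 / lam /\ sin theta = 1 / lam.
Proof.
rewrite /theta; case: xgetP => [th -> //|h].
have [th hth] := @piece_angle R 2 1 ltac:(lra).
by case: (h th).
Qed.

(** The third of the five triangles is a translate of [R_theta(p_0)], and reflection reverses the
    angle for [p_1]. *)
Lemma omega_proto_self i : exists v, omega_proto c i (placed i (orient i * theta) v).
Proof.
have [v hv] : exists v, omega_proto c false (placed false theta v).
  have [ct st] := thetaP; have l0 := @lambda_neq0 R; have l2 := @lambda_sqr R.
  have [v hv] : exists v, triangle (pt 1 0) (pt 3 1) (pt 1 1) = placed false theta v.
    apply: triangle_piece; rewrite !mxE /= /orient ?ct ?st; try by field.
    by transitivity (5 / lam ^+ 2); [rewrite l2; lra|field].
  exists (v - lam *: c); rewrite omega_protoF.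
  exists (placed false theta v); last first.
    by rewrite tact_placed add0r rotmx0 mul1mx.
  by rewrite -hv triangleC23; left; left; right.
case: i; last by exists v; rewrite /orient mul1r.
exists (reflF v); rewrite omega_protoT; exists (placed false theta v) => //.
by rewrite reflT_placed /orient mulN1r.
Qed.

(** The first of the five triangles has the opposite chirality. Its angle is left unspecified, as
    [reach_progression] absorbs it in the constant [C]. *)
Lemma omega_proto_cross i : exists ph v, omega_proto c i (placed (~~ i) ph v).
Proof.
have [ph [v hv]] : exists ph v, omega_proto c false (placed true ph v).
  have [ph [cp sp]] := @piece_angle R (-1) (-2) ltac:(lra).
  have l0 := @lambda_neq0 R; have l2 := @lambda_sqr R.
  have [v hv] : exists v, triangle (pt 0 0) (pt 1 2) (pt 1 0) = placed true ph v.
    apply: triangle_piece; rewrite !mxE /= /orient ?cp ?sp; try by field.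
    by transitivity (5 / lam ^+ 2); [rewrite l2; lra|field].
  exists ph, (v - lam *: c); rewrite omega_protoF.
  exists (placed true ph v); last first.
    by rewrite tact_placed add0r rotmx0 mul1mx.
  by rewrite -hv triangleC23; left; left; left; left.
case: i; last by exists ph, v.
exists (- ph), (reflF v); rewrite omega_protoT; exists (placed true ph v) => //.
by rewrite reflT_placed.
Qed.

Lemma omega_tile_placed i ph v :
  omega_tile c (placed i ph v) = sact ph (lam *: v) (omega_proto c i).
Proof.
apply/seteqP; split=> s.
  move=> [j [ph' [v' [/placed_inj[<- er <-] [s0 h0 ->]]]]].
  by exists s0 => //; rewrite /tact er.
by move=> [s0 h0 <-]; exists i, ph, v; split=> //; exists s0.
Qed.

Lemma omega_tile_tact a w t : (exists i ph v, t = placed i ph v) ->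
  omega_tile c (tact a w t) = sact a (lam *: w) (omega_tile c t).
Proof.
move=> [i [ph [v ->]]]; rewrite tact_placed !omega_tile_placed sact_comp.
by rewrite scalerDr scalemxAr.
Qed.

Lemma tiles_omega P : tiles (omega P).
Proof.
move=> s [t _ [i [ph [v [_ [s0 /tiles_omega_proto[j [ph' [v' ->]]] ->]]]]]].
by rewrite -/(tact ph (lam *: v) _) tact_placed; do 3 eexists.
Qed.

Lemma omega_sact a w P : tiles P -> omega (sact a w P) = sact a (lam *: w) (omega P).
Proof.
move=> hP; apply/seteqP; split=> s.
  move=> [_ [t Pt <-]]; rewrite omega_tile_tact; last exact: hP.
  by move=> [u tu <-]; exists u => //; exists t.
move=> [u [t Pt tu] <-]; exists (tact a w t); first by exists t.
by rewrite omega_tile_tact; [exists u|exact: hP].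
Qed.

Lemma tiles_iter_omega N P : tiles P -> tiles (iter N omega P).
Proof. by case: N => // N _; rewrite iterS; exact: tiles_omega. Qed.

Lemma iter_omega_sact N a w P : tiles P ->
  iter N omega (sact a w P) = sact a (lam ^+ N *: w) (iter N omega P).
Proof.
move=> hP; elim: N => [|N IH]; first by rewrite scale1r.
by rewrite !iterS IH omega_sact ?scalerA -?exprS//; exact: tiles_iter_omega.
Qed.

Lemma tiles_proto i : tiles [set proto c i].
Proof. by move=> _ ->; exists i, 0, 0; rewrite -proto_placed. Qed.

Lemma tiles_omega_iter_proto N i : tiles (omega_iter_proto c N i).
Proof. by apply: tiles_iter_omega; exact: tiles_proto. Qed.

Lemma iter_omegaP N P s : tiles P -> (iter N omega P s <->
  exists i ph v t, [/\ P (placed i ph v), omega_iter_proto c N i t &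
    s = tact ph (lam ^+ N *: v) t]).
Proof.
move=> hP; elim: N s => [|N IH] s /=.
  split=> [Ps|[i [ph [v [t [Pv -> ->]]]]]]; last by rewrite scale1r.
  have [i [ph [v e]]] := hP _ Ps.
  by exists i, ph, v, (proto c i); rewrite -e scale1r.
split.
  move=> [_ /IH[i [ph [v [t [Pv ht ->]]]]]].
  rewrite omega_tile_tact; last exact: tiles_omega_iter_proto ht.
  move=> [u tu <-]; exists i, ph, v, u.
  by rewrite scalerA -exprS; split=> //; exists t.
move=> [i [ph [v [u [Pv [t ht tu] ->]]]]].
exists (tact ph (lam ^+ N *: v) t); first by apply/IH; exists i, ph, v, t.
rewrite omega_tile_tact; last exact: tiles_omega_iter_proto ht.
by exists u => //; rewrite scalerA -exprS.
Qed.

Lemma omega_iter_protoD N m i j ph v t :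
  omega_iter_proto c m j (placed i ph v) -> omega_iter_proto c N i t ->
  omega_iter_proto c (N + m) j (tact ph (lam ^+ N *: v) t).
Proof.
move=> hv ht; rewrite /omega_iter_proto iterD; apply/iter_omegaP.
  exact: tiles_omega_iter_proto.
by exists i, ph, v, t.
Qed.

Lemma omega_iter_proto_sub N i s :
  omega_iter_proto c N i s -> s `<=` [set lam ^+ N *: p | p in proto c i].
Proof.
elim: N s => [|N IH] s; first by move=> -> p pp; exists p => //; rewrite scale1r.
move=> [t ht]; have [j [ph [v et]]] := tiles_omega_iter_proto ht.
rewrite et omega_tile_placed => -[u /omega_proto_sub us <-] _ [p /us[q qj <-] <-].
have /(IH _ ht)[q' q'i e] : t (rotmx ph *m q + v) by rewrite et; exists q.
by exists q' => //; rewrite exprS -scalerA e scalerDr scalemxAr.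
Qed.

Lemma omega_tile_sub N i ph v t :
  omega_iter_proto c N i t ->
  tact ph (lam ^+ N *: v) t `<=` [set lam ^+ N *: p | p in placed i ph v].
Proof.
move=> /omega_iter_proto_sub ht _ [p /ht[q qi <-] <-].
by exists (rotmx ph *m q + v); [exists q|rewrite scalerDr scalemxAr].
Qed.

Lemma finite_omega_iter_proto N i : finite_set (omega_iter_proto c N i).
Proof.
elim: N => [|N IH]; first exact: finite_set1.
apply: bigcup_finite => // t /tiles_omega_iter_proto[j [ph [v ->]]].
by rewrite omega_tile_placed; apply: finite_image; exact: finite_omega_proto.
Qed.

Definition reach m j i ph := exists v, omega_iter_proto c m j (placed i ph v).

Lemma reach_trans m m' j i k ph ph' :
  reach m j i ph -> reach m' i k ph' -> reach (m' + m) j k (ph + ph').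
Proof.
move=> [v hv] [v' hv']; have := omega_iter_protoD hv hv'.
by rewrite tact_placed; eexists; eassumption.
Qed.

Lemma reach1 j i ph v : omega_proto c j (placed i ph v) -> reach 1 j i ph.
Proof.
move=> h; exists v; exists (proto c j) => //.
rewrite proto_placed omega_tile_placed scaler0.
by exists (placed i ph v); rewrite ?tact_id.
Qed.

Lemma reach_self j m : reach m j j (m%:R * (orient j * theta)).
Proof.
elim: m => [|m IH]; first by exists 0; rewrite mul0r -proto_placed.
have [v /reach1 h] := omega_proto_self j.
by have := reach_trans IH h; rewrite add1n -natr1 mulrDl mul1r.
Qed.

(* The time spent in the opposite chirality is a free parameter, and it
   changes the angle by multiples of [2 * theta]. *)
Lemma reach_progression i j B : exists C, forall b, (b < B)%N ->
  reach B.+1 j i (C - (2 * b)%:R * (orient j * theta)).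
Proof.
have [ph1 [v1 /reach1 h1]] := omega_proto_cross j.
have [ph2 [v2 /reach1 h2]] := omega_proto_cross (~~ j).
rewrite negbK in h2.
have [->|ij] := eqVneq i j.
  exists (B.-1%:R * (orient j * theta) + ph1 + ph2) => b bB.
  have bB' : (b <= B.-1)%N by case: B bB.
  have eB : B.+1 = (1 + (b + (1 + (B.-1 - b))))%N.
    by rewrite !add1n addnS subnKC// prednK//; case: B bB {bB'}.
  have a1 := reach_trans (reach_trans (reach_trans (reach_self j (B.-1 - b)) h1)
    (reach_self (~~ j) b)) h2.
  rewrite eB; move: a1; congr (reach _ _ _ _).
  by rewrite natrB// orientN natrM; ring.
have {ij} -> : i = ~~ j by move: ij; case: (i); case: (j).
exists (B%:R * (orient j * theta) + ph1) => b bB.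
have a1 := reach_trans (reach_trans (reach_self j (B - b)) h1) (reach_self (~~ j) b).
have -> : B.+1 = (b + (1 + (B - b)))%N by rewrite add1n addnS subnKC// ltnW.
move: a1; congr (reach _ _ _ _).
by rewrite natrB ?(ltnW bB)// orientN natrM; ring.
Qed.

Lemma puncture_placed i ph v : puncture c (placed i ph v) = v.
Proof.
apply: xget_unique; first by exists i, ph.
by move=> w [j [ph' /placed_inj[]]].
Qed.

(** [angle] picks some representative modulo [2 pi]; here and later angles are compared through
    their rotation matrices. *)
Lemma angle_placed i ph v : rotmx (angle c (placed i ph v)) = rotmx ph.
Proof.
rewrite /angle; set A := [set _ | _].
have : A (xget 0 A) by apply: xgetPex; exists ph, i, v.
by move=> [j [w /placed_inj[_ <- _]]].
Qed.

Lemma puncture_tact a w t : (exists i ph v, t = placed i ph v) ->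
  puncture c (tact a w t) = rotmx a *m puncture c t + w.
Proof. by move=> [i [ph [v ->]]]; rewrite tact_placed !puncture_placed. Qed.

Lemma angle_tact a w t : (exists i ph v, t = placed i ph v) ->
  rotmx (angle c (tact a w t)) = rotmx (a + angle c t).
Proof.
move=> [i [ph [v ->]]]; rewrite tact_placed angle_placed.
by apply: rotmx_eqD => //; rewrite angle_placed.
Qed.

End Substitution.

(** * Separation of punctures, and agreement of tilings up to rotation *)

Section InteriorPuncture.
Context {R : realType} (c : planeOf R) {hc : interior_puncture c}.

Local Notation plane := (planeOf R).
Local Notation tile := (tileOf R).
Local Notation tileset := (tilesetOf R).
Local Notation placed := (placed c).
Local Notation puncture := (puncture c).
Local Notation tile0 := (@tile0 R).
Local Notation tiling := (tiling c).
Implicit Types (P T S : tileset) (s t : tile) (v w : plane).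

(** The radius of a disc about the puncture inside both prototiles. It also separates the punctures
    of a tiling, by [tiling_separated]. *)
Definition rho : R := xget 1 [set r | 0 < r /\ forall i, eball 0 r `<=` proto c i].

Lemma rhoP : 0 < rho /\ forall i, eball 0 rho `<=` proto c i.
Proof.
rewrite /rho; set A := [set _ | _]; suff : A (xget 1 A) by [].
apply: xgetPex; have [r r0 hr] := (interior_eball _ _).1 puncture_interior.
have hF : eball 0 r `<=` proto c false.
  move=> p; rewrite /eball /= subr0 => pr; exists (p + c); last by rewrite addrK.
  by apply: hr; rewrite /eball /= addrK.
exists r; split=> // -[] // p pr; exists (reflF p); last exact: reflF_K.
apply: hF; move: pr; rewrite /eball /= !subr0 => pr.
rewrite -(ltr_pXn2r (n := 2)) ?nnegrE ?fnorm_ge0 ?(ltW r0)//.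
rewrite fnorm2_sqr /reflF pt0 pt1 sqrrN -fnorm2_sqr.
by rewrite ltr_pXn2r// nnegrE ?fnorm_ge0// ltW.
Qed.

Lemma rho_gt0 : 0 < rho. Proof. exact: rhoP.1. Qed.

Lemma placed_ball i ph v : eball v rho `<=` placed i ph v.
Proof.
move=> p; rewrite /eball /= => pv; exists (rotmx (- ph) *m (p - v)).
  by apply: rhoP.2; rewrite /eball /= subr0 fnorm_rot.
by rewrite rotKN subrK.
Qed.

Lemma placed_self i ph v : placed i ph v v.
Proof. by apply: placed_ball; rewrite /eball /= subrr fnorm0 rho_gt0. Qed.

(** The diameter of a tile is [lambda], rounded up to [3] here and in all radii below. *)
Lemma placed_radius i ph v p : placed i ph v p -> fnorm (p - v) < 3.
Proof.
move=> /placedP[x [y [x0 y0 xy ->]]].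
have /placedP[x' [y' [x0' y0' xy' e]]] := placed_self i ph v.
rewrite {2}e opprD addrACA subrr addr0 -mulmxBr fnorm_rot.
rewrite -(ltr_pXn2r (n := 2)) ?nnegrE ?fnorm_ge0// legpt_dist.
suff : (x - x') ^+ 2 + (y - y') ^+ 2 <= 5 by lra.
have h1 : (x - x') ^+ 2 <= 1 by move: x0 y0 xy x0' y0' xy'; clear; nra.
have h2 : (y - y') ^+ 2 <= 4 by move: x0 y0 xy x0' y0' xy'; clear; nra.
by lra.
Qed.

Lemma placed_sub_eball i ph v x (r : R) : fnorm (v - x) + 3 <= r -> placed i ph v `<=` eball x r.
Proof.
move=> h p /placed_radius hp; rewrite /eball /=.
by apply: le_lt_trans (fnormB_le p v x) _; move: h hp; lra.
Qed.

Lemma placed_sub_eball0 i ph v (r : R) : fnorm v + 3 <= r -> placed i ph v `<=` eball 0 r.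
Proof. by move=> h; apply: placed_sub_eball; rewrite subr0. Qed.

Lemma placed_in_eball i ph v x (r : R) : placed i ph v `<=` eball x r -> fnorm (v - x) < r.
Proof. by move=> /(_ _ (placed_self i ph v)). Qed.

Lemma tiling_tiles T : tiling T -> tiles c T.
Proof. by case. Qed.

(** The point [q] is interior to both tiles. *)
Lemma tiling_disjoint T t s p q (r r' : R) : tiling T -> T t -> T s ->
  0 < r -> eball p r `<=` t -> 0 < r' -> eball q r' `<=` s ->
  fnorm (p - q) < r -> t = s.
Proof.
move=> [_ _ _ disj] Tt Ts r0 pt r'0 qs pq.
case: (pselect (t = s)) => // ts; exfalso.
have /seteqP[/(_ q) h _] := disj _ _ Tt Ts ts; apply: h; split.
  apply/interior_eball; exists (r - fnorm (p - q)); first by rewrite subr_gt0.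
  apply: subset_trans pt; apply: eball_sub.
  by rewrite fnormBC addrC subrK.
by apply/interior_eball; exists r'.
Qed.

Lemma tiling_separated T i ph v j ph' v' : tiling T ->
  T (placed i ph v) -> T (placed j ph' v') -> fnorm (v - v') < rho ->
  placed i ph v = placed j ph' v'.
Proof.
move=> hT h h' vv; apply: (tiling_disjoint (p := v) (q := v') hT h h' rho_gt0 _ rho_gt0 _ vv);
  exact: placed_ball.
Qed.

Lemma tile0_placed T i ph : tiling T -> T (placed i ph 0) -> tile0 T = placed i ph 0.
Proof.
move=> hT h; apply: xget_unique; first by split=> //; exact: placed_self.
move=> s [Ts s0]; have [j [ph' [v es]]] := tiling_tiles hT Ts; subst s; symmetry.
(* The tile [s] is convex, so its homothets towards [0] give balls inside [s]
   arbitrarily close to [0]. *)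
pose e := rho / (rho + fnorm v + 1).
have d0 : 0 < rho + fnorm v + 1 by have := rho_gt0; have := fnorm_ge0 v; lra.
have e0 : 0 < e by rewrite divr_gt0// rho_gt0.
have e1 : e <= 1.
  by rewrite ler_pdivrMr// mul1r; have := fnorm_ge0 v; lra.
apply: (tiling_disjoint (p := 0) (q := e *: v) (r := rho) (r' := e * rho) hT h Ts).
- exact: rho_gt0.
- exact: placed_ball.
- by rewrite mulr_gt0// rho_gt0.
- move=> p; rewrite /eball /= => pv.
  have -> : p = (1 - e) *: 0 + e *: (e^-1 *: p).
    by rewrite scaler0 add0r scalerA divff ?scale1r// gt_eqF.
  apply: placed_convex => //; first exact: ltW.
  apply: placed_ball; rewrite /eball /=.
  have -> : e^-1 *: p - v = e^-1 *: (p - e *: v).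
    by rewrite scalerBr scalerA mulVf ?scale1r// gt_eqF.
  by rewrite fnormZ gtr0_norm ?invr_gt0// mulrC ltr_pdivrMr// mulrC.
rewrite sub0r fnormN fnormZ gtr0_norm// /e mulrAC ltr_pdivrMr// ltr_pM2l ?rho_gt0//.
by have := rho_gt0; lra.
Qed.

(** Pigeonhole on a grid of mesh [rho / 2]: two punctures in one cell are closer than [rho], so they
    belong to the same tile, and finitely many cells meet the ball. *)
Lemma finite_inball T x (r : R) : tiling T -> finite_set (inball T x r).
Proof.
move=> hT; pose d := rho / 2; have d0 : 0 < d by rewrite divr_gt0 ?rho_gt0.
pose cell (y : R) := Num.truncn ((y + r) / d); pose K := (Num.truncn (2 * r / d)).+1.
pose f t := (cell ((puncture t - x) 0 0), cell ((puncture t - x) 1 0)).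
have ucell (y : R) : `|y| < r -> 0 <= (y + r) / d.
  by rewrite ltr_norml => /andP[h1 h2]; rewrite divr_ge0 ?(ltW d0)//; move: h1; lra.
have cellK (y : R) : `|y| < r -> (cell y < K)%N.
  move=> yr; have /andP[h3 _] := truncn_itv (ucell _ yr).
  have r0 : 0 <= 2 * r / d.
    by rewrite divr_ge0 ?(ltW d0)// mulr_ge0//; exact: le_trans (ltW yr).
  have /andP[_ h4] := truncn_itv r0.
  rewrite -(ltr_nat R); apply: le_lt_trans h3 (le_lt_trans _ h4).
  by rewrite ler_pM2r ?invr_gt0//; move: yr; rewrite ltr_norml => /andP[]; lra.
have cell_eq (y y' : R) : `|y| < r -> `|y'| < r -> cell y = cell y' -> `|y - y'| < d.
  move=> yr yr' e; have /andP[h1 h2] := truncn_itv (ucell _ yr).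
  have /andP[h3 h4] := truncn_itv (ucell _ yr').
  rewrite -/(cell y) e in h1 h2; rewrite -/(cell y') -natr1 in h3 h4 *.
  rewrite -natr1 in h2.
  move: h1 h2 h3 h4; rewrite ler_pdivlMr// ltr_pdivrMr// ler_pdivlMr// ltr_pdivrMr//.
  by move: ((cell y')%:R : R) => k h1 h2 h3 h4; rewrite ltr_norml; apply/andP; split; lra.
have small t k : inball T x r t -> `|(puncture t - x) k 0| < r.
  move=> [Tt tr]; have [i [ph [v et]]] := tiling_tiles hT Tt.
  apply: le_lt_trans (coord_le_fnorm _ _) _.
  by move: tr; rewrite et puncture_placed; exact: placed_in_eball.
have finj : {in inball T x r &, injective f}.
  move=> t s /set_mem ht /set_mem hs [e0 e1]; have [Tt _] := ht; have [Ts _] := hs.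
  have h0 := cell_eq _ _ (small _ _ ht) (small _ _ hs) e0.
  have h1 := cell_eq _ _ (small _ _ ht) (small _ _ hs) e1.
  have [i [ph [v et]]] := tiling_tiles hT Tt.
  have [j [ph' [v' es]]] := tiling_tiles hT Ts.
  move: h0 h1; rewrite et es !puncture_placed => h0 h1.
  apply: (tiling_separated hT); rewrite -?et -?es//.
  have -> : v - v' = (v - x) - (v' - x) by rewrite opprB addrA subrK.
  rewrite (_ : rho = 2 * d); last by rewrite /d mulrC divfK ?pnatr_eq0.
  by apply: fnorm_lt2; rewrite mxE [X in _ + X]mxE.
rewrite -(eq_finite_set (inj_card_eq finj)).
apply: (sub_finite_set (B := `I_K `*` `I_K)); last exact: finite_setX.
by move=> _ [t ht <-]; split; apply: cellK; exact: small.
Qed.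

Lemma tiling_sact a w T : tiling T -> tiling (sact a w T).
Proof.
move=> hT; have hp := tiling_tiles hT; case: hT => cT _ covT disT; split.
- exact: card_le_trans (card_image_le _ _) cT.
- exact: tiles_sact.
- apply/seteqP; split=> // p _.
  have : (\bigcup_(t in T) t) (rotmx (- a) *m (p - w)) by rewrite covT.
  move=> [t Tt tp]; exists (tact a w t); first by exists t.
  by exists (rotmx (- a) *m (p - w)) => //; rewrite rotKN subrK.
move=> _ _ [t Tt <-] [s Ts <-] ts; apply/seteqP; split=> // p [].
move=> /interior_eball[r r0 hr] /interior_eball[r' r'0 hr'].
have ts' : t <> s by move=> e; apply: ts; rewrite e.
have /seteqP[/(_ (rotmx (- a) *m (p - w))) h _] := disT _ _ Tt Ts ts'; apply: h.
have inv t' q (d : R) : eball q d `<=` tact a w t' ->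
    eball (rotmx (- a) *m (q - w)) d `<=` t'.
  move=> h y; rewrite /eball /= => yq.
  have /h[y' ty' /addIr/(congr1 (mulmx (rotmx (- a))))] : eball q d (rotmx a *m y + w).
    rewrite /eball /= -(rotKN a (q - w)) in yq *.
    have -> : rotmx a *m y + w - q = rotmx a *m (y - rotmx (- a) *m (q - w)).
      by rewrite mulmxBr rotKN opprB addrA.
    by rewrite fnorm_rot; move: yq; rewrite rotNK.
  by rewrite !rotNK => <-.
by split; apply/interior_eball; [exists r|exists r'] => //; exact: inv.
Qed.

(** Only rotations about the origin are allowed, without the translations of [within]; this suffices
    for tilings with a puncture at the origin, by [dGamma_near_by]. *)
Definition agree (a r : R) (S S' : tileset) :=
  forall t, t `<=` eball 0 r -> (S t <-> S' (tact a 0 t)).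

Lemma tact0N a t : tact (- a) 0 (tact a 0 t) = t.
Proof. by rewrite tact_comp addNr mulmx0 add0r tact_id. Qed.

Lemma tactN0 a t : tact a 0 (tact (- a) 0 t) = t.
Proof. by rewrite tact_comp subrr mulmx0 add0r tact_id. Qed.

Lemma agree_sym a r S S' : agree a r S S' -> agree (- a) r S' S.
Proof. by move=> h t /(rot_eball (- a)) /h; rewrite tactN0 => h'; split=> /h'. Qed.

Lemma agree_trans a b r S S' S'' :
  agree a r S S' -> agree b r S' S'' -> agree (b + a) r S S''.
Proof.
move=> h h' t tr; rewrite h//; have /(rot_eball a)/h' -> := tr.
by rewrite tact_comp mulmx0 addr0.
Qed.

Lemma agree_le a r r' S S' : r' <= r -> agree a r S S' -> agree a r' S S'.
Proof.
move=> rr h t tr; apply: h; apply: subset_trans tr _; apply: eball_sub.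
by rewrite subrr fnorm0 add0r.
Qed.

Lemma agree_refl r S : agree 0 r S S.
Proof. by move=> t _; rewrite tact_id. Qed.

Lemma agree_rot a b r S S' : rotmx a = rotmx b -> agree a r S S' -> agree b r S S'.
Proof. by move=> e h t /h; rewrite (tact_rot _ _ e). Qed.

Lemma agree_shift a r k v S S' : fnorm v <= k -> agree a r S S' ->
  agree a (r - k) (sact 0 v S) (sact 0 (rotmx a *m v) S').
Proof.
move=> vk h t tr; rewrite !sactP oppr0 !rotmx0 !mul1mx h.
  by rewrite !tact_comp addr0 add0r mulmxN rotmx0 mul1mx addr0 add0r.
apply: subset_trans (_ : eball (- v) (r - k) `<=` _); last first.
  by apply: eball_sub; rewrite subr0 fnormN addrC -lerBrDr lerD2l lerN2.
have := tact_eball 0 (- v) t 0 (r - k); rewrite rotmx0 mul1mx add0r.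
by move=> [_]; exact.
Qed.

Lemma agree_sact a r S : agree a r S (sact a 0 S).
Proof. by move=> t _; rewrite sact_tact. Qed.

Lemma agree_inball a r S S' : agree a r S S' ->
  inball (sact a 0 S) 0 r = inball S' 0 r.
Proof.
move=> h; apply/seteqP; split=> t [].
  move=> [s Ss <-] tr; split=> //; apply/h => //; exact/(rot_eball a).
move=> St tr; split=> //; exists (tact (- a) 0 t); last by rewrite tactN0.
by apply/(agree_sym h).
Qed.

Lemma inball_agree a r S S' :
  inball (sact a 0 S) 0 r = inball S' 0 r -> agree a r S S'.
Proof.
move=> e t tr; have tr' : tact a 0 t `<=` eball 0 r by exact/rot_eball.
split=> [St|S't].
  have : inball (sact a 0 S) 0 r (tact a 0 t) by split=> //; exact/sact_tact.
  by rewrite e => -[].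
have : inball S' 0 r (tact a 0 t) by [].
by rewrite -e => -[/sact_tact].
Qed.

(** Inflation moves points away from the origin, so a tile of the iterate within [r - 6] comes from
    a tile of [S] that meets the ball of radius [r - 6]. Its puncture is at most [3] further out and
    the whole tile at most [6], hence it lies where [S] and [S'] agree. *)
Lemma agree_omega N a r S S' : tiles c S -> tiles c S' -> agree a r S S' ->
  agree a (r - 6) (iter N (omega c) S) (iter N (omega c) S').
Proof.
have half b P P' : tiles c P -> tiles c P' -> agree b r P P' ->
    forall t, t `<=` eball 0 (r - 6) -> iter N (omega c) P t ->
    iter N (omega c) P' (tact b 0 t).
  move=> hP hP' h t tr /(iter_omegaP _ _ hP)[i [ph [v [s [Pv hs et]]]]].
  apply/(iter_omegaP _ _ hP'); exists i, (b + ph), (rotmx b *m v), s; split=> //.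
    have -> : placed i (b + ph) (rotmx b *m v) = tact b 0 (placed i ph v).
      by rewrite tact_placed addr0.
    apply/h => //; apply: placed_sub_eball0.
    have [j [ph' [v' es]]] := tiles_omega_iter_proto hs.
    have tv : t (rotmx ph *m v' + lambda ^+ N *: v).
      by rewrite et; exists v' => //; rewrite es; exact: placed_self.
    have := tr _ tv; rewrite /eball /= subr0.
    move: tv; rewrite {1}et => /(omega_tile_sub hs)[p pv <-].
    rewrite fnormZ ger0_norm ?exprn_ge0 ?(ltW lambda_gt0)// => pr.
    have := placed_radius pv => pv3.
    have : fnorm p <= lambda ^+ N * fnorm p.
      by rewrite ler_peMl ?fnorm_ge0// exprn_ege1// ltW// lambda_gt1.
    have := fnormB_le v p 0; rewrite !subr0 (fnormBC v p).
    by move: pv3 pr; lra.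
  by rewrite et tact_comp addr0 scalemxAr.
move=> hS hS' h t tr; split; first exact: half.
move=> h'; have := half _ _ _ hS' hS (agree_sym h) (tact a 0 t).
by rewrite tact0N; apply=> //; exact/rot_eball.
Qed.

End InteriorPuncture.

(** * Limits along ultrafilters *)

Section Ultrafilters.

Lemma ultra_finite (X : Type) (Y : eqType) (F : set_system X) {UF : UltraFilter F}
    (A : set Y) (P : Y -> set X) :
  finite_set A -> F (\bigcup_(a in A) P a) -> exists2 a, A a & F (P a).
Proof.
move=> /finite_seqP[s ->]; elim: s => [|a s IH].
  move=> h; exfalso; apply: (@filter_not_empty _ F).
  by apply: filterS h => x [].
move=> h; have [Fa|Fa] := in_ultra_setVsetC (P a) UF.
  by exists a => //=; rewrite inE eqxx.
have [|b bs Fb] := IH; last by exists b => //=; rewrite inE orbC; apply/orP; left.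
apply: filterS (filterI h Fa) => x [[b /=]].
rewrite inE => /orP[/eqP -> //|bs Pb _].
by exists b.
Qed.

Lemma ultra_cvg_bounded (R : realType) (X : Type) (F : set_system X)
    {UF : UltraFilter F} (f : X -> R) (M : R) :
  F [set x | `|f x| <= M] ->
  exists l, forall e : R, 0 < e -> F [set x | `|f x - l| < e].
Proof.
move=> hF; have FF : ProperFilter (fmap f F) by exact: fmap_proper_filter.
have [|l [_ hl]] := @segment_compact R (- M) M (fmap f F) FF.
  by apply: (@filterS _ F _ _ _ _ hF) => x /= xM; rewrite in_itv /= -ler_norml.
exists l => e e0; have [//|h] := in_ultra_setVsetC [set x | `|f x - l| < e] UF.
have /hl : fmap f F [set y | ~ `|y - l| < e] by [].
move=> /(_ (ball l e)) []; first exact: nbhsx_ballx.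
by move=> y [/= h1]; rewrite -ball_normE /ball_ /= distrC.
Qed.

End Ultrafilters.

(** * The tiling metric in terms of agreement up to rotation *)

Section DGamma.
Context {R : realType}.

Local Notation plane := (planeOf R).
Local Notation tileset := (tilesetOf R).
Implicit Types (T S : tileset).

Lemma dGamma_within T1 T2 (d : R) : dGamma T1 T2 < d -> d <= 1 ->
  exists e : R, [/\ 0 < e, e < d & Defs.within e T1 T2].
Proof.
move=> h; have [|e] := inf_lt _ h; first by exists 1; right.
move=> [[/andP[e0 e1] he] ed _|-> d1 /(lt_le_trans d1)].
  by exists e.
by rewrite ltxx.
Qed.

Lemma within_dGamma T1 T2 (e : R) : 0 < e -> e < 1 -> Defs.within e T1 T2 -> dGamma T1 T2 <= e.
Proof.
move=> e0 e1 h; apply: ge_inf; last by left; split=> //; rewrite e0 e1.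
by exists 0 => d [[/andP[/ltW]]|->].
Qed.

Lemma inball_le T T' (r r' : R) : r' <= r ->
  inball T 0 r = inball T' 0 r -> inball T 0 r' = inball T' 0 r'.
Proof.
move=> rr; have half S S' : inball S 0 r = inball S' 0 r ->
    inball S 0 r' `<=` inball S' 0 r'.
  move=> e t [St tr]; split=> //.
  have : inball S 0 r t.
    split=> //; apply: subset_trans tr _; apply: eball_sub.
    by rewrite subrr fnorm0 add0r.
  by rewrite e => -[].
by move=> e; apply/seteqP; split; apply: half.
Qed.

Lemma inball_sact T T' (a : R) (w : plane) (r r' : R) : r' + fnorm w <= r ->
  inball T 0 r = inball T' 0 r ->
  inball (sact a w T) 0 r' = inball (sact a w T') 0 r'.
Proof.
move=> rr; have half S S' : inball S 0 r = inball S' 0 r ->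
    inball (sact a w S) 0 r' `<=` inball (sact a w S') 0 r'.
  move=> e _ [[t St <-] tr]; split=> //; apply/sact_tact.
  have : inball S 0 r t.
    split=> //; apply: subset_trans (_ : eball (- (rotmx (- a) *m w)) r' `<=` _).
      by apply/(tact_eball a w); rewrite mulmxN rotKN addNr.
    by apply: eball_sub; rewrite subr0 fnormN fnorm_rot addrC.
  by rewrite e => -[].
by move=> e; apply/seteqP; split; apply: half.
Qed.

(** One parameter measures both the radius of agreement and, inverted, the size of the rotation, as
    in the tiling metric. *)
Definition near_by (r a : R) (S S' : tileset) :=
  fnorm (rotmx a - 1%:M) < r^-1 /\ agree a r S S'.

Lemma near_by_dGamma (r a : R) S S' : 1 < r -> near_by r a S S' -> dGamma S S' <= r^-1.
Proof.
move=> r1 [ha hS]; have r0 : 0 < r by exact: lt_trans r1.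
apply: within_dGamma; rewrite ?invr_gt0 ?invf_lt1//.
exists 0, a, 0, 0; rewrite /gdist subrr fnorm0 add0r rotmx0 subrr fnorm0 addr0.
split=> //; first by rewrite invr_gt0.
by rewrite !gactE !mulmx0 sact_id invrK; exact: agree_inball.
Qed.

Lemma near_by_sym r a S S' : near_by r a S S' -> near_by r (- a) S' S.
Proof. by move=> [ha hS]; split; [rewrite fnorm_rotN|exact: agree_sym]. Qed.

Lemma near_by_le r r' a S S' : 0 < r' -> r' <= r -> near_by r a S S' -> near_by r' a S S'.
Proof.
move=> r0 rr [ha hS]; split; last exact: agree_le hS.
by apply: lt_le_trans ha _; rewrite lef_pV2// posrE// (lt_le_trans r0).
Qed.

End DGamma.

Class pinwheel_hull {R : realType} (c : planeOf R) (T : tilesetOf R) : Prop := {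
  hull_base : tiling c T;
  hull_rot : hull_rotation_invariant c T;
  hull_finite : hull_flc c T;
  hull_aperiodic : hull_strongly_aperiodic c T;
  hull_omega_bij : set_bij (hull c T) (hull c T) (omega c)
}.

(** * Invariance and closedness of the hull *)

Section Hull.
Context {R : realType} (c : planeOf R) (T : tilesetOf R).
Context {hc : interior_puncture c} {hT : pinwheel_hull c T}.

Local Notation plane := (planeOf R).
Local Notation tile := (tileOf R).
Local Notation tileset := (tilesetOf R).
Local Notation placed := (placed c).
Local Notation tiling := (tiling c).
Local Notation hull := (hull c T).
Local Notation hull_punc := (hull_punc c T).
Implicit Types (S : tileset) (s t : tile) (v w : plane).

Lemma hull_tiling S : hull S -> tiling S. Proof. by case. Qed.

Lemma hull_tiles S : hull S -> tiles c S.
Proof. by move=> /hull_tiling/tiling_tiles. Qed.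

Lemma hull_sact0 a S : hull S -> hull (sact a 0 S).
Proof. by move=> /(hull_rot a); rewrite gactE mulmx0. Qed.

(** The approximating translate of [T] is moved by [v] turned through the two comparison rotations,
    so that after them both patches move by [rotmx th2 *m v]. This costs a radius [fnorm v], which
    is why the accuracy [(e1^-1 + fnorm v)^-1] is asked for. *)
Lemma hull_shift v S : hull S -> hull (sact 0 v S).
Proof.
move=> [tS hS]; split; first exact: tiling_sact.
move=> e e0; pose e1 := Num.min e 1 / 2.
have m0 : 0 < Num.min e 1 by rewrite lt_min e0 ltr01.
have e10 : 0 < e1 by rewrite divr_gt0.
have e1m : e1 < Num.min e 1 by rewrite ltr_pdivrMr// ltr_pMr// ltr1n.
have e1e : e1 < e by apply: lt_le_trans e1m _; rewrite ge_min lexx.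
have e11 : e1 < 1 by apply: lt_le_trans e1m _; rewrite ge_min lexx orbT.
have d0 : 0 < e1^-1 + fnorm v by rewrite ltr_wpDr ?fnorm_ge0// invr_gt0.
have [|x hx] := hS (e1^-1 + fnorm v)^-1; first by rewrite invr_gt0.
have [|e2 [e20 e2d [x1 [th1 [x2 [th2 [g1 g2 e12]]]]]]] := dGamma_within hx.
  rewrite invf_le1//; apply: le_trans (_ : e1^-1 <= _); last by rewrite lerDl fnorm_ge0.
  by rewrite invf_ge1// ltW.
have e2e1 : e2 <= e1.
  apply: le_trans (ltW e2d) _; rewrite invf_ple ?posrE//.
  by rewrite lerDl fnorm_ge0.
exists (x + rotmx (- th1) *m (rotmx th2 *m v)).
apply: le_lt_trans (within_dGamma e10 e11 _) e1e.
exists x1, th1, x2, th2; split; [exact: lt_le_trans e2e1|exact: lt_le_trans e2e1|].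
have ew : fnorm (rotmx th2 *m v) = fnorm v by rewrite fnorm_rot.
have rr : e1^-1 + fnorm (rotmx th2 *m v) <= e2^-1.
  by rewrite ew ltW// -[ltLHS]invrK ltf_pV2// posrE invr_gt0.
have := inball_sact 0 rr e12.
rewrite !gactE !translateE !sact_comp !addr0 !rotmx0 !mul1mx add0r.
rewrite add0r mulmxDr rotKN (addrC (rotmx th2 *m v)) (addrC (rotmx th1 *m x1)) addrA.
by [].
Qed.

(** The hull is closed under limits modulo small rotations: the rotation [a] is absorbed by the
    second isometry in [within]. *)
Lemma hull_limit S : tiling S ->
  (forall r : R, 0 < r -> exists S' a, hull S' /\ near_by r a S S') -> hull S.
Proof.
move=> tS hS; split=> // e e0; pose e1 := Num.min e 1 / 2.
have m0 : 0 < Num.min e 1 by rewrite lt_min e0 ltr01.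
have e10 : 0 < e1 by rewrite divr_gt0.
have e1m : e1 < Num.min e 1 by rewrite ltr_pdivrMr// ltr_pMr// ltr1n.
have e1e : e1 < e by apply: lt_le_trans e1m _; rewrite ge_min lexx.
have e11 : e1 < 1 by apply: lt_le_trans e1m _; rewrite ge_min lexx orbT.
(* Then [r^-1 < e1 / 2] bounds the extra rotation, and [r] exceeds [e1^-1] by more than the
   translation [x2]. *)
pose r := 2 / e1 + 1.
have r0 : 0 < r by rewrite addr_gt0// divr_gt0.
have [S' [a [[_ hS'] [ha hSS']]]] := hS _ r0.
have [|x hx] := hS' (e1 / 2); first by rewrite divr_gt0.
have [|e2 [e20 e2d [x1 [th1 [x2 [th2 [g1 g2 e12]]]]]]] := dGamma_within hx.
  by lra.
have e2e1 : e2 <= e1 by lra.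
exists x; apply: le_lt_trans (within_dGamma e10 e11 _) e1e.
exists x1, th1, (rotmx (- a) *m x2), (th2 + a); split.
- exact: lt_le_trans e2e1.
- move: g2; rewrite /gdist !subr0 !rotmx0 fnorm_rot => g2.
  have := fnorm_rotD th2 a.
  have : r^-1 < e1 / 2.
    rewrite invf_plt ?posrE ?divr_gt0// invf_div /r; lra.
  by move: ha g2 e2d; lra.
rewrite (inball_le _ e12); last by rewrite lef_pV2.
rewrite !gactE rotmxD -mulmxA rotKN.
rewrite (_ : sact (th2 + a) _ S = sact th2 (rotmx th2 *m x2) (sact a 0 S)); last first.
  by rewrite sact_comp mulmx0 add0r.
apply: inball_sact (esym (agree_inball hSS')).
rewrite fnorm_rot; move: g2; rewrite /gdist !subr0 rotmx0 => g2.
have := fnorm_ge0 (rotmx th2 - 1%:M).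
have : 0 < e1^-1 by rewrite invr_gt0.
by rewrite /r; move: g2 e2e1 e11; lra.
Qed.

Lemma hull_puncP S : hull_punc S <-> hull S /\ exists i ph, S (placed i ph 0).
Proof.
split=> [[hS [t St t0]]|[hS [i [ph h]]]]; split=> //.
  have [i [ph [v et]]] := hull_tiles hS St; exists i, ph.
  by move: St t0; rewrite et puncture_placed => St v0; rewrite -{1}v0.
by exists (placed i ph 0); rewrite ?puncture_placed.
Qed.

Lemma hull_punc_tiling S : hull_punc S -> tiling S.
Proof. by move=> [/hull_tiling]. Qed.

Lemma tile0_agree a r S S' : tiling S -> tiling S' -> agree a r S S' -> 3 <= r ->
  (exists i ph, S (placed i ph 0)) -> tile0 S' = tact a 0 (tile0 S).
Proof.
move=> tS tS' h r3 [i [ph Sp]]; rewrite (tile0_placed tS Sp) tact_placed mulmx0 addr0.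
apply: tile0_placed => //.
have := h (placed i ph 0); rewrite tact_placed mulmx0 addr0 => -[|/(_ Sp)//].
by apply: placed_sub_eball0; rewrite fnorm0 add0r.
Qed.

End Hull.

(** * Compactness of the punctured hull *)

Section HullCompactness.
Context {R : realType} (c : planeOf R) (T : tilesetOf R).
Context {hc : interior_puncture c} {hT : pinwheel_hull c T}.

Local Notation plane := (planeOf R).
Local Notation tile := (tileOf R).
Local Notation tileset := (tilesetOf R).
Local Notation placed := (placed c).
Local Notation tiling := (tiling c).
Local Notation hull := (hull c T).
Local Notation hull_punc := (hull_punc c T).
Implicit Types (S : tileset) (s t : tile) (v w : plane).

(** After the two isometries the tiles at the origin have their punctures at the images of [x] and
    [x']. These are closer than [rho] and belong to one patch, so they coincide; the translations
    cancel and only the rotation by [- th' + th] is left. *)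
Lemma dGamma_near_by (r : R) : 0 < r -> exists2 d : R, 0 < d &
  forall S S', hull_punc S -> hull_punc S' -> dGamma S S' < d ->
  exists a, near_by r a S S'.
Proof.
move=> r0; have rho0 := @rho_gt0 _ c hc.
have p0 : 0 < 2 / rho c by rewrite divr_gt0.
(* The term [2 * r] lets two rotations add up to less than [r^-1], [2 / rho c] makes the
   translations too short to reach another puncture, and [8] leaves room for the tile at the
   origin. *)
pose K := 2 * r + 8 + 2 / rho c; have K0 : 0 < K by rewrite /K; move: r0 p0; lra.
exists K^-1; first by rewrite invr_gt0.
move=> S S' /hull_puncP[hS [i [ph Sp]]] /hull_puncP[hS' [j [ph' Sp']]] hd.
have K1 : K^-1 <= 1 by rewrite invf_le1// /K; move: r0 p0; lra.
have [e [e0 eK [x [th [x' [th' [g g' eb]]]]]]] := dGamma_within hd K1.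
have ie : K < e^-1 by rewrite -[ltLHS]invrK ltf_pV2// posrE invr_gt0.
have e8 : e < 8^-1.
  by apply: lt_trans eK _; rewrite ltf_pV2 ?posrE// /K; move: r0 p0; lra.
have er : e < (2 * r)^-1.
  apply: lt_trans eK _; rewrite ltf_pV2 ?posrE ?mulr_gt0// /K; move: r0 p0; lra.
have erho : e < rho c / 2.
  rewrite -invf_div; apply: lt_trans eK _; rewrite ltf_pV2 ?posrE// /K; move: r0; lra.
have [xe re] : fnorm x < e /\ fnorm (rotmx th - 1%:M) < e.
  move: g; rewrite /gdist subr0 rotmx0.
  by have := fnorm_ge0 x; have := fnorm_ge0 (rotmx th - 1%:M); split; lra.
have [xe' re'] : fnorm x' < e /\ fnorm (rotmx th' - 1%:M) < e.
  move: g'; rewrite /gdist subr0 rotmx0.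
  by have := fnorm_ge0 x'; have := fnorm_ge0 (rotmx th' - 1%:M); split; lra.
rewrite !gactE in eb.
pose w := rotmx (- th') *m (rotmx th *m x).
have wx : w = x'.
  have : inball (sact th (rotmx th *m x) S) 0 e^-1
      (tact th (rotmx th *m x) (placed i ph 0)).
    split; first exact/sact_tact.
    rewrite tact_placed mulmx0 add0r; apply: placed_sub_eball0.
    by rewrite fnorm_rot; move: xe ie e8 p0 r0; rewrite /K; lra.
  rewrite eb => -[/sactP]; rewrite rotNK tact_comp -/w tact_placed mulmx0 add0r => h _.
  have : placed i (- th' + th + ph) (w - x') = placed j ph' 0.
    apply: (tiling_separated (hull_tiling hS') h Sp').
    rewrite subr0; apply: le_lt_trans (fnormD _ _) _.
    by rewrite fnormN /w !fnorm_rot; move: xe xe' erho; lra.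
  by move=> /placed_inj[_ _ /eqP]; rewrite subr_eq0 => /eqP.
exists (- th' + th); split.
  apply: le_lt_trans (fnorm_rotD _ _) _; rewrite fnorm_rotN.
  have : 2 * (2 * r)^-1 = r^-1 by field; exact: lt0r_neq0.
  by move: re re' er; lra.
move=> t tr; have tb : tact th (rotmx th *m x) t `<=` eball 0 e^-1.
  apply: subset_trans (_ : eball (rotmx th *m x) r `<=` _).
    have := tact_eball th (rotmx th *m x) t 0 r; rewrite mulmx0 add0r.
    by move=> [_]; exact.
  apply: eball_sub; rewrite subr0 fnorm_rot.
  by move: xe ie e8 p0 r0; rewrite /K; lra.
have et : tact (- th' + th) 0 t =
    tact (- th') (- (rotmx (- th') *m (rotmx th' *m x'))) (tact th (rotmx th *m x) t).
  by rewrite tact_comp rotNK -/w wx subrr.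
split=> [St|S't].
  have : inball (sact th (rotmx th *m x) S) 0 e^-1 (tact th (rotmx th *m x) t).
    by split=> //; exact/sact_tact.
  by rewrite eb => -[/sactP]; rewrite -et.
have : inball (sact th' (rotmx th' *m x') S') 0 e^-1 (tact th (rotmx th *m x) t).
  by split=> //; apply/sactP; rewrite -et.
by rewrite -eb => -[/sact_tact].
Qed.

(** Each comparison rotation carries the tile at the origin of [S] to that of [S'], so all of them
    have the same matrix. It is arbitrarily close to the identity, hence trivial, and [S] and [S']
    agree on all balls. *)
Lemma near_by_all_eq S S' : hull_punc S -> hull_punc S' ->
  (forall r : R, 0 < r -> exists a, near_by r a S S') -> S = S'.
Proof.
move=> /hull_puncP[hS [i [ph Sp]]] /hull_puncP[hS' [j [ph' Sp']]] h.
have tS := hull_tiling hS; have tS' := hull_tiling hS'.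
have h0 a (r : R) : 3 <= r -> near_by r a S S' -> rotmx (a + ph) = rotmx ph'.
  move=> r3 [_ ha]; have : tile0 S' = tact a 0 (tile0 S).
    by apply: (tile0_agree tS tS' ha r3); exists i, ph.
  rewrite (tile0_placed tS Sp) (tile0_placed tS' Sp') tact_placed.
  by move=> /placed_inj[].
have e1 : rotmx ph' = rotmx ph.
  apply: fnorm_small_eq => e e0; pose r := e^-1 + 3.
  have ie : 0 < e^-1 by rewrite invr_gt0.
  have r3 : 3 <= r by rewrite /r; lra.
  have [|a ha] := h r; first by lra.
  rewrite -(h0 a r r3 ha) fnorm_rotB addrK.
  case: ha => ha _; apply: lt_trans ha _.
  by rewrite -[ltRHS]invrK ltf_pV2 ?posrE /r; lra.
have key (r : R) : 3 <= r -> agree 0 r S S'.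
  move=> r3; have [|a ha] := h r; first by lra.
  have e2 := h0 a r r3 ha; apply: agree_rot (ha.2).
  by apply: (@rotmx_addI R ph); rewrite addr0 addrC e2 e1.
apply/seteqP; split=> t.
  move=> St; have [k [psi [v et]]] := tiling_tiles tS St.
  have := key (fnorm v + 3) _ t; rewrite tact_id => -[||/(_ St)//].
    by have := fnorm_ge0 v; lra.
  by rewrite et; exact: placed_sub_eball0.
move=> St; have [k [psi [v et]]] := tiling_tiles tS' St.
have := key (fnorm v + 3) _ t; rewrite tact_id => -[||_ /(_ St)//].
  by have := fnorm_ge0 v; lra.
by rewrite et; exact: placed_sub_eball0.
Qed.

Section Compactness.
Context (X : Type) (F : set_system X) {UF : UltraFilter F}.

(* A patch is determined by its class modulo isometries together with the
   position of one of its tiles. *)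
Lemma ultra_patch (nu : X -> tileset) i (r : R) : 3 <= r ->
  F [set x | hull (nu x) /\ nu x (proto c i)] ->
  exists Q, F [set x | inball (nu x) 0 r = Q].
Proof.
move=> r3 hF; have r0 : 0 < r by lra.
have [A finA hA] := hull_finite r0.
pose G := [set x | hull (nu x) /\ nu x (proto c i)].
have [|P AP FP] := @ultra_finite X _ F UF A
    (fun P => [set x | G x /\ exists y th, inball (nu x) 0 r = gact y th P]) finA.
  apply: filterS hF => x Gx; have [P [y [th [AP e]]]] := hA (nu x) 0 Gx.1.
  by exists P => //; split=> //; exists y, th.
have [x0 [Gx0 [y0 [th0 e0]]]] := filter_ex FP.
have finP : finite_set P.
  have := finite_inball (c := c) 0 r (hull_tiling Gx0.1); rewrite e0 gactE => fin.
  have -> : P = sact (- th0) (- (rotmx (- th0) *m (rotmx th0 *m y0)))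
      (sact th0 (rotmx th0 *m y0) P).
    by rewrite sact_comp addNr subrr sact_id.
  by apply: finite_image; exact: fin.
have [|s Ps Fs] := @ultra_finite X _ F UF P
    (fun s => [set x | exists y th, inball (nu x) 0 r = gact y th P /\
        tact th (rotmx th *m y) s = proto c i]) finP.
  apply: filterS FP => x [[_ Gx] [y [th e]]].
  have : inball (nu x) 0 r (proto c i).
    by split=> //; rewrite proto_placed; apply: placed_sub_eball0; rewrite fnorm0 add0r.
  by rewrite e gactE => -[s Ps es]; exists s => //; exists y, th; split.
have [x1 [y1 [th1 [e1 es1]]]] := filter_ex Fs.
exists (inball (nu x1) 0 r); apply: filterS Fs => x [y [th [e es]]].
rewrite /= e e1 !gactE.
have sP : exists j psi v, s = placed j psi v.
  have -> : s = tact (- th1) (- (rotmx (- th1) *m (rotmx th1 *m y1))) (proto c i).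
    by rewrite -es1 tactK.
  by rewrite proto_placed tact_placed; do 3 eexists.
move: sP es es1 => [j [psi [v ->]]]; rewrite !tact_placed proto_placed.
move=> /placed_inj[_ er ev] /placed_inj[_ er1 ev1].
have rr : rotmx th = rotmx th1.
  by apply: (@rotmx_addI R psi); rewrite addrC er addrC er1.
rewrite (_ : rotmx th *m y = rotmx th1 *m y1); first exact: sact_rot.
by move: ev1; rewrite -ev rr => /addrI.
Qed.

(** Turn the tile at the origin into standard position. By [ultra_patch] the patch in each ball is
    then constant along the ultrafilter, and these patches assemble to a tiling; the orientations
    converge on the circle, and the limit is turned back by [phi0]. *)
Lemma hull_punc_compact (tau : X -> tileset) :
  F [set x | hull_punc (tau x)] ->
  exists S, hull_punc S /\
    forall r : R, 0 < r -> F [set x | exists a, near_by r a S (tau x)].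
Proof.
move=> hF.
have [|i _ Fi] := @ultra_finite X bool F UF setT
    (fun i => [set x | hull (tau x) /\ exists ph, tau x (placed i ph 0)])
    finite_finset.
  by apply: filterS hF => x /hull_puncP[hx [i h]]; exists i.
pose phi x := xget 0 [set ph | tau x (placed i ph 0)].
have {hF}Fphi : F [set x | hull (tau x) /\ tau x (placed i (phi x) 0)].
  apply: filterS Fi => x [hx h]; split=> //.
  by have := @xgetPex R 0 [set ph | tau x (placed i ph 0)] h.
have [C hC] := @ultra_cvg_bounded R X F UF (fun x => cos (phi x)) 1
  (filterS (fun x _ => cos_max (phi x)) filterT).
have [D hD] := @ultra_cvg_bounded R X F UF (fun x => sin (phi x)) 1
  (filterS (fun x _ => sin_max (phi x)) filterT).
have CD : C ^+ 2 + D ^+ 2 = 1.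
  apply/eqP; rewrite -subr_eq0; apply/eqP/normr0_eq0/eqP; rewrite eq_le normr_ge0 andbT.
  apply/ler_addgt0Pr => e e0; rewrite add0r.
  pose d := Num.min 1 (e / 6).
  have d0 : 0 < d by rewrite lt_min ltr01 divr_gt0.
  have d1 : d <= 1 by rewrite ge_min lexx.
  have de : d <= e / 6 by rewrite ge_min lexx orbT.
  have [x [/= h1 h2]] := filter_ex (filterI (hC d d0) (hD d d0)).
  have := cos2Dsin2 (phi x); have := cos_max (phi x); have := sin_max (phi x).
  move: h1 h2; move: (cos (phi x)) (sin (phi x)) => c' s'.
  rewrite !ltr_norml !ler_norml => /andP[a1 a2] /andP[a3 a4] /andP[a5 a6] /andP[a7 a8] a9.
  apply/andP; split; nra.
have [phi0 [ec es]] := angle_exists CD.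
have hrot (e : R) : 0 < e -> F [set x | fnorm (rotmx (phi x) - rotmx phi0) < e].
  move=> e0; have e4 : 0 < e / 4 by rewrite divr_gt0.
  apply: filterS (filterI (hC _ e4) (hD _ e4)) => x [/= h1 h2].
  rewrite -(ltr_pXn2r (n := 2)) ?nnegrE ?fnorm_ge0 ?(ltW e0)//.
  rewrite fnorm_sqr !big_ord_recl !big_ord0 /= !addr0 !mxE /= ec es.
  move: h1 h2.
  move: (cos (phi x)) (sin (phi x)) => c' s'.
  rewrite !ltr_norml => /andP[a1 a2] /andP[a3 a4]; nra.
pose nu x := sact (- phi x) 0 (tau x).
have Fnu : F [set x | hull (nu x) /\ nu x (proto c i)].
  apply: filterS Fphi => x [hx h]; split; first exact: hull_sact0.
  exists (placed i (phi x) 0) => //.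
  by rewrite tact_placed addNr mulmx0 addr0 -proto_placed.
(* The limit tiling consists of the tiles present along the ultrafilter; in each ball it coincides
   with almost every [nu x]. *)
pose S0 : tileset := [set t | F [set x | nu x t]].
have hS0 (r : R) : 3 <= r -> F [set x | inball (nu x) 0 r = inball S0 0 r].
  move=> r3; have [Q FQ] := ultra_patch r3 Fnu.
  suff <- : Q = inball S0 0 r by [].
  apply/seteqP; split=> t.
    move=> Qt; have [x e] := filter_ex FQ; split; last first.
      by have : inball (nu x) 0 r t by [rewrite e]; case.
    by apply: filterS FQ => y ey; have : inball (nu y) 0 r t by [rewrite ey]; case.
  move=> [St tr]; have [x [<- h]] := filter_ex (filterI FQ St).
  by split.
have tS0 : tiling S0.
  have S0t : tiles c S0.
    move=> t St; have [x [/= nt [hx _]]] := filter_ex (filterI (St : F [set x | nu x t]) Fnu).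
    exact: hull_tiles hx _ nt.
  split=> //.
  - have -> : S0 = \bigcup_n inball S0 0 (n%:R + 3).
      apply/seteqP; split=> [t St|t [n _ []]//].
      have [j [ph [v et]]] := S0t _ St; exists (Num.truncn (fnorm v)).+1 => //.
      split=> //; rewrite et; apply: placed_sub_eball0; rewrite lerD2r.
      by have /andP[_ /ltW] := truncn_itv (fnorm_ge0 v).
    apply: bigcup_countable => // n _; apply: finite_set_countable.
    have [|x [<- [hx _]]] := filter_ex (filterI (hS0 (n%:R + 3) _) Fnu).
      by rewrite lerDr.
    by apply: (finite_inball (c := c)); exact: hull_tiling hx.
  - apply/seteqP; split=> // p _.
    have [|x [e [hx _]]] := filter_ex (filterI (hS0 (fnorm p + 6) _) Fnu).
      by have := fnorm_ge0 p; lra.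
    have : (\bigcup_(t in nu x) t) p by case: (hull_tiling hx) => _ _ ->.
    move=> [t nt tp]; exists t => //.
    suff : inball (nu x) 0 (fnorm p + 6) t by rewrite e => -[].
    split=> //; have [j [ph [v et]]] := hull_tiles hx nt.
    rewrite et; apply: placed_sub_eball0.
    have pv : placed j ph v p by rewrite -et.
    have {pv} : fnorm (p - v) < 3 by exact: placed_radius pv.
    rewrite fnormBC => pv.
    by have := fnormB_le v p 0; rewrite !subr0; lra.
  move=> s t Ss St st.
  have [x [/= [ns nt] [hx _]]] := filter_ex
    (filterI (filterI (Ss : F [set x | nu x s]) (St : F [set x | nu x t])) Fnu).
  by case: (hull_tiling hx) => _ _ _; apply.
pose S := sact phi0 0 S0.
have nearS (r : R) : 0 < r -> F [set x | hull (tau x) /\ exists a, near_by r a S (tau x)].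
  move=> r0; have ir0 : 0 < r^-1 by rewrite invr_gt0.
  apply: filterS (filterI (hrot _ ir0) (filterI (hS0 (r + 3) _) Fphi)).
    move=> x [/= h1 [h2 [hx _]]]; split=> //; exists (phi x - phi0); split.
      by rewrite -fnorm_rotB.
    have ag : agree 0 r S0 (nu x).
      apply: (@agree_le _ _ (r + 3)); first by lra.
      by apply: inball_agree; rewrite sact_id.
    have a1 : agree (- phi0) r S S0 by exact/agree_sym/agree_sact.
    have a2 : agree (phi x) r (nu x) (tau x).
      by have := agree_sym (@agree_sact R (- phi x) r (tau x)); rewrite opprK.
    by have := agree_trans (agree_trans a1 ag) a2; rewrite add0r.
  by rewrite lerDr ltW.
have hS : hull S.
  apply: hull_limit; first exact: tiling_sact.
  by move=> r r0; have [x [hx [a ha]]] := filter_ex (nearS _ r0); exists (tau x), a.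
exists S; split.
  apply/hull_puncP; split=> //; exists i, phi0; exists (proto c i).
    by apply: filterS Fnu => x [].
  by rewrite -placedE.
by move=> r r0; apply: filterS (nearS _ r0) => x [].
Qed.

End Compactness.

End HullCompactness.

(** * Addresses of the origin in supertiles *)

Section Addresses.
Context {R : realType} (c : planeOf R) (T : tilesetOf R).
Context {hc : interior_puncture c} {hT : pinwheel_hull c T}.

Local Notation plane := (planeOf R).
Local Notation tile := (tileOf R).
Local Notation tileset := (tilesetOf R).
Local Notation placed := (placed c).
Local Notation puncture := (puncture c).
Local Notation hull := (hull c T).
Local Notation hull_punc := (hull_punc c T).
Local Notation omega := (omega c).
Local Notation lam := (@lambda R).
Implicit Types (S : tileset) (s t : tile) (v w : plane).

Lemma hull_omega N S : hull S -> hull (iter N omega S).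
Proof.
move=> hS; elim: N => //= N IH.
by have [h _ _] := @hull_omega_bij _ c T hT; exact: h.
Qed.

Lemma iter_omega_inj N S S' : hull S -> hull S' ->
  iter N omega S = iter N omega S' -> S = S'.
Proof.
move=> hS hS'; elim: N => //= N IH e; apply: IH.
have [_ h _] := @hull_omega_bij _ c T hT.
by apply: h => //; rewrite inE; exact: hull_omega.
Qed.

Lemma iter_omega_surj N S : hull S -> exists2 S', hull S' & iter N omega S' = S.
Proof.
have [_ _ h] := @hull_omega_bij _ c T hT.
elim: N S => [|N IH] S hS; first by exists S.
have [S' hS' <-] := h _ hS; have [S'' hS'' <-] := IH _ hS'.
by exists S''.
Qed.

Lemma lamX_gt0 N : 0 < lam ^+ N. Proof. by rewrite exprn_gt0// lambda_gt0. Qed.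
Lemma lamX_neq0 N : lam ^+ N != 0. Proof. by rewrite gt_eqF// lamX_gt0. Qed.

(* The level-[N] supertile of [T'] at the origin is of type [i] and
   orientation [ph], and the tile of [T'] at the origin is its subtile [t]. *)
Definition addr N i ph t T' := exists S, [/\ hull S, S (placed i ph 0),
  omega_iter_proto c N i t &
  T' = sact 0 (- (rotmx ph *m puncture t)) (iter N omega S)].

Lemma addr_rot N i ph ph' t T' : rotmx ph = rotmx ph' ->
  addr N i ph t T' -> addr N i ph' t T'.
Proof.
by move=> e [S [hS Sp ht ->]]; exists S; split; rewrite // -?e// -(placed_rot c i 0 e).
Qed.

Lemma addr_sub N i ph t T' : addr N i ph t T' -> omega_iter_proto c N i t.
Proof. by move=> [S []]. Qed.

Lemma addr_hull N i ph t T' : addr N i ph t T' -> hull T'.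
Proof. by move=> [S [hS _ _ ->]]; exact/hull_shift/hull_omega. Qed.

Lemma addr_mem N i ph t T' s : addr N i ph t T' -> omega_iter_proto c N i s ->
  T' (tact ph (- (rotmx ph *m puncture t)) s).
Proof.
move=> [S [hS Sp ht ->]] hs; exists (tact ph 0 s).
  apply/iter_omegaP; first exact: hull_tiles hS.
  by exists i, ph, 0, s; rewrite scaler0.
by rewrite tact_comp mulmx0 !add0r.
Qed.

Lemma addr_tile0 N i ph t T' : addr N i ph t T' ->
  tile0 T' = tact ph (- (rotmx ph *m puncture t)) t.
Proof.
move=> h; have ht := addr_sub h; have := addr_mem h ht.
have [j [b [w ->]]] := tiles_omega_iter_proto ht.
rewrite puncture_placed tact_placed subrr => h0.
by apply: tile0_placed h0; exact/hull_tiling/addr_hull/h.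
Qed.

Lemma addr_punc N i ph t T' : addr N i ph t T' -> hull_punc T'.
Proof.
move=> h; have ht := addr_sub h; have := addr_mem h ht.
have [j [b [w ->]]] := tiles_omega_iter_proto ht.
rewrite puncture_placed tact_placed subrr => h0.
by apply/hull_puncP; split; [exact: addr_hull h|exists j, (ph + b)].
Qed.

(** Deflate [N] times, take the tile whose supertile contains the tile at the origin, and translate
    so that its puncture becomes the origin. *)
Lemma addr_exists N T' : hull_punc T' -> exists i ph t, addr N i ph t T'.
Proof.
move=> /hull_puncP[hT' [j [b hb]]]; have [S hS e] := iter_omega_surj N hT'.
have tS := hull_tiles hS.
move: (hb); rewrite -e => /(iter_omegaP _ _ tS)[i [ph [v [t [Sv ht et]]]]].
exists i, ph, t, (sact 0 (- v) S); split=> //.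
- exact: hull_shift.
- by exists (placed i ph v) => //; rewrite tact_placed add0r rotmx0 mul1mx subrr.
have := congr1 puncture et.
rewrite puncture_placed puncture_tact; last exact: tiles_omega_iter_proto ht.
move/esym/eqP; rewrite addr_eq0 => /eqP ->.
by rewrite opprK iter_omega_sact// sact0D scalerN addNr sact_id.
Qed.

(** Recentred so as to inflate exactly to [T'], the two tilings behind the addresses are equal by
    injectivity. The tile at the origin contains a disc about it; deflated, this disc lies in both
    base tiles, which therefore coincide. *)
Lemma addr_unique N i ph t i' ph' t' T' : addr N i ph t T' -> addr N i' ph' t' T' ->
  [/\ i = i', rotmx ph = rotmx ph' & t = t'].
Proof.
move=> h h'; have t0 := addr_tile0 h; have t0' := addr_tile0 h'.
have l0 := lamX_neq0 N.
have base j psi s : addr N j psi s T' ->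
    exists S, [/\ hull S, iter N omega S = T' &
      S (placed j psi (- ((lam ^+ N)^-1 *: (rotmx psi *m puncture s))))].
  move=> [S [hS Sp hs ->]].
  exists (sact 0 (- ((lam ^+ N)^-1 *: (rotmx psi *m puncture s))) S); split.
  - exact: hull_shift.
  - rewrite iter_omega_sact; last exact: hull_tiles hS.
    by rewrite scalerN scalerA divff// scale1r.
  by exists (placed j psi 0) => //; rewrite tact_placed !add0r mulmx0 add0r.
have [S [hS eS Sp]] := base _ _ _ h; have [S' [hS' eS' Sp']] := base _ _ _ h'.
have ee : S' = S by apply: (iter_omega_inj (N := N) hS' hS); rewrite eS eS'.
rewrite ee {hS' eS' ee S'} in Sp'.
have ball j psi s : addr N j psi s T' -> eball 0 (rho c / lam ^+ N) `<=`
    placed j psi (- ((lam ^+ N)^-1 *: (rotmx psi *m puncture s))).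
  move=> hs p pr.
  have : tile0 T' (lam ^+ N *: p).
    have /hull_puncP[hT' [k [b hb]]] := addr_punc hs.
    rewrite (tile0_placed (hull_tiling hT') hb); apply: placed_ball.
    rewrite /eball /= subr0 fnormZ gtr0_norm ?lamX_gt0// mulrC -ltr_pdivlMr ?lamX_gt0//.
    by move: pr; rewrite /eball /= subr0.
  rewrite (addr_tile0 hs) => hp.
  have := @omega_tile_sub _ c N j psi
    (- ((lam ^+ N)^-1 *: (rotmx psi *m puncture s))) s (addr_sub hs) (lam ^+ N *: p).
  rewrite scalerN scalerA divff// scale1r => /(_ hp)[q qs /(scalerI l0) <-].
  exact: qs.
have r0 : 0 < rho c / lam ^+ N by rewrite divr_gt0 ?lamX_gt0// rho_gt0.
have := tiling_disjoint (hull_tiling hS) Sp Sp' r0 (ball _ _ _ h) r0 (ball _ _ _ h').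
rewrite subrr fnorm0 => /(_ r0)/placed_inj[ei er /oppr_inj/(scalerI (invr_neq0 l0)) ev].
split=> //; move: t0'; rewrite t0 -ev (tact_rot _ t' (esym er)).
exact: tact_inj.
Qed.

Lemma addr_orientation N i ph ph' t T' T'' a :
  addr N i ph t T' -> addr N i ph' t T'' -> tile0 T'' = tact a 0 (tile0 T') ->
  rotmx ph' = rotmx (a + ph).
Proof.
move=> h h'; rewrite (addr_tile0 h) (addr_tile0 h').
have [j [b [w ->]]] := tiles_omega_iter_proto (addr_sub h).
rewrite puncture_placed !tact_placed => /placed_inj[_ e _].
by apply: (@rotmx_addI R b); rewrite addrC e addrA addrC.
Qed.

(** Continuity of the inverse of [omega^N], by compactness. If the address did not persist along
    tilings tending to [T'], an ultrafilter would make their type and subtile constant and their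
    deflations convergent to some [S]. By [agree_omega] and [near_by_all_eq] the recentred inflation
    of [S] is [T'], so type and subtile are [i] and [t] by uniqueness, and the tile at the origin
    gives the orientation. *)
Lemma addr_near N i ph t T' : addr N i ph t T' -> exists2 r : R, 0 < r &
  forall T'' a, hull_punc T'' -> near_by r a T' T'' -> addr N i (a + ph) t T''.
Proof.
move=> hT'; apply: contrapT => hN.
have hT'p := addr_punc hT'; have tT' := hull_punc_tiling hT'p.
have {hN} /choice[f hf] : forall n : nat, exists q : tileset * R,
    [/\ hull_punc q.1, near_by (n%:R + 3) q.2 T' q.1 & ~ addr N i (q.2 + ph) t q.1].
  move=> n; apply: contrapT => hn; apply: hN; exists (n%:R + 3); first by rewrite ltr_wpDl.
  move=> T'' a h1 h2; apply: contrapT => h3; apply: hn.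
  by exists (T'', a).
have [G [UG leG]] := @ultraFilterLemma _ (nbhs \oo) _.
pose B (k : bool * tile) n (q : tileset * R) := [/\ hull q.1, q.1 (placed k.1 q.2 0),
  omega_iter_proto c N k.1 k.2 &
  (f n).1 = sact 0 (- (rotmx q.2 *m puncture k.2)) (iter N omega q.1)].
have finA : finite_set [set k : bool * tile | omega_iter_proto c N k.1 k.2].
  apply: sub_finite_set (_ : _ `<=` setT `*` (omega_iter_proto c N false `|`
    omega_iter_proto c N true)) _.
    by move=> [[] s] h; split=> //; [right|left].
  apply: finite_setX; first exact: finite_finset.
  by rewrite finite_setU; split; exact: finite_omega_iter_proto.
have [|[j s] hs FB] := @ultra_finite _ _ G UG _
    (fun k => [set n | exists q, B k n q]) finA.
  apply: filterS (@filterT _ G _) => n _; have [h _ _] := hf n.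
  have [j [psi [s [S [hS Sp hs e]]]]] := addr_exists N h.
  by exists (j, s) => //; exists (S, psi).
rewrite /= in hs.
have /choice[g hg] : forall n, exists q, (exists q', B (j, s) n q') -> B (j, s) n q.
  move=> n; have [[q hq]|h] := pselect (exists q', B (j, s) n q').
    by exists q.
  by exists (set0, 0) => h'.
have {}FB : G [set n | B (j, s) n (g n)] by apply: filterS FB => n /hg.
have [|S [hS nearS]] := @hull_punc_compact _ c T hc hT _ G UG (fun n => (g n).1).
  apply: filterS FB => n [h1 h2 _ _]; apply/hull_puncP; split=> //.
  by exists j, (g n).2.
have /hull_puncP[hS' [k [ps Sps]]] := hS.
have key (r : R) : 0 < r -> exists n a, [/\ B (j, s) n (g n), near_by r a S (g n).1 & r <= n%:R].
  move=> r0; have [n [[h1 [a h2]] h3]] := filter_ex (filterI (filterI FB (nearS r r0))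
    (leG _ (nbhs_infty_gtr r))).
  by exists n, a; split=> //; exact: ltW.
have orient n a (r : R) : 3 <= r -> B (j, s) n (g n) -> near_by r a S (g n).1 ->
    j = k /\ rotmx (g n).2 = rotmx (a + ps).
  move=> r3 [h1 h2 _ _] [_ h3].
  have : tile0 (g n).1 = tact a 0 (tile0 S).
    apply: (tile0_agree (hull_punc_tiling hS) (hull_tiling h1) h3 r3).
    by exists k, ps.
  rewrite (tile0_placed (hull_tiling h1) h2) (tile0_placed (hull_tiling hS') Sps).
  by rewrite tact_placed => /placed_inj[].
have jk : j = k.
  have [|n [a [h1 h2 _]]] := key 3; first by [].
  by have [] := orient _ _ _ (lexx _) h1 h2.
subst k; pose T1 := sact 0 (- (rotmx ps *m puncture s)) (iter N omega S).
have aT1 : addr N j ps s T1 by exists S.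
have eT : T' = T1.
  apply: near_by_all_eq hT'p (addr_punc aT1) _ => r r0.
  pose K := fnorm (puncture s); have K0 : 0 <= K by exact: fnorm_ge0.
  (* [2 * r] serves the sum of two rotations, [9] the loss [6] in [agree_omega] and the radius [3]
     for the tile at the origin, [K] the recentring. *)
  pose r1 := 2 * r + 9 + K.
  have r13 : 3 <= r1 by rewrite /r1; lra.
  have r10 : 0 < r1 by lra.
  have [n [a [h1 h2 h3]]] := key r1 r10.
  have [_ er] := orient _ _ _ r13 h1 h2.
  have [_ nn _] := hf n; case: h1 => g1 g2 g3 g4.
  have {}nn : near_by r1 (f n).2 T' (f n).1 by apply: near_by_le nn => //; lra.
  exists (- a + (f n).2); split.
    apply: le_lt_trans (fnorm_rotD _ _) _; rewrite fnorm_rotN.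
    have i1 : r1^-1 < (2 * r)^-1.
      by rewrite ltf_pV2 ?posrE ?mulr_gt0// /r1; lra.
    have : 2 * (2 * r)^-1 = r^-1 by field; exact: lt0r_neq0.
    by case: h2 nn => h2 _ [h4 _]; move: h2 h4 i1; lra.
  have ag : agree a r T1 (f n).1.
    have ao : agree a (r1 - 6) (iter N omega S) (iter N omega (g n).1).
      by apply: agree_omega h2.2; [exact: hull_tiles hS'|exact: hull_tiles g1].
    have vK : fnorm (- (rotmx ps *m puncture s)) <= K by rewrite fnormN fnorm_rot.
    have := agree_shift vK ao.
    rewrite mulmxN mulmxA -rotmxD -er -g4; apply: agree_le.
    by rewrite /r1; lra.
  have ag' : agree (f n).2 r T' (f n).1 by apply: agree_le nn.2; rewrite /r1; lra.
  exact: agree_trans ag' (agree_sym ag).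
rewrite -eT in aT1; have [ei _ et] := addr_unique hT' aT1; subst j s.
have [n [a [[g1 g2 g3 g4] _ _]]] := key 1 ltr01.
have [pn nn na] := hf n; apply: na.
have afn : addr N i (g n).2 t (f n).1 by exists (g n).1.
apply: (addr_rot _ (afn)); apply: (addr_orientation hT' (afn)).
apply: (tile0_agree tT' (hull_punc_tiling pn) nn.2); first by rewrite lerDr.
by have /hull_puncP[] := hT'p.
Qed.

Lemma addr_shift N i ph t t' T' : addr N i ph t T' -> omega_iter_proto c N i t' ->
  addr N i ph t' (sact 0 (rotmx ph *m (puncture t - puncture t')) T').
Proof.
move=> [S [hS Sp ht ->]] ht'; exists S; split=> //.
by rewrite sact0D mulmxBr addrA addNr add0r.
Qed.

(** Keeps the lower [N] levels of an address of level [N + m]. Kernels of level [N] are evaluated in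
    this way on shifts inside a larger supertile. *)
Lemma addr_refine N m i j ph a w t T' :
  omega_iter_proto c m j (placed i a w) -> omega_iter_proto c N i t ->
  addr (N + m) j ph (tact a (lam ^+ N *: w) t) T' -> addr N i (ph + a) t T'.
Proof.
move=> hw ht [S [hS Sp _ ->]].
exists (sact 0 (- (rotmx ph *m w)) (iter m omega S)); split=> //.
- exact/hull_shift/hull_omega.
- exists (placed i (ph + a) (rotmx ph *m w)).
    apply/iter_omegaP; first exact: hull_tiles hS.
    exists j, ph, 0, (placed i a w); split=> //.
    by rewrite scaler0 tact_placed addr0.
  by rewrite tact_placed add0r rotmx0 mul1mx subrr.
rewrite iter_omega_sact; last by apply: tiles_iter_omega; exact: hull_tiles hS.
rewrite -iterD sact0D; congr (sact _ _ _).
rewrite puncture_tact; last exact: tiles_omega_iter_proto ht.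
by rewrite mulmxDr mulmxA -rotmxD opprD addrC scalerN scalemxAr.
Qed.

End Addresses.

(** * The groupoid [R_punc] and its topology *)

Section Groupoid.
Context {R : realType} (c : planeOf R) (T : tilesetOf R).
Context {hc : interior_puncture c} {hT : pinwheel_hull c T}.

Local Notation plane := (planeOf R).
Local Notation tile := (tileOf R).
Local Notation tileset := (tilesetOf R).
Local Notation placed := (placed c).
Local Notation tiling := (tiling c).
Local Notation hull := (hull c T).
Local Notation hull_punc := (hull_punc c T).
Local Notation Rpunc := (Rpunc c T).
Local Notation disp := (displacement c).
Local Notation dR := (dR c).
Implicit Types (S : tileset) (s t : tile) (v w : plane) (p q : tileset * tileset).

Definition is_punct S v := exists i ph, S (placed i ph v).

Lemma is_punct_sact a w S v : is_punct S v -> is_punct (sact a w S) (rotmx a *m v + w).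
Proof.
move=> [i [ph h]]; exists i, (a + ph); exists (placed i ph v) => //.
by rewrite tact_placed.
Qed.

Lemma is_punct_shift w S v : is_punct S v -> is_punct (sact 0 w S) (v + w).
Proof. by move=> /(is_punct_sact 0 w); rewrite rotmx0 mul1mx. Qed.

Lemma hull_punc_shift S v : hull S -> is_punct S v -> hull_punc (sact 0 (- v) S).
Proof.
move=> hS /(is_punct_shift (- v)); rewrite subrr => h.
by apply/hull_puncP; split; first exact: hull_shift.
Qed.

Lemma hull_aper S v w : hull S -> sact 0 v S = sact 0 w S -> v = w.
Proof.
move=> hS e; apply: contrapT => vw.
have := @hull_aperiodic _ c T hT S (v - w) hS.
apply; first by move=> /eqP; rewrite subr_eq0 => /eqP.
by rewrite translateE -sact0D e sact0D subrr sact_id.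
Qed.

Lemma RpuncP p : Rpunc p <->
  hull_punc p.1 /\ exists2 v, is_punct p.1 v & p.2 = sact 0 (- v) p.1.
Proof.
split=> [[h1 [t ht e]]|[h1 [v [i [ph h]] e]]]; split=> //.
  have [i [ph [v et]]] := hull_tiles h1.1 ht; exists v.
    by exists i, ph; rewrite -et.
  by rewrite e translateE et puncture_placed.
by exists (placed i ph v) => //; rewrite puncture_placed translateE.
Qed.

Lemma Rpunc_shift S v : hull_punc S -> is_punct S v -> Rpunc (S, sact 0 (- v) S).
Proof. by move=> hS hv; apply/RpuncP; split=> //; exists v. Qed.

Lemma Rpunc_refl S : hull_punc S -> Rpunc (S, S).
Proof.
move=> hS; apply/RpuncP; split=> //; exists 0; last by rewrite oppr0 sact_id.
by have /hull_puncP[_ [i [ph h]]] := hS; exists i, ph.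
Qed.

Lemma Rpunc_hull1 S S' : Rpunc (S, S') -> hull_punc S.
Proof. by case. Qed.

Lemma Rpunc_hull2 S S' : Rpunc (S, S') -> hull_punc S'.
Proof. by move=> /RpuncP[/= hS [v hv ->]]; apply: hull_punc_shift => //; case: hS. Qed.

Lemma Rpunc_sym S S' : Rpunc (S, S') -> Rpunc (S', S).
Proof.
move=> h; have h2 := Rpunc_hull2 h; move: h => /RpuncP[/= hS [v hv e]].
apply/RpuncP; split=> //=; exists (- v); last first.
  by rewrite e sact0D opprK addNr sact_id.
rewrite e; have /hull_puncP[_ [i [ph h]]] := hS.
by have := is_punct_shift (- v) (ex_intro _ i (ex_intro _ ph h)); rewrite add0r.
Qed.

Lemma Rpunc_trans S S' S'' : Rpunc (S, S') -> Rpunc (S', S'') -> Rpunc (S, S'').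
Proof.
move=> /RpuncP[/= hS [v hv e]] /RpuncP[/= hS' [w hw e']].
apply/RpuncP; split=> //=; exists (v + w); last by rewrite e' e sact0D opprD.
by move: hw; rewrite e => /(is_punct_shift v); rewrite sact0D addNr sact_id addrC.
Qed.

Lemma disp_shift S v : hull_punc S -> is_punct S v -> disp (S, sact 0 (- v) S) = v.
Proof.
move=> hS [i [ph hv]]; apply: xget_unique.
  by exists (placed i ph v); rewrite puncture_placed translateE.
move=> w [t [_ _ /=]]; rewrite translateE => /(hull_aper hS.1)/eqP.
by rewrite eqr_opp => /eqP.
Qed.

Lemma dispP p : Rpunc p -> is_punct p.1 (disp p) /\ p.2 = sact 0 (- disp p) p.1.
Proof.
case: p => S S' /RpuncP[/= hS [v hv ->]].
by rewrite disp_shift.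
Qed.

Lemma disp_eq S S' v : Rpunc (S, S') -> S' = sact 0 (- v) S -> disp (S, S') = v.
Proof.
move=> h e; have [_ /=] := dispP h; rewrite e => /(hull_aper h.1.1)/eqP.
by rewrite eqr_opp => /eqP.
Qed.

(** The displacement turns exactly with the tiling. By [dR_nearR] and [nearR_dR] this describes the
    neighbourhoods of [dR] on [Rpunc]. *)
Definition nearR r a p q := near_by r a p.1 q.1 /\ disp q = rotmx a *m disp p.

Lemma nearR_le r r' a p q : 0 < r' -> r' <= r -> nearR r a p q -> nearR r' a p q.
Proof. by move=> r0 rr [h1 h2]; split=> //; exact: near_by_le h1. Qed.

Lemma dGamma_ge0 S S' : 0 <= dGamma S S'.
Proof.
apply: lb_le_inf; first by exists 1; right.
by move=> e [[/andP[/ltW]]|->].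
Qed.

Lemma near_by_punct r a S S' v : 0 < r -> fnorm v + 3 <= r -> near_by r a S S' ->
  is_punct S v -> is_punct S' (rotmx a *m v).
Proof.
move=> r0 vr [_ h] [i [ph Sv]]; exists i, (a + ph).
have := h (placed i ph v); rewrite tact_placed addr0 => -[|/(_ Sv)//].
exact: placed_sub_eball0.
Qed.

Lemma punct_separated S v w : tiling S -> is_punct S v -> is_punct S w ->
  fnorm (v - w) < rho c -> v = w.
Proof.
move=> tS [i [ph h]] [j [ph' h']] vw.
have : placed i ph v = placed j ph' w by exact: tiling_separated tS h h' vw.
by move=> /placed_inj[].
Qed.

(** The turned displacement of [p] is a puncture of [q.1] closer than [rho] to the displacement of
    [q], so the two are equal. In [r1] the summand [fnorm v + 3] makes it a puncture, and the
    quotient by [rho c] keeps the rotation from moving it by more than [rho c / 2]. *)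
Lemma dR_nearR p (r : R) : Rpunc p -> 0 < r -> exists2 d : R, 0 < d &
  forall q, Rpunc q -> dR p q < d -> exists a, nearR r a p q.
Proof.
move=> hp r0; pose v := disp p; have v0 : 0 <= fnorm v by exact: fnorm_ge0.
have rho0 : 0 < rho c by exact: rho_gt0.
pose r1 := r + (fnorm v + 3) + 2 * fnorm v / rho c.
have q0 : 0 <= 2 * fnorm v / rho c by rewrite divr_ge0 ?mulr_ge0// ltW.
have r10 : 0 < r1 by rewrite /r1; lra.
have [d d0 hd] := @dGamma_near_by _ c T hc _ r10.
exists (Num.min d (rho c / 2)); first by rewrite lt_min d0 divr_gt0.
move=> q hq; rewrite /dR lt_min => /andP[h1 h2].
have dG0 := dGamma_ge0 p.1 q.1; have f0 := fnorm_ge0 (disp p - disp q).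
have [|a ha] := hd p.1 q.1 hp.1 hq.1; first by lra.
have [pv _] := dispP hp; have [qv _] := dispP hq.
exists a; split; first by apply: near_by_le ha => //; rewrite /r1; lra.
have qv' : is_punct q.1 (rotmx a *m disp p).
  by apply: near_by_punct ha pv => //; rewrite -/v /r1; lra.
apply: (punct_separated (hull_punc_tiling hq.1) qv qv').
apply: le_lt_trans (fnormB_le _ (disp p) _) _.
rewrite (fnormBC (disp q)) (fnormBC _ (rotmx a *m _)).
have : fnorm (rotmx a *m disp p - disp p) <= rho c / 2.
  apply: le_trans (fnorm_rot_sub _ _) _; rewrite -/v.
  apply: le_trans (_ : r1^-1 * fnorm v <= _).
    by rewrite ler_wpM2r// ltW//; case: ha.
  rewrite mulrC ler_pdivrMr// mulrC -ler_pdivrMr ?divr_gt0// invf_div.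
  have -> : fnorm v * (2 / rho c) = 2 * fnorm v / rho c by ring.
  by rewrite /r1; lra.
by lra.
Qed.

Lemma nearR_dR p (d : R) : Rpunc p -> 0 < d -> exists2 r : R, 0 < r &
  forall q a, nearR r a p q -> dR p q < d.
Proof.
move=> hp d0; pose v := disp p; have v0 : 0 <= fnorm v by exact: fnorm_ge0.
pose r := (2 + fnorm v) / d + 2.
have q0 : 0 < (2 + fnorm v) / d by rewrite divr_gt0//; lra.
have r0 : 0 < r by rewrite /r; lra.
exists r => // q a [h1 h2]; rewrite /dR h2 -/v fnormBC.
have g1 : dGamma p.1 q.1 <= r^-1 by apply: near_by_dGamma h1; rewrite /r; lra.
have g2 : fnorm (rotmx a *m v - v) <= r^-1 * fnorm v.
  apply: le_trans (fnorm_rot_sub _ _) _.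
  by rewrite ler_wpM2r// ltW//; case: h1.
have : r^-1 * (1 + fnorm v) < d.
  rewrite mulrC ltr_pdivrMr// /r mulrDr mulrC divfK ?gt_eqF//.
  by lra.
by rewrite mulrDr mulr1; lra.
Qed.

End Groupoid.

(** * Continuous functions of compact support on [R_punc] *)

Section CompactSupport.
Context {R : realType} (c : planeOf R) (T : tilesetOf R).
Context {hc : interior_puncture c} {hT : pinwheel_hull c T}.

Local Open Scope complex_scope.

Local Notation plane := (planeOf R).
Local Notation tileset := (tilesetOf R).
Local Notation Rpunc := (Rpunc c T).
Local Notation rpunc := (rpunc c T).
Local Notation disp := (displacement c).
Local Notation dR := (dR c).
Local Notation Cc := (Cc c T).
Local Notation is_punct := (is_punct c).
Local Notation nearR := (nearR c).
Local Notation normc := (@Normc.normc R).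
Implicit Types (S : tileset) (v w : plane) (p q : tileset * tileset) (f g : @pairfun R).

Lemma normcE (x : R[i]) : `|x| = (normc x)%:C. Proof. by []. Qed.

Lemma ltC_real (x y : R) : (x%:C < y%:C) = (x < y).
Proof. by rewrite ltcE /= eqxx. Qed.

Lemma posC_real (e : R[i]) : 0 < e -> exists2 d : R, 0 < d & e = d%:C.
Proof.
case: e => a b; rewrite ltcE /= => /andP[/eqP -> a0].
by exists a.
Qed.

Definition cts f := forall p, Rpunc p -> forall e : R, 0 < e ->
  exists2 r : R, 0 < r & forall q a, Rpunc q -> nearR r a p q -> normc (f q - f p) < e.

Lemma rpunc_valP (x : rpunc) : Rpunc (val x).
Proof. exact: set_valP. Qed.

Lemma rpunc_lift p : Rpunc p -> exists x : rpunc, val x = p.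
Proof. by move=> h; exists (exist _ p (mem_set h)). Qed.

Lemma openP (U : set rpunc) : open U <-> rpunc_open U.
Proof. by []. Qed.

Lemma nbhs_rpuncP (x : rpunc) (U : set rpunc) : open U -> U x -> nbhs x U.
Proof. by move=> oU Ux; exact: open_nbhs_nbhs. Qed.

Lemma ctsP f : cts f <-> continuous (fun x : rpunc => f (val x) : R[i]^o).
Proof.
split.
  move=> hf; apply/continuousP => A oA; apply/openP => x /= Ax.
  have [e' /= /posC_real[e e0 ->] hA] : nbhs_ball_ (@ball _ R[i]^o) (f (val x)) A.
    by apply/nbhs_ballP; rewrite openE in oA; exact: oA.
  have [r r0 hr] := hf _ (rpunc_valP x) e e0.
  have [d d0 hd] := dR_nearR (rpunc_valP x) r0.
  exists d => // y xy; have [a ha] := hd _ (rpunc_valP y) xy.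
  apply: hA; rewrite -ball_normE /ball_ /= normcE ltC_real -normcN opprB.
  exact: hr (rpunc_valP y) ha.
move=> hf p hp e e0; have [x ex] := rpunc_lift hp.
have h : nbhs (f (val x) : R[i]^o) (ball (f (val x) : R[i]^o) (e%:C)).
  by apply: nbhsx_ballx; rewrite ltC_real.
have := hf x _ h; rewrite /= nbhs_simpl /= topology_structure.nbhsE => -[V [oV Vx] hV].
have [d d0 hd] := oV _ Vx.
have [r r0 hr] := nearR_dR (rpunc_valP x) d0.
exists r => // q a hq; rewrite -ex => hn; have [y ey] := rpunc_lift hq.
have := hV y (hd _ _); rewrite ey => /(_ (hr _ _ hn)).
by rewrite -ball_normE /ball_ /= normcE ltC_real -normcN opprB ey.
Qed.

Definition dball (r : R) : set rpunc := [set x | fnorm (disp (val x)) <= r].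

(** Along an ultrafilter the first components tend to some [S]. The displacements, turned back, are
    among the finitely many punctures of [S] of norm at most [r], so one of them is constant along
    the ultrafilter. The choice of the rotation does not matter, as the tile at the origin
    determines its matrix. *)
Lemma compact_dball (r : R) : compact (dball r).
Proof.
rewrite compact_ultra => F UF Fr.
have [|S [hS nearS]] := @hull_punc_compact _ c T hc hT _ F UF (fun x => (val x).1).
  by apply: filterS (@filterT _ F _) => x _; case: (rpunc_valP x).
have finA : finite_set [set v | is_punct S v /\ fnorm v <= r].
  have := @finite_inball _ c hc S 0 (r + 3) (hull_punc_tiling hS).
  move=> /(finite_image (puncture c)); apply: sub_finite_set => v [[i [ph Sv]] vr].
  exists (placed c i ph v); last exact: puncture_placed.
  by split=> //; apply: placed_sub_eball0; rewrite lerD2r.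
have [|v [Sv vr] Fv] := @ultra_finite _ _ F UF _
    (fun v => [set x : rpunc | forall r' a, `|r| + 3 <= r' ->
       near_by r' a S (val x).1 -> disp (val x) = rotmx a *m v]) finA.
  have r0 : 0 < `|r| + 3 by rewrite ltr_wpDl.
  apply: filterS (filterI Fr (nearS _ r0)) => x [xr [a ha]].
  have [pv _] := dispP (rpunc_valP x).
  have pv' : is_punct S (rotmx (- a) *m disp (val x)).
    apply: near_by_punct (near_by_sym ha) pv => //.
    by rewrite lerD2r; apply: le_trans xr _; exact: ler_norm.
  exists (rotmx (- a) *m disp (val x)); first by split=> //; rewrite fnorm_rot.
  move=> r' a' rr' ha'.
  have : rotmx a' = rotmx a; last by move=> ->; rewrite rotKN.
  have /hull_puncP[hS' [i [ph Sp]]] := hS.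
  have tx : tiling c (val x).1 by apply: (@hull_punc_tiling _ c T); case: (rpunc_valP x).
  have e1 : tile0 (val x).1 = tact a 0 (tile0 S).
    apply: (tile0_agree (hull_tiling hS') tx ha.2); first by rewrite lerDr.
    by exists i, ph.
  have e2 : tile0 (val x).1 = tact a' 0 (tile0 S).
    apply: (tile0_agree (hull_tiling hS') tx ha'.2); last by exists i, ph.
    by apply: le_trans rr'; rewrite lerDr.
  move: e1; rewrite e2 (tile0_placed (hull_tiling hS') Sp) !tact_placed.
  by move=> /placed_inj[_ e _]; apply: (@rotmx_addI R ph); rewrite addrC e addrC.
have hp : Rpunc (S, sact 0 (- v) S) by exact: Rpunc_shift.
have [x ex] := rpunc_lift hp; exists x; split.
  by rewrite /dball /= ex disp_shift.
move=> U; rewrite topology_structure.nbhsE => -[V [oV Vx] VU].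
have [d d0 hd] := oV _ Vx.
have [r1 r10 hr1] := nearR_dR (rpunc_valP x) d0.
pose r2 := r1 + (`|r| + 3).
have r20 : 0 < r2 by rewrite /r2 addr_gt0// ltr_wpDl.
apply: filterS (filterI (nearS _ r20) Fv) => y [[a ha] hy].
apply: VU; apply: hd; apply: (hr1 _ a); rewrite ex; split=> /=.
  by apply: near_by_le ha => //; rewrite /r2 lerDl ltW// ltr_wpDl.
rewrite disp_shift//; apply: hy ha.
by rewrite /r2 lerDr ltW.
Qed.

Lemma disp_cts (U : set R) : open U -> open [set x : rpunc | U (fnorm (disp (val x)))].
Proof.
move=> oU; apply/openP => x /= Ux.
have [e /= e0 he] : nbhs_ball_ (@ball _ R^o) (fnorm (disp (val x))) U.
  by apply/nbhs_ballP; rewrite openE in oU; exact: oU.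
exists e => // y xy; apply: he; rewrite -ball_normE /ball_ /=.
have := dGamma_ge0 (val x).1 (val y).1.
have h1 := fnormB_le (disp (val x)) (disp (val y)) 0.
have h2 := fnormB_le (disp (val y)) (disp (val x)) 0.
rewrite !subr0 in h1 h2; rewrite (fnormBC (disp (val y))) in h2.
move: xy; rewrite /dR => xy g0; rewrite ltr_norml; apply/andP; split; lra.
Qed.

(** The displacement is continuous, hence bounded on a compact support; conversely a support of
    bounded displacement is compact by [compact_dball]. Compactness thus becomes an estimate that
    passes to sums and convolutions. *)
Lemma CcP f : Cc f <-> [/\ forall p, ~ Rpunc p -> f p = 0, cts f &
  exists r : R, forall p, f p <> 0 -> fnorm (disp p) <= r].
Proof.
split=> [[h0 hf hK]|[h0 hf [r hr]]].
  split=> //; first exact/ctsP.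
  have cd : continuous (fun x : rpunc => fnorm (disp (val x)) : R^o).
    by apply/continuousP => A; exact: disp_cts.
  have /compact_bounded[M [_ hM]] := continuous_compact (continuous_subspaceT cd) hK.
  exists (M + 1) => p fp; have hp : Rpunc p by apply: contrapT => /h0.
  have [x ex] := rpunc_lift hp.
  have M1 : M < M + 1 by rewrite ltrDl.
  have im : [set fnorm (disp (val x)) | x in closure [set p : rpunc | f (val p) <> 0]]
      (fnorm (disp p)).
    by exists x; [apply: subset_closure; rewrite /= ex|rewrite ex].
  by have := hM _ M1 _ im; rewrite /= ger0_norm ?fnorm_ge0.
split=> //; first exact/ctsP.
apply: (subclosed_compact (@closed_closure _ _) (@compact_dball r)).
move=> x hx; rewrite /dball /= leNgt; apply/negP => xr.
have /hx[y [/= fy]] : nbhs x [set y : rpunc | r < fnorm (disp (val y))].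
  apply: nbhs_rpuncP => //; apply: (@disp_cts [set y | r < y]).
  exact: open_gt.
by rewrite ltNge => /negP; apply; exact: hr.
Qed.

End CompactSupport.

(** * The convolution algebra of kernels *)

Section KernelAlgebra.
Context {R : realType} (c : planeOf R) (T : tilesetOf R).
Context {hc : interior_puncture c} {hT : pinwheel_hull c T}.

Local Open Scope complex_scope.

Local Notation plane := (planeOf R).
Local Notation tileset := (tilesetOf R).
Local Notation puncture := (puncture c).
Local Notation hull := (hull c T).
Local Notation hull_punc := (hull_punc c T).
Local Notation Rpunc := (Rpunc c T).
Local Notation eqclass := (eqclass c T).
Local Notation disp := (displacement c).
Local Notation Cc := (Cc c T).
Local Notation cts := (cts c T).
Local Notation conv := (Defs.conv c T).
Local Notation is_punct := (is_punct c).
Local Notation nearR := (nearR c).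
Local Notation normc := (@Normc.normc R).
Local Notation kadd := (@Defs.kadd R).
Implicit Types (S : tileset) (v w : plane) (p q : tileset * tileset) (f g : @pairfun R).

Lemma normcD (x y : R[i]) : normc (x + y) <= normc x + normc y.
Proof. exact: le_normcD. Qed.

Lemma normcM (x y : R[i]) : normc (x * y) = normc x * normc y.
Proof. exact: Normc.normcM. Qed.

Lemma normc_ge0 (x : R[i]) : 0 <= normc x.
Proof. by case: x => a b; exact: sqrtr_ge0. Qed.

(** The rotation is an argument of [h] because the terms of a convolution are indexed by punctures
    of the base point, and these turn with [a]. *)
Definition nlim p (h : tileset * tileset -> R -> R[i]) (l : R[i]) :=
  forall e : R, 0 < e -> exists2 r : R, 0 < r &
    forall q a, Rpunc q -> nearR r a p q -> normc (h q a - l) < e.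

Lemma nlim_common p h l h' l' : nlim p h l -> nlim p h' l' ->
  forall e : R, 0 < e -> exists2 r : R, 0 < r &
    forall q a, Rpunc q -> nearR r a p q -> normc (h q a - l) < e /\ normc (h' q a - l') < e.
Proof.
move=> h1 h2 e e0; have [r r0 hr] := h1 e e0; have [r' r'0 hr'] := h2 e e0.
exists (r + r'); first exact: addr_gt0.
move=> q a hq hn; split.
  by apply: hr => //; apply: nearR_le hn => //; rewrite lerDl ltW.
by apply: hr' => //; apply: nearR_le hn => //; rewrite lerDr ltW.
Qed.

Lemma nlim_add p h l h' l' : nlim p h l -> nlim p h' l' ->
  nlim p (fun q a => h q a + h' q a) (l + l').
Proof.
move=> h1 h2 e e0; have e2 : 0 < e / 2 by rewrite divr_gt0.
have [r r0 hr] := nlim_common h1 h2 e2; exists r => // q a hq hn.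
have [a1 a2] := hr q a hq hn; rewrite opprD addrACA.
by apply: le_lt_trans (normcD _ _) _; lra.
Qed.

Lemma nlim_mul p h l h' l' : nlim p h l -> nlim p h' l' ->
  nlim p (fun q a => h q a * h' q a) (l * l').
Proof.
move=> h1 h2 e e0.
pose K := normc l + normc l' + 1.
have K0 : 0 < K by rewrite /K; have := normc_ge0 l; have := normc_ge0 l'; lra.
pose d := Num.min 1 (e / K).
have d0 : 0 < d by rewrite lt_min ltr01 divr_gt0.
have d1 : d <= 1 by rewrite ge_min lexx.
have dK : d * K <= e by rewrite -ler_pdivlMr// ge_min lexx orbT.
have [r r0 hr] := nlim_common h1 h2 d0; exists r => // q a hq hn.
have [a1 a2] := hr q a hq hn.
have -> : h q a * h' q a - l * l' = (h q a - l) * (h' q a - l') +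
    ((h q a - l) * l' + l * (h' q a - l')) by ring.
apply: le_lt_trans (normcD _ _) _; rewrite normcM.
have := normcD ((h q a - l) * l') (l * (h' q a - l')); rewrite !normcM => b1.
have := normc_ge0 l; have := normc_ge0 l'.
have := normc_ge0 (h q a - l); have := normc_ge0 (h' q a - l').
move: a1 a2 b1 dK; rewrite /K.
move: (normc (_ + _)) (normc (h q a - l)) (normc (h' q a - l')) (normc l) (normc l').
move=> z x y m m' x0 y0 b1 dK y00 x00 m'0 m0.
have c1 : x * y <= d * 1 by rewrite ler_pM// ltW// (lt_le_trans y0).
have c2 : x * m' <= d * m' by rewrite ler_wpM2r// ltW.
have c3 : m * y <= m * d by rewrite ler_wpM2l// ltW.
have [c4|c4] := eqVneq x 0; first by rewrite c4 mul0r in c1 c2 b1 *; nra.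
have : x * y < d * 1.
  by apply: ltr_pM => //; [apply: lt_le_trans y0 d1].
by lra.
Qed.

Lemma nlim_cst p (l : R[i]) : nlim p (fun _ _ => l) l.
Proof.
move=> e e0; exists 1 => // q a _ _.
by rewrite subrr Normc.normc0.
Qed.

Lemma nlim_sum p (I : eqType) (s : seq I) (h : I -> tileset * tileset -> R -> R[i])
    (l : I -> R[i]) : (forall i, i \in s -> nlim p (h i) (l i)) ->
  nlim p (fun q a => \sum_(i <- s) h i q a) (\sum_(i <- s) l i).
Proof.
elim: s => [_|i s IH hs].
  rewrite big_nil (_ : (fun _ _ => _) = fun _ _ => 0); first exact: nlim_cst.
  by apply/funext => q; apply/funext => a; rewrite big_nil.
rewrite big_cons (_ : (fun _ _ => _) = fun q a => h i q a + \sum_(j <- s) h j q a).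
  apply: nlim_add; first by apply: hs; rewrite inE eqxx.
  by apply: IH => j js; apply: hs; rewrite inE js orbT.
by apply/funext => q; apply/funext => a; rewrite big_cons.
Qed.

Lemma nlim_near p h h' l (r1 : R) : 0 < r1 ->
  (forall q a, Rpunc q -> nearR r1 a p q -> h q a = h' q a) -> nlim p h' l -> nlim p h l.
Proof.
move=> r10 e hl d d0; have [r r0 hr] := hl d d0.
exists (r + r1); first exact: addr_gt0.
move=> q a hq hn; rewrite (e _ _ hq); last by apply: nearR_le hn => //; rewrite lerDr ltW.
by apply: hr => //; apply: nearR_le hn => //; rewrite lerDl ltW.
Qed.

Lemma cts_nlim f : cts f <-> forall p, Rpunc p -> nlim p (fun q _ => f q) (f p).
Proof. by []. Qed.

Lemma Cc_supp f p : Cc f -> f p <> 0 -> Rpunc p.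
Proof. by move=> [h _ _] fp; apply: contrapT => /h. Qed.

Lemma Cc_kadd f g : Cc f -> Cc g -> Cc (kadd f g).
Proof.
move=> /CcP[f0 fc [r hr]] /CcP[g0 gc [r' hr']]; apply/CcP; split.
- by move=> p hp; rewrite /Defs.kadd f0// g0// addr0.
- by apply/cts_nlim => p hp; apply: nlim_add; [exact: fc|exact: gc].
exists (Num.max r r') => p hp; rewrite le_max; apply/orP.
have [fp|fp] := eqVneq (f p) 0; last by left; apply: hr; apply/eqP.
by right; apply: hr'; move: hp; rewrite /Defs.kadd fp add0r.
Qed.

Lemma Cc_kscale k f : Cc f -> Cc (kscale k f).
Proof.
move=> /CcP[f0 fc [r hr]]; apply/CcP; split.
- by move=> p hp; rewrite /kscale f0// mulr0.
- by apply/cts_nlim => p hp; apply: nlim_mul; [exact: nlim_cst|exact: fc].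
by exists r => p hp; apply: hr => fp; apply: hp; rewrite /kscale fp mulr0.
Qed.

Lemma ksubE f g : ksub f g = kadd f (kscale (-1) g).
Proof. by apply/funext => p; rewrite /ksub /Defs.kadd /kscale mulN1r. Qed.

Lemma Cc_ksub f g : Cc f -> Cc g -> Cc (ksub f g).
Proof. by move=> hf hg; rewrite ksubE; apply: Cc_kadd => //; exact: Cc_kscale. Qed.

Lemma sact_shift_inj S v w : hull S -> sact 0 (- v) S = sact 0 (- w) S -> v = w.
Proof. by move=> hS /(hull_aper hS)/eqP; rewrite eqr_opp => /eqP. Qed.

(** Punctures replace tilings as summation index: near a given base point the index set is then a
    rotated copy of a fixed finite set. *)
Lemma conv_sumE f g S S' (s : seq plane) : hull_punc S -> uniq s ->
  (forall v, v \in s -> is_punct S v) ->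
  (forall v, is_punct S v -> f (S, sact 0 (- v) S) <> 0 -> v \in s) ->
  conv f g (S, S') =
  \sum_(v <- s) f (S, sact 0 (- v) S) * g (sact 0 (- v) S, S').
Proof.
move=> hS us hs hf; rewrite /Defs.conv /=.
pose D := [set` map (fun v => sact 0 (- v) S) s].
have uD : uniq (map (fun v => sact 0 (- v) S) s).
  by rewrite map_inj_in_uniq// => v w _ _; exact: (sact_shift_inj hS.1).
transitivity (\sum_(S3 \in D) f (S, S3) * g (S3, S')); last first.
  by rewrite /D -fsbig_seq// big_map.
symmetry; apply: fsbig_widen.
  by move=> S3 /mapP[v vs ->]; apply: Rpunc_shift => //; exact: hs.
move=> S3 [/= hS3 nS3]; have [pv e] := dispP hS3.
have [f0|/eqP f0] := eqVneq (f (S, S3)) 0; first by rewrite f0 mul0r.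
exfalso; apply: nS3; rewrite /= in e pv; rewrite e; apply/mapP.
by exists (disp (S, S3)) => //; apply: hf => //; rewrite -e.
Qed.

Lemma conv_neq0 f g p : conv f g p <> 0 -> exists2 S3, eqclass p.1 S3 &
  f (p.1, S3) <> 0 /\ g (S3, p.2) <> 0.
Proof.
move=> h; apply: contrapT => hN; apply: h; rewrite /Defs.conv fsbig1// => S3 h3.
apply: contrapT => fg; apply: hN; exists S3 => //; split=> e; apply: fg.
  by rewrite e mul0r.
by rewrite e mulr0.
Qed.

Lemma disp_trans S S' S'' : Rpunc (S, S') -> Rpunc (S', S'') ->
  disp (S, S'') = disp (S, S') + disp (S', S'').
Proof.
move=> h h'; have [_ /= e] := dispP h; have [_ /= e'] := dispP h'.
apply: disp_eq; first exact: Rpunc_trans h h'.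
by move: e e'; move: (disp _) (disp _) => v w -> ->; rewrite sact0D opprD.
Qed.

Lemma finite_punct S (r : R) : hull_punc S ->
  exists s : seq plane, uniq s /\ forall v, v \in s <-> is_punct S v /\ fnorm v <= r.
Proof.
move=> hS; have : finite_set [set v | is_punct S v /\ fnorm v <= r].
  have := @finite_inball _ c hc S 0 (r + 3) (hull_punc_tiling hS).
  move=> /(finite_image puncture); apply: sub_finite_set => v [[i [ph Sv]] vr].
  exists (placed c i ph v); last exact: puncture_placed.
  by split=> //; apply: placed_sub_eball0; rewrite lerD2r.
move=> /finite_seqP[s es]; exists (undup s); split; first exact: undup_uniq.
by move=> v; rewrite mem_undup; have /seteqP[h1 h2] := es; split=> [/h2|/h1].
Qed.

(** For [q] near [p] the intermediate tilings correspond to the punctures of [p.1] turned by [a], so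
    the convolution is a fixed finite sum of products that have limits. Displacements add along a
    product, which bounds the support. *)
Lemma Cc_conv f g : Cc f -> Cc g -> Cc (conv f g).
Proof.
move=> Cf Cg; have [f0 fc [rf hf]] := (CcP f).1 Cf; have [g0 gc [rg hg]] := (CcP g).1 Cg.
apply/CcP; split.
- move=> [S S'] hp; apply: contrapT => /conv_neq0[S3 h3 [/= /(Cc_supp Cf) h1]].
  by move=> /(Cc_supp Cg) h2; apply: hp; exact: Rpunc_trans h1 h2.
- apply/cts_nlim => -[S S'] hp; have hS : hull_punc S by exact: Rpunc_hull1 hp.
  have [s [us hs]] := finite_punct rf hS.
  pose h v q a := f (q.1, sact 0 (- (rotmx a *m v)) q.1) *
    g (sact 0 (- (rotmx a *m v)) q.1, q.2).
  rewrite (@conv_sumE f g S S' s) //; last 2 first.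
  + by move=> v /hs[].
  + by move=> v vS fv; apply/hs; split=> //; rewrite -(disp_shift hS vS); exact: hf.
  have r10 : 0 < `|rf| + 3 by rewrite ltr_wpDl.
  apply: (nlim_near (h' := fun q a => \sum_(v <- s) h v q a) r10).
    move=> [S1 S1'] a hq [/= hn _].
    rewrite (@conv_sumE f g S1 S1' (map (mulmx (rotmx a)) s)).
    - by rewrite big_map.
    - exact: Rpunc_hull1 hq.
    - rewrite map_inj_uniq// => v w /(congr1 (mulmx (rotmx (- a)))).
      by rewrite !rotNK.
    - move=> _ /mapP[v /hs[vS vr] ->]; apply: near_by_punct hn vS => //.
      by rewrite lerD2r (le_trans vr)// ler_norm.
    move=> v vS1 fv; apply/mapP; exists (rotmx (- a) *m v); last by rewrite rotKN.
    have vr : fnorm v <= rf by rewrite -(disp_shift (Rpunc_hull1 hq) vS1); exact: hf.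
    apply/hs; split; last by rewrite fnorm_rot.
    apply: near_by_punct (near_by_sym hn) vS1 => //.
    by rewrite lerD2r (le_trans vr)// ler_norm.
  apply: nlim_sum => v /hs[vS vr]; apply: nlim_mul.
    move=> e e0; have hpv := Rpunc_shift hS vS.
    have [r r0 hr] := fc _ hpv e e0.
    have v3 : 0 < fnorm v + 3 by rewrite ltr_wpDl// fnorm_ge0.
    exists (r + (fnorm v + 3)); first by rewrite addr_gt0.
    move=> [S1 S1'] a hq [/= hn _].
    have vS1 : is_punct S1 (rotmx a *m v).
      apply: near_by_punct hn vS; first by rewrite addr_gt0.
      by rewrite lerDr ltW.
    apply: (hr _ a); first exact: Rpunc_shift (Rpunc_hull1 hq) vS1.
    split=> /=; first by apply: near_by_le hn => //; rewrite lerDl ltW.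
    by rewrite !disp_shift//; exact: Rpunc_hull1 hq.
  move=> e e0; have hpv := Rpunc_trans (Rpunc_sym (Rpunc_shift hS vS)) hp.
  have [r r0 hr] := gc _ hpv e e0.
  have v3 : 0 < fnorm v + 3 by rewrite ltr_wpDl// fnorm_ge0.
  exists (r + (fnorm v + 3)); first by rewrite addr_gt0.
  move=> [S1 S1'] a hq [/= hn hd].
  have hS1 := Rpunc_hull1 hq.
  have vS1 : is_punct S1 (rotmx a *m v).
    apply: near_by_punct hn vS; first by rewrite addr_gt0.
    by rewrite lerDr ltW.
  have hqv := Rpunc_trans (Rpunc_sym (Rpunc_shift hS1 vS1)) hq.
  have v0 := fnorm_ge0 v.
  apply: (hr _ a) => //; split=> /=.
    split; first by have [] := near_by_le (r' := r) r0 _ hn => //; lra.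
    have vv : fnorm (- v) <= fnorm v + 3 by rewrite fnormN; lra.
    by have := agree_shift vv hn.2; rewrite addrK mulmxN.
  have dd S2 S2' w : Rpunc (S2, S2') -> is_punct S2 w ->
      disp (sact 0 (- w) S2, S2') = disp (S2, S2') - w.
    move=> h2 hw; have hS2 := Rpunc_hull1 h2; have h3 := Rpunc_shift hS2 hw.
    by rewrite (disp_trans h3 (Rpunc_trans (Rpunc_sym h3) h2)) disp_shift// addrAC subrr add0r.
  by rewrite !dd// hd mulmxBr.
exists (rf + rg) => -[S S'] /conv_neq0[S3 h3 [/= h1 h2]].
rewrite (disp_trans (Cc_supp Cf h1) (Cc_supp Cg h2)).
by apply: le_trans (fnormD _ _) _; apply: lerD; [exact: hf|exact: hg].
Qed.

End KernelAlgebra.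

(** * The generators of the algebras of level [N] *)

Section Generators.
Context {R : realType} (c : planeOf R) (T : tilesetOf R).
Context {hc : interior_puncture c} {hT : pinwheel_hull c T}.

Local Open Scope complex_scope.

Local Notation plane := (planeOf R).
Local Notation tileset := (tilesetOf R).
Local Notation puncture := (puncture c).
Local Notation hull_punc := (hull_punc c T).
Local Notation Rpunc := (Rpunc c T).
Local Notation disp := (displacement c).
Local Notation Cc := (Cc c T).
Local Notation conv := (Defs.conv c T).
Local Notation addr := (addr c T).
Local Notation is_punct := (is_punct c).
Local Notation nearR := (nearR c).
Local Notation normc := (@Normc.normc R).
Implicit Types (S : tileset) (v w : plane) (p q : tileset * tileset) (f g : @pairfun R).

Lemma expiD (a b : R) : expi (a + b) = expi a * expi b.
Proof. by rewrite /expi cosD sinD; simpc; rewrite (addrC (cos a * sin b)). Qed.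

Lemma expi_rot (a b : R) : rotmx a = rotmx b -> expi a = expi b.
Proof. by move=> /rotmx_eqP[hcos hsin]; rewrite /expi hcos hsin. Qed.

Lemma normc_expi (a : R) : normc (expi a) = 1.
Proof. by rewrite /Normc.normc /expi cos2Dsin2 sqrtr1. Qed.

Lemma normc_sqr (x : R[i]) : normc x ^+ 2 = complex.Re x ^+ 2 + complex.Im x ^+ 2.
Proof. by case: x => a b; rewrite sqr_sqrtr// addr_ge0// sqr_ge0. Qed.

Lemma normc_expi1 (a : R) : normc (expi a - 1) <= fnorm (rotmx a - 1%:M).
Proof.
rewrite -(ler_pXn2r (n := 2)) ?nnegrE ?fnorm_ge0 ?normc_ge0// normc_sqr.
rewrite fnorm_sqr !big_ord_recl !big_ord0 /= !addr0 !mxE /=.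
by rewrite !subr0 sqrrN lerDl addr_ge0// sqr_ge0.
Qed.

Lemma normc_exprz1 (w : R[i]) (k : int) : normc w = 1 ->
  normc (w ^ k - 1) <= `|k|%:R * normc (w - 1).
Proof.
move=> w1; have wn n : normc (w ^+ n) = 1.
  by elim: n => [|n IH]; rewrite ?expr0 ?Normc.normc1// exprS normcM w1 IH mulr1.
have hn n : normc (w ^+ n - 1) <= n%:R * normc (w - 1).
  elim: n => [|n IH]; first by rewrite expr0 subrr Normc.normc0 mul0r.
  have -> : w ^+ n.+1 - 1 = w * (w ^+ n - 1) + (w - 1) by rewrite exprS; ring.
  apply: le_trans (normcD _ _) _; rewrite normcM w1 mul1r -natr1 mulrDl mul1r.
  by rewrite lerD2r.
case: k => n; first by rewrite -exprnP.
rewrite NegzE -exprnN abszN.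
have w0 : w ^+ n.+1 != 0.
  by apply/eqP => e; have := wn n.+1; rewrite e Normc.normc0 => /eqP; rewrite eq_sym oner_eq0.
have -> : w ^- n.+1 - 1 = - (w ^- n.+1 * (w ^+ n.+1 - 1)).
  by rewrite mulrBr mulVf// mulr1 opprB.
by rewrite normcN normcM Normc.normcV wn invr1 mul1r; exact: hn.
Qed.

Lemma normc_exprz (w : R[i]) (k : int) : normc w = 1 -> normc (w ^ k) = 1.
Proof.
move=> w1; have wn n : normc (w ^+ n) = 1.
  by elim: n => [|n IH]; rewrite ?expr0 ?Normc.normc1// exprS normcM w1 IH mulr1.
by case: k => n; rewrite ?NegzE -?exprnN -?exprnP ?Normc.normcV wn ?invr1.
Qed.

Definition zeta S : R[i] := expi (angle c (tile0 S)).

Lemma normc_zeta S : normc (zeta S) = 1. Proof. exact: normc_expi. Qed.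

Lemma zeta_neq0 S : zeta S != 0.
Proof.
apply/eqP => e; have := normc_zeta S; rewrite e Normc.normc0 => /eqP.
by rewrite eq_sym oner_eq0.
Qed.

Lemma zeta_addr N i ph t S : addr N i ph t S -> zeta S = expi ph * expi (angle c t).
Proof.
move=> h; rewrite /zeta (addr_tile0 h) -expiD; apply: expi_rot.
exact/angle_tact/tiles_omega_iter_proto/addr_sub/h.
Qed.

Lemma zeta_near (r a : R) S S' : hull_punc S -> hull_punc S' -> near_by r a S S' ->
  3 <= r -> zeta S' = expi a * zeta S.
Proof.
move=> hS hS' [_ h] r3; have /hull_puncP[hS1 [i [ph Sp]]] := hS.
have e : tile0 S' = tact a 0 (tile0 S).
  by apply: (tile0_agree (hull_tiling hS1) (hull_punc_tiling hS') h r3); exists i, ph.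
rewrite /zeta e -expiD; apply: expi_rot; apply: angle_tact.
rewrite (tile0_placed (hull_tiling hS1) Sp); by do 3 eexists.
Qed.

Lemma VNP N i t t' p : omega_iter_proto c N i t -> omega_iter_proto c N i t' ->
  VN c T N i t t' p <-> exists2 ph, addr N i ph t p.1 &
    p.2 = sact 0 (rotmx ph *m (puncture t - puncture t')) p.1.
Proof.
move=> ht ht'; split.
  move=> [S [ph [hS Sp ->]]] /=; exists ph.
    by exists S; split=> //; rewrite translateE.
  by rewrite !translateE sact0D mulmxBr addrA addNr add0r.
case: p => S1 S2 /= [ph [S [hS Sp _ ->]] ->].
exists S, ph; split=> //; rewrite !translateE sact0D mulmxBr addrA addNr.
by rewrite add0r.
Qed.

Lemma addr_punct N i ph t t' S : addr N i ph t S -> omega_iter_proto c N i t' ->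
  is_punct S (rotmx ph *m (puncture t' - puncture t)).
Proof.
move=> h ht'; have := addr_mem h ht'.
have [j [b [w ->]]] := tiles_omega_iter_proto ht'.
rewrite puncture_placed tact_placed -mulmxBr => hw.
by exists j, (ph + b).
Qed.

Lemma VN_Rpunc N i t t' p : omega_iter_proto c N i t -> omega_iter_proto c N i t' ->
  VN c T N i t t' p -> Rpunc p.
Proof.
move=> ht ht' /(VNP _ ht ht')[ph h e]; apply/RpuncP; split; first exact: addr_punc h.
by exists (rotmx ph *m (puncture t' - puncture t));
  [exact: addr_punct h ht'|rewrite e -mulmxN opprB].
Qed.

Definition gen (k : int) N i t t' : @pairfun R := conv (zpow c T k) (eN c T N i t t').

(** Powers of [z] are carried by the diagonal, so the convolution has a single term. *)
Lemma genE k N i t t' p : omega_iter_proto c N i t -> omega_iter_proto c N i t' ->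
  gen k N i t t' p = if `[< VN c T N i t t' p >] then zeta p.1 ^ k else 0.
Proof.
move=> ht ht'; have [hV|hV] := asboolP (VN c T N i t t' p).
  have hp := VN_Rpunc ht ht' hV; have hS : hull_punc p.1 by case: hp.
  case: p hV hp hS => S S' hV hp /= hS.
  rewrite /gen (@conv_sumE _ c T hT (zpow c T k) (eN c T N i t t') S S' [:: 0]) //.
  - have hz : Rpunc (S, S) /\ S = S by split=> //; exact: Rpunc_refl.
    by rewrite big_seq1 oppr0 sact_id /zpow /eN /= (asboolT hV) (asboolT hz) mulr1.
  - move=> v; rewrite inE => /eqP ->; have /hull_puncP[_ [j [b h]]] := hS.
    by exists j, b.
  move=> v vS; rewrite /zpow; case: asboolP => //= -[_ e] _; rewrite inE; apply/eqP.
  by apply: (sact_shift_inj hS.1); rewrite oppr0 sact_id -e.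
apply: contrapT => /conv_neq0[S3 _ [/=]]; rewrite /zpow; case: asboolP => //= -[_ <-] _.
by rewrite /eN; case: asboolP => // h; case: hV; case: (p) h.
Qed.

(** [V_N] is open and closed: close to [p] the address of the first component and the displacement
    are those of [p] up to the same rotation, and together they decide membership. *)
Lemma VN_near N i t t' p : omega_iter_proto c N i t -> omega_iter_proto c N i t' ->
  Rpunc p -> exists2 r : R, 0 < r & forall q a, Rpunc q -> nearR r a p q ->
    (VN c T N i t t' q <-> VN c T N i t t' p).
Proof.
move=> ht ht' hp; have [i1 [ph1 [t1 h1]]] := addr_exists N hp.1.
have [r r0 hr] := addr_near h1; exists r => // q a hq [hn hd].
have h1q := hr _ _ hq.1 hn.
have [_ ep] := dispP hp; have [_ eq] := dispP hq.
split.
  move=> /(VNP _ ht ht')[ph h e]; have [ei er et] := addr_unique h1q h; subst i1 t1.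
  apply/VNP => //; exists ph1 => //.
  rewrite ep; congr (sact 0 _ _).
  have : - disp q = rotmx ph *m (puncture t - puncture t').
    by apply: (hull_aper hq.1.1); rewrite -eq.
  rewrite -er hd rotmxD -mulmxA -mulmxN => /(congr1 (mulmx (rotmx (- a)))).
  by rewrite !rotNK.
move=> /(VNP _ ht ht')[ph h e]; have [ei er et] := addr_unique h1 h; subst i1 t1.
apply/VNP => //; exists (a + ph1) => //.
rewrite eq hd; congr (sact 0 _ _); rewrite rotmxD -mulmxA -mulmxN; congr (_ *m _).
by apply: (hull_aper hp.1.1); rewrite -ep er.
Qed.

(** Close to [p] either both values vanish or they differ by the factor [expi a ^ k], which is near
    [1]. On the support the displacement has constant norm. *)
Lemma Cc_gen k N i t t' : omega_iter_proto c N i t -> omega_iter_proto c N i t' ->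
  Cc (gen k N i t t').
Proof.
move=> ht ht'; apply/CcP; split.
- move=> p hp; rewrite genE//; case: asboolP => // /(VN_Rpunc ht ht').
  by move=> /hp.
- move=> p hp e e0; have [r1 r10 hr1] := VN_near ht ht' hp.
  pose r2 := (`|k|%:R + 1) / e; have r20 : 0 < r2 by rewrite divr_gt0// ltr_wpDl.
  have rr0 : 0 < r1 + r2 + 3 by rewrite !addr_gt0.
  exists (r1 + r2 + 3) => // q a hq hn; rewrite !genE//.
  have hV : VN c T N i t t' q <-> VN c T N i t t' p.
    apply: (hr1 q a) => //; apply: nearR_le hn => //.
    by rewrite -addrA lerDl addr_ge0// ltW.
  have -> : `[< VN c T N i t t' q >] = `[< VN c T N i t t' p >].
    by apply/asboolP/asboolP => /hV.
  case: asboolP => _; last by rewrite subrr Normc.normc0.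
  have r3 : 3 <= r1 + r2 + 3 by rewrite lerDr addr_ge0// ltW.
  rewrite (zeta_near hp.1 hq.1 hn.1 r3) expfzMl.
  have -> : expi a ^ k * zeta p.1 ^ k - zeta p.1 ^ k =
    (expi a ^ k - 1) * zeta p.1 ^ k by rewrite mulrBl mul1r.
  rewrite normcM (normc_exprz k (normc_zeta _)) mulr1.
  apply: le_lt_trans (normc_exprz1 k (normc_expi a)) _.
  have : normc (expi a - 1) <= r2^-1.
    apply: le_trans (normc_expi1 a) _; have [[h _] _] := hn; apply: le_trans (ltW h) _.
    by rewrite lef_pV2 ?posrE//; lra.
  move=> hle; apply: le_lt_trans (ler_wpM2l (ler0n _ _) hle) _.
  by rewrite /r2 invf_div mulrA ltr_pdivrMr ?ltr_wpDl// mulrDr mulr1 mulrC ltrDl.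
exists (fnorm (puncture t' - puncture t)) => p.
rewrite genE//; case: asboolP => // hV _.
have := hV; move=> /(VNP _ ht ht')[ph h e]; have hp := VN_Rpunc ht ht' hV.
case: p hp e h {hV} => S S' hp /= e h.
rewrite (disp_eq (v := rotmx ph *m (puncture t' - puncture t)) hp) ?fnorm_rot//.
by rewrite -mulmxN opprB.
Qed.

End Generators.

(** * Operator norms of kernels *)

Section KernelBounds.
Context {R : realType} (c : planeOf R) (T : tilesetOf R).
Context {hc : interior_puncture c} {hT : pinwheel_hull c T}.

Local Open Scope complex_scope.

Local Notation tileset := (tilesetOf R).
Local Notation hull_punc := (hull_punc c T).
Local Notation Rpunc := (Rpunc c T).
Local Notation eqclass := (eqclass c T).
Local Notation disp := (displacement c).
Local Notation Cc := (Cc c T).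
Local Notation conv := (Defs.conv c T).
Local Notation rednorm := (rednorm c T).
Local Notation l2norm := (l2norm c T).
Local Notation kadd := (@Defs.kadd R).
Local Notation normc := (@Normc.normc R).
Implicit Types (S x y z : tileset) (A B E : seq tileset) (f g : @pairfun R)
  (xi : tileset -> R[i]) (C D : R).

Definition sqnorm A xi : R := \sum_(x <- A) normc (xi x) ^+ 2.

Lemma sqnorm_ge0 A xi : 0 <= sqnorm A xi.
Proof. exact: sum_sqr_ge0. Qed.

Definition in_class S A := forall x, x \in A -> eqclass S x.

(* Finitely supported vectors suffice to compute the norms of the [pi_(T_0)], and they
   keep summability out of the estimates. *)
Definition kbound C f := forall S, hull_punc S -> forall A B xi, uniq A -> uniq B ->
  in_class S A -> in_class S B ->
  sqnorm A (fun x => \sum_(y <- B) f (x, y) * xi y) <= C ^+ 2 * sqnorm B xi.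

Lemma kbound_le C D f : 0 <= C -> C <= D -> kbound C f -> kbound D f.
Proof.
move=> C0 CD h S hS A B xi uA uB hA hB; apply: le_trans (h _ hS _ _ _ uA uB hA hB) _.
by rewrite ler_wpM2r ?sqnorm_ge0// ler_pXn2r// nnegrE// (le_trans C0).
Qed.

Lemma minkowski_sqr (I : Type) (s : seq I) (a b : I -> R) (X Y : R) : 0 <= X -> 0 <= Y ->
  (forall i, 0 <= a i) -> (forall i, 0 <= b i) ->
  \sum_(i <- s) a i ^+ 2 <= X ^+ 2 -> \sum_(i <- s) b i ^+ 2 <= Y ^+ 2 ->
  \sum_(i <- s) (a i + b i) ^+ 2 <= (X + Y) ^+ 2.
Proof.
move=> X0 Y0 a0 b0 hX hY.
have -> : \sum_(i <- s) (a i + b i) ^+ 2 = \sum_(i <- s) a i ^+ 2 +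
    \sum_(i <- s) b i ^+ 2 + 2 * \sum_(i <- s) a i * b i.
  rewrite mulr_sumr -!big_split /=; apply: eq_bigr => i _; ring.
have : \sum_(i <- s) a i * b i <= X * Y.
  rewrite -(ler_pXn2r (n := 2)) ?nnegrE ?mulr_ge0//; last first.
    by apply: sumr_ge0 => i _; exact: mulr_ge0.
  apply: le_trans (cauchy_schwarz_sum _ _ _) _; rewrite exprMn.
  by apply: ler_pM => //; exact: sum_sqr_ge0.
by move: hX hY; lra.
Qed.

Lemma sqnormD A (a b : tileset -> R[i]) (X Y : R) : 0 <= X -> 0 <= Y ->
  sqnorm A a <= X ^+ 2 -> sqnorm A b <= Y ^+ 2 ->
  sqnorm A (fun x => a x + b x) <= (X + Y) ^+ 2.
Proof.
move=> X0 Y0 hX hY; apply: le_trans (_ : \sum_(x <- A) (normc (a x) + normc (b x)) ^+ 2 <= _).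
  by apply: ler_sum => x _; rewrite ler_pXn2r ?nnegrE ?addr_ge0 ?normc_ge0// normcD.
by apply: minkowski_sqr => // x; exact: normc_ge0.
Qed.

Lemma kbound_kadd C D f g : 0 <= C -> 0 <= D -> kbound C f -> kbound D g ->
  kbound (C + D) (kadd f g).
Proof.
move=> C0 D0 hf hg S hS A B xi uA uB hA hB.
pose X := Num.sqrt (sqnorm B xi); have X2 : X ^+ 2 = sqnorm B xi.
  by rewrite sqr_sqrtr// sqnorm_ge0.
have X0 : 0 <= X by exact: sqrtr_ge0.
have -> : (fun x => \sum_(y <- B) kadd f g (x, y) * xi y) =
    (fun x => \sum_(y <- B) f (x, y) * xi y + \sum_(y <- B) g (x, y) * xi y).
  by apply/funext => x; rewrite -big_split; apply: eq_bigr => y _; rewrite /Defs.kadd mulrDl.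
rewrite -X2 -exprMn mulrDl; apply: sqnormD; rewrite ?mulr_ge0// exprMn X2.
  exact: hf hA hB.
exact: hg hA hB.
Qed.

Lemma kbound_kscale C f k : kbound C f -> kbound (normc k * C) (kscale k f).
Proof.
move=> hf S hS A B xi uA uB hA hB.
rewrite exprMn -mulrA; apply: le_trans (ler_wpM2l (sqr_ge0 _) (hf _ hS _ _ _ uA uB hA hB)).
rewrite /sqnorm mulr_sumr; apply: ler_sum => x _; rewrite -exprMn -normcM mulr_sumr.
rewrite (eq_bigr (fun y => k * (f (x, y) * xi y)))// => y _.
by rewrite /kscale mulrA.
Qed.

Lemma fsum_cover (P : set tileset) (F : tileset -> R[i]) E : uniq E ->
  (forall z, z \in E -> P z) -> (forall z, P z -> F z <> 0 -> z \in E) ->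
  \sum_(z \in P) F z = \sum_(z <- E) F z.
Proof.
move=> uE hE hF; transitivity (\sum_(z \in [set` E]) F z); last by rewrite -fsbig_seq.
symmetry; apply: fsbig_widen => // z [Pz nz].
by apply: contrapT => Fz; apply: nz; exact: hF.
Qed.

Lemma eqclass_sub S x z : eqclass S x -> eqclass S z -> eqclass x z.
Proof. by move=> hx hz; exact: Rpunc_trans (Rpunc_sym hx) hz. Qed.

(** Bounded displacement leaves finitely many nonzero entries in each row, so a finite set of
    columns serves all rows in [A]. *)
Lemma row_support f S A : Cc f -> hull_punc S -> in_class S A ->
  exists E, [/\ uniq E, in_class S E &
    forall x z, x \in A -> f (x, z) <> 0 -> z \in E].
Proof.
move=> Cf hS; elim: A => [|x A IH] hA; first by exists [::].
have [|E [uE hE hf]] := IH; first by move=> z zA; apply: hA; rewrite inE zA orbT.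
have hx : eqclass S x by apply: hA; rewrite inE eqxx.
have [_ _ [r hr]] := (CcP f).1 Cf.
have hx' : hull_punc x := Rpunc_hull2 hx.
have [s [us hs]] := finite_punct r hx'.
exists (undup (map (fun v => sact 0 (- v) x) s ++ E)); split.
- exact: undup_uniq.
- move=> z; rewrite mem_undup mem_cat => /orP[/mapP[v /hs[hv _] ->]|/hE//].
  by apply: Rpunc_trans hx _; exact: Rpunc_shift.
move=> y z; rewrite inE mem_undup mem_cat => /orP[/eqP ->|yA] fz; last first.
  by apply/orP; right; exact: hf fz.
have hz := Cc_supp Cf fz; have [pv e] := dispP hz; rewrite /= in pv e.
apply/orP; left; apply/mapP; exists (disp (x, z)); last exact: e.
by apply/hs; split=> //; exact: hr.
Qed.

Lemma kbound_conv C D f g : 0 <= C -> Cc f -> kbound C f -> kbound D g ->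
  kbound (C * D) (conv f g).
Proof.
move=> C0 Cf hf hg S hS A B xi uA uB hA hB.
have [E [uE hE fE]] := row_support Cf hS hA.
rewrite exprMn -mulrA.
apply: le_trans (_ : C ^+ 2 * sqnorm E (fun z => \sum_(y <- B) g (z, y) * xi y) <= _); last first.
  by rewrite ler_wpM2l ?sqr_ge0//; exact: hg hE hB.
apply: le_trans (hf _ hS _ _ _ uA uE hA hE).
rewrite /sqnorm le_eqVlt; apply/orP; left; apply/eqP.
rewrite big_seq [RHS]big_seq; apply: eq_bigr => x xA.
congr (normc _ ^+ 2).
rewrite (eq_bigr (fun y => \sum_(z <- E) f (x, z) * (g (z, y) * xi y))); last first.
  move=> y _; rewrite /Defs.conv /= (fsum_cover uE).
  - by rewrite mulr_suml; apply: eq_bigr => z _; rewrite mulrA.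
  - by move=> z /hE; exact/eqclass_sub/hA.
  by move=> z _ fg; apply: (fE x) => // f0; apply: fg; rewrite f0 mul0r.
by rewrite exchange_big; apply: eq_bigr => z _; rewrite mulr_sumr.
Qed.

(** Test on the vector carried by a single tiling. *)
Lemma kbound_point C f p : 0 <= C -> kbound C f -> Rpunc p -> normc (f p) <= C.
Proof.
case: p => S S' C0 hf hp; have hS := Rpunc_hull1 hp.
have := hf _ hS [:: S] [:: S'] (fun=> 1) isT isT.
rewrite /sqnorm !big_seq1 mulr1 Normc.normc1 expr1n mulr1 ler_pXn2r ?nnegrE ?normc_ge0//.
by apply=> x; rewrite inE => /eqP ->//; exact: Rpunc_refl.
Qed.

Lemma sum_uniq_le (I : eqType) (A' B' : seq I) (b : I -> R) : uniq A' -> uniq B' ->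
  (forall i, 0 <= b i) -> \sum_(i <- A' | i \in B') b i <= \sum_(i <- B') b i.
Proof.
move=> uA uB b0; rewrite -big_filter.
rewrite (perm_big [seq i <- B' | i \in A']) /=; last first.
  by apply: uniq_perm; rewrite ?filter_uniq// => i; rewrite !mem_filter andbC.
rewrite big_filter [leRHS](bigID (mem A')) /= lerDl.
exact: sumr_ge0.
Qed.

Lemma esum_le_finite (P : set tileset) (b : tileset -> R) C : (forall x, 0 <= b x) ->
  (\esum_(x in P) (b x)%:E <= C%:E)%E <->
  forall A, uniq A -> (forall x, x \in A -> P x) -> \sum_(x <- A) b x <= C.
Proof.
move=> b0; split=> [h A uA hA|h].
  rewrite -lee_fin; apply: le_trans h; apply: esum_ge.
  exists [set` A]; first by split=> [|x]; [exact: finite_seq|exact: hA].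
  by rewrite -fsbig_seq// sumEFin.
apply: ge_ereal_sup => _ [F [/finite_seqP[s es] FP] <-].
have e : F = [set` undup s].
  by rewrite es; apply/seteqP; split=> x /=; rewrite mem_undup.
rewrite e -fsbig_seq ?undup_uniq// sumEFin lee_fin; apply: h; first exact: undup_uniq.
by move=> x; rewrite mem_undup => xs; apply: FP; rewrite es.
Qed.

Lemma l2norm_le S xi C : 0 <= C -> (l2norm S xi <= C%:E)%E <->
  forall A, uniq A -> in_class S A -> sqnorm A xi <= C ^+ 2.
Proof.
move=> C0; rewrite -(@esum_le_finite _ (fun x => normc (xi x) ^+ 2)); last first.
  by move=> x; exact: sqr_ge0.
rewrite /Defs.l2norm -(@lee_sqrt _ _ (C ^+ 2)%:E) ?lee_fin ?sqr_ge0//.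
by rewrite EFin_expe sqrte_sqr gee0_abs ?lee_fin.
Qed.

Lemma rednorm_le_kbound C f : 0 <= C -> (rednorm f <= C%:E)%E -> kbound C f.
Proof.
move=> C0 h S hS A B xi uA uB hA hB; pose X := sqnorm B xi.
have X0 : 0 <= X by exact: sqnorm_ge0.
have [X00|Xn0] := eqVneq X 0.
  have xi0 y : y \in B -> xi y = 0.
    move=> yB; move/eqP: X00; rewrite psumr_eq0; last by move=> z _; exact: sqr_ge0.
    by move=> /allP/(_ _ yB); rewrite sqrf_eq0 => /eqP/Normc.eq0_normc.
  rewrite -/X X00 mulr0 /sqnorm big1// => x _.
  by rewrite big_seq big1 ?Normc.normc0 ?expr0n// => y yB; rewrite xi0// mulr0.
have Xp : 0 < X by rewrite lt_def Xn0.
pose sX : R[i] := (Num.sqrt X)^-1%:C.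
have nsX : normc sX ^+ 2 = X^-1.
  by rewrite normc_sqr /sX /= expr0n addr0 exprVn sqr_sqrtr.
pose eta y := if y \in B then sX * xi y else 0.
have eta1 : (l2norm S eta <= 1)%E.
  apply/(@l2norm_le _ _ 1) => // A' uA' hA'; rewrite expr1n.
  have -> : sqnorm A' eta = \sum_(y <- A' | y \in B) normc (sX * xi y) ^+ 2.
    rewrite /sqnorm (bigID (mem B)) /= [X in _ + X]big1 ?addr0.
      by apply: eq_bigr => y yB; rewrite /eta yB.
    by move=> y /negbTE yB; rewrite /eta yB Normc.normc0 expr0n.
  apply: le_trans (sum_uniq_le uA' uB _) _; first by move=> y; exact: sqr_ge0.
  rewrite (eq_bigr (fun y => X^-1 * normc (xi y) ^+ 2)).
    by rewrite -mulr_sumr -/(sqnorm B xi) -/X mulVf.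
  by move=> y _; rewrite normcM exprMn nsX.
have : (l2norm S (piT c T S f eta) <= C%:E)%E.
  apply: le_trans h; apply: le_trans (_ : opnorm c T S f <= _)%E.
    by apply: ereal_sup_ubound; exists eta.
  by apply: ereal_sup_ubound; exists S.
move=> /(l2norm_le _ _ C0)/(_ A uA hA).
have -> : sqnorm A (piT c T S f eta) =
    X^-1 * sqnorm A (fun x => \sum_(y <- B) f (x, y) * xi y).
  rewrite /sqnorm mulr_sumr; apply: eq_bigr => x _.
  rewrite -nsX -exprMn -normcM; congr (normc _ ^+ 2); rewrite /piT (fsum_cover uB hB).
    rewrite mulr_sumr; rewrite big_seq [RHS]big_seq; apply: eq_bigr => y yB.
    by rewrite /eta yB mulrCA.
  by move=> z _; rewrite /eta; case: ifP => // _; rewrite mulr0.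
by rewrite mulrC ler_pdivrMr.
Qed.

Lemma kbound_rednorm C f : 0 <= C -> Cc f -> kbound C f -> (rednorm f <= C%:E)%E.
Proof.
move=> C0 Cf hf; apply: ge_ereal_sup => _ [S hS <-]; apply: ge_ereal_sup => _ [xi xi1 <-].
apply/l2norm_le => // A uA hA; have [E [uE hE fE]] := row_support Cf hS hA.
have -> : sqnorm A (piT c T S f xi) = sqnorm A (fun x => \sum_(y <- E) f (x, y) * xi y).
  rewrite /sqnorm big_seq [RHS]big_seq; apply: eq_bigr => x xA; congr (normc _ ^+ 2).
  rewrite /piT (fsum_cover uE hE)// => z _ fz.
  by apply: (fE x) => // f0; apply: fz; rewrite f0 mul0r.
apply: le_trans (hf _ hS _ _ _ uA uE hA hE) _.
move: xi1 => /(@l2norm_le _ _ 1 ler01)/(_ E uE hE); rewrite expr1n => h.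
by rewrite ler_piMr// sqr_ge0.
Qed.

(** The supremum over an empty set of tilings would be [-oo]; with a tiling at hand the zero vector
    gives the bound. *)
Lemma rednorm_ge0 f : hull_punc !=set0 -> (0 <= rednorm f)%E.
Proof.
move=> [S hS]; apply: (@le_trans _ _ (l2norm S (piT c T S f (fun=> 0)))).
  exact: sqrte_ge0.
apply: (@le_trans _ _ (opnorm c T S f)); last by apply: ereal_sup_ubound; exists S.
apply: ereal_sup_ubound; exists (fun=> 0) => //=.
apply/(@l2norm_le _ _ 1) => // A _ _; rewrite /sqnorm big1 ?expr1n// => x _.
by rewrite Normc.normc0 expr0n.
Qed.

End KernelBounds.

(** * The completion through representing sequences *)

Section Completion.
Context {R : realType} (c : planeOf R) (T : tilesetOf R).
Context {hc : interior_puncture c} {hT : pinwheel_hull c T}.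

Local Open Scope complex_scope.

Local Notation hull_punc := (hull_punc c T).
Local Notation Cc := (Cc c T).
Local Notation conv := (Defs.conv c T).
Local Notation rednorm := (rednorm c T).
Local Notation cauchy_seq := (Defs.cauchy_seq c T).
Local Notation seq_class := (Defs.seq_class c T).
Local Notation cstar := (Defs.cstar c T).
Local Notation cadd := (@Defs.cadd R c T).
Local Notation cmul := (@Defs.cmul R c T).
Local Notation cscale := (@Defs.cscale R c T).
Local Notation kadd := (@Defs.kadd R).
Local Notation kbound := (kbound c T).
Local Notation normc := (@Normc.normc R).
Implicit Types (f g h : @pairfun R) (u v w : nat -> @pairfun R) (C D e : R) (a b : cstar).

Lemma hull_self : hull c T T.
Proof.
split; first exact: hull_base.
move=> e e0; exists 0; rewrite translateE sact_id.
pose r := 1 + e^-1; have ie0 : 0 < e^-1 by rewrite invr_gt0.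
have r1 : 1 < r by rewrite ltrDl.
have h : near_by r 0 T T.
  split; last exact: agree_refl.
  by rewrite rotmx0 subrr fnorm0 invr_gt0; lra.
apply: le_lt_trans (near_by_dGamma r1 h) _.
by rewrite -[ltRHS]invrK ltf_pV2 ?posrE /r; lra.
Qed.

Lemma hull_punc_nonempty : hull_punc !=set0.
Proof.
have [_ tT covT _] := @hull_base _ c T hT.
have [t Tt _] : (\bigcup_(t in T) t) 0 by rewrite covT.
have [i [ph [v et]]] := tT _ Tt; exists (sact 0 (- v) T).
by apply: hull_punc_shift hull_self _; exists i, ph; rewrite -et.
Qed.

Definition ev_bound e w := exists N, forall n, (N <= n)%N -> kbound e (w n).

Lemma ev_bound_kadd C D u v : 0 <= C -> 0 <= D -> ev_bound C u -> ev_bound D v ->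
  ev_bound (C + D) (fun n => kadd (u n) (v n)).
Proof.
move=> C0 D0 [N hN] [M hM]; exists (maxn N M) => n; rewrite geq_max => /andP[nN nM].
by apply: kbound_kadd => //; [exact: hN|exact: hM].
Qed.

Lemma ksub_triangle f g h : ksub f h = kadd (ksub f g) (ksub g h).
Proof. by apply/funext => p; rewrite /Defs.kadd /ksub addrA subrK. Qed.

Lemma ksub_swap f g : ksub f g = kscale (-1) (ksub g f).
Proof. by apply/funext => p; rewrite /kscale /ksub mulN1r opprB. Qed.

Lemma kbound_ksubC e f g : kbound e (ksub f g) -> kbound e (ksub g f).
Proof.
move=> h; rewrite ksub_swap; have := kbound_kscale (-1) h.
by rewrite normcN Normc.normc1 mul1r.
Qed.

Lemma kbound0 : kbound 0 (@Defs.kzero R).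
Proof.
move=> S hS A B xi _ _ _ _; rewrite expr0n mul0r /sqnorm big1// => x _.
by rewrite big1 ?Normc.normc0 ?expr0n// => y _; rewrite /Defs.kzero mul0r.
Qed.

Lemma ksubxx f : ksub f f = @Defs.kzero R.
Proof. by apply/funext => p; rewrite /ksub subrr. Qed.

Lemma rednorm_lt_kbound e f : 0 < e -> (rednorm f < e%:E)%E -> kbound e f.
Proof. by move=> e0 /ltW; apply: rednorm_le_kbound; exact: ltW. Qed.

Lemma kbound_rednorm_lt e d f : 0 <= e -> e < d -> Cc f -> kbound e f -> (rednorm f < d%:E)%E.
Proof. by move=> e0 ed Cf /(kbound_rednorm e0 Cf) h; apply: le_lt_trans h _; rewrite lte_fin. Qed.

Lemma cauchy_seqP u : cauchy_seq u <-> (forall n, Cc (u n)) /\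
  forall e, 0 < e -> exists N, forall m n, (N <= m)%N -> (N <= n)%N ->
    kbound e (ksub (u m) (u n)).
Proof.
split=> -[Cu hu]; split=> // e e0.
  have [N hN] := hu e e0; exists N => m n mN nN.
  by apply: rednorm_lt_kbound => //; exact: hN.
have e2 : 0 < e / 2 by rewrite divr_gt0.
have [N hN] := hu _ e2; exists N => m n mN nN.
apply: (kbound_rednorm_lt (ltW e2)); [lra|exact: Cc_ksub|exact: hN].
Qed.

Lemma rednorm_cvg0P w : (forall n, Cc (w n)) ->
  (rednorm (w n) @[n --> \oo] --> 0%E) <-> forall e, 0 < e -> ev_bound e w.
Proof.
move=> Cw; split.
  move=> h e e0.
  have : nbhs 0%E [set y : \bar R | (y < e%:E)%E].
    by apply: open_ereal_lt'; rewrite lte_fin.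
  move=> /h[N _ hN]; exists N => n nN; apply: rednorm_lt_kbound => //.
  exact: hN.
move=> hw; have fin1 n e : 0 <= e -> kbound e (w n) ->
    rednorm (w n) \is a fin_num /\ `|fine (rednorm (w n))| <= e.
  move=> e0 hk; have h1 : (rednorm (w n) <= e%:E)%E by exact: kbound_rednorm.
  have h0 : (0 <= rednorm (w n))%E by exact: rednorm_ge0 hull_punc_nonempty.
  have hf : rednorm (w n) \is a fin_num by rewrite ge0_fin_numE// (le_lt_trans h1)// ltry.
  split=> //; rewrite ger0_norm; last by rewrite fine_ge0.
  by rewrite -lee_fin fineK.
apply/fine_cvgP; split.
  have [N hN] := hw 1 ltr01; exists N => // n /= nN.
  by have [] := fin1 n 1 ler01 (hN n nN).
apply/cvgrPdist_lt => e e0; have e2 : 0 < e / 2 by rewrite divr_gt0.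
have [N hN] := hw _ e2; exists N => // n /= nN.
have [_] := fin1 n _ (ltW e2) (hN n nN).
by rewrite sub0r normrN; lra.
Qed.

Definition same u v := forall e, 0 < e -> ev_bound e (fun n => ksub (u n) (v n)).

Lemma same_sym u v : same u v -> same v u.
Proof.
by move=> h e e0; have [N hN] := h e e0; exists N => n /hN; exact: kbound_ksubC.
Qed.

Lemma same_trans u v w : same u v -> same v w -> same u w.
Proof.
move=> h h' e e0; have e2 : 0 < e / 2 by rewrite divr_gt0.
have := ev_bound_kadd (ltW e2) (ltW e2) (h _ e2) (h' _ e2).
move=> [N hN]; exists N => n nN; rewrite (ksub_triangle _ (v n)).
rewrite [e]splitr.
exact: hN.
Qed.

Lemma same_refl u : same u u.
Proof.
move=> e e0; exists 0%N => n _; rewrite ksubxx.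
by apply: kbound_le kbound0 => //; exact: ltW.
Qed.

Lemma seq_classP u v : cauchy_seq u -> (seq_class u v <-> cauchy_seq v /\ same u v).
Proof.
move=> cu; split=> -[cv h]; split=> //.
  by apply/rednorm_cvg0P => // n; apply: Cc_ksub; [case: cu|case: cv].
by apply/rednorm_cvg0P => // n; apply: Cc_ksub; [case: cu|case: cv].
Qed.

Lemma seq_class_same u v : cauchy_seq u -> cauchy_seq v ->
  seq_class u = seq_class v -> same u v.
Proof.
move=> cu cv e; have vv : seq_class v v.
  exact: ((seq_classP _ cv).2 (conj cv (@same_refl v))).
have uv : seq_class u v by rewrite e.
by have [_] := (seq_classP _ cu).1 uv.
Qed.

Lemma same_seq_class u v : cauchy_seq u -> cauchy_seq v ->
  same u v -> seq_class u = seq_class v.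
Proof.
move=> cu cv h; apply: funext => w; apply: propext; split.
  move=> /(seq_classP _ cu)[cw hw]; apply/(seq_classP _ cv); split=> //.
  exact: same_trans (same_sym h) hw.
move=> /(seq_classP _ cv)[cw hw]; apply/(seq_classP _ cu); split=> //.
exact: same_trans h hw.
Qed.

(** The operations of [cstar] are defined on the representatives chosen by [crepr]. This relation
    admits every representative, and [repr_cadd], [repr_cscale] and [repr_cmul] carry the operations
    over. *)
Definition repr a u := cauchy_seq u /\ projT1 a = seq_class u.

Lemma repr_crepr a : repr a (crepr a).
Proof. by rewrite /repr /crepr; case: cid2. Qed.

Lemma repr_cclass u : cauchy_seq u -> repr (Defs.cclass c T u) u.
Proof. by move=> cu; rewrite /repr /Defs.cclass; case: pselect. Qed.

Lemma repr_same a u v : repr a u -> repr a v -> same u v.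
Proof.
by move=> [cu eu] [cv ev]; exact: (seq_class_same cu cv (etrans (esym eu) ev)).
Qed.

Lemma same_repr a u v : repr a u -> cauchy_seq v -> same u v -> repr a v.
Proof.
by move=> [cu eu] cv h; split; [exact: cv|exact: (etrans eu (same_seq_class cu cv h))].
Qed.

Lemma repr_inj a b u v : repr a u -> repr b v -> same u v -> a = b.
Proof.
move=> [cu eu] [cv ev] h.
have : projT1 a = projT1 b by exact: (etrans eu (etrans (same_seq_class cu cv h) (esym ev))).
case: (a) (b) => [A hA] [B hB] /= eAB; subst B.
by congr exist; exact: Prop_irrelevance.
Qed.

Lemma cauchy_const f : Cc f -> cauchy_seq (fun=> f).
Proof.
move=> Cf; apply/cauchy_seqP; split=> // e e0; exists 0%N => m n _ _; rewrite ksubxx.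
by apply: kbound_le kbound0 => //; exact: ltW.
Qed.

Lemma repr_cembed f : Cc f -> repr (cembed c T f) (fun=> f).
Proof. by move=> Cf; exact/repr_cclass/cauchy_const. Qed.

Lemma repr_czero : repr (Defs.czero c T) (fun=> @Defs.kzero R).
Proof. by split=> //; exact: cauchy_seq0. Qed.

Lemma cauchy_kadd u v : cauchy_seq u -> cauchy_seq v ->
  cauchy_seq (fun n => kadd (u n) (v n)).
Proof.
move=> /cauchy_seqP[Cu hu] /cauchy_seqP[Cv hv]; apply/cauchy_seqP.
split=> [n|e e0]; first exact: Cc_kadd.
have e2 : 0 < e / 2 by rewrite divr_gt0.
have [N hN] := hu _ e2; have [M hM] := hv _ e2.
exists (maxn N M) => m n; rewrite !geq_max => /andP[m1 m2] /andP[n1 n2].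
have -> : ksub (kadd (u m) (v m)) (kadd (u n) (v n)) =
    kadd (ksub (u m) (u n)) (ksub (v m) (v n)).
  by apply/funext => p; rewrite /ksub /Defs.kadd opprD addrACA.
rewrite [e]splitr.
by apply: kbound_kadd; rewrite ?(ltW e2)//; [exact: hN|exact: hM].
Qed.

Lemma repr_cadd a b u v : repr a u -> repr b v ->
  repr (cadd a b) (fun n => kadd (u n) (v n)).
Proof.
move=> ha hb; have [[cu _] [cv _]] := (ha, hb).
have [[ca _] [cb _]] := (repr_crepr a, repr_crepr b).
apply: (same_repr (u := fun n => kadd (crepr a n) (crepr b n))).
- exact/repr_cclass/cauchy_kadd.
- exact: cauchy_kadd.
move=> e e0; have e2 : 0 < e / 2 by rewrite divr_gt0.
have [N hN] := repr_same (repr_crepr a) ha e2.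
have [M hM] := repr_same (repr_crepr b) hb e2.
exists (maxn N M) => n; rewrite geq_max => /andP[n1 n2].
have -> : ksub (kadd (crepr a n) (crepr b n)) (kadd (u n) (v n)) =
    kadd (ksub (crepr a n) (u n)) (ksub (crepr b n) (v n)).
  by apply/funext => p; rewrite /ksub /Defs.kadd opprD addrACA.
rewrite [e]splitr.
by apply: kbound_kadd; rewrite ?(ltW e2)//; [exact: hN|exact: hM].
Qed.

Lemma kbound_kscale_eps k f e : 0 <= e -> kbound (e / (normc k + 1)) f ->
  kbound e (kscale k f).
Proof.
move=> e0 /(kbound_kscale k); have k0 := normc_ge0 k.
apply: kbound_le; first by rewrite mulr_ge0// divr_ge0// addr_ge0.
by rewrite mulrCA ler_piMr// ler_pdivrMr ?ltr_wpDl// mul1r lerDl.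
Qed.

Lemma cauchy_kscale k u : cauchy_seq u -> cauchy_seq (fun n => kscale k (u n)).
Proof.
move=> /cauchy_seqP[Cu hu]; apply/cauchy_seqP; split=> [n|e e0]; first exact: Cc_kscale.
have [|N hN] := hu (e / (normc k + 1)).
  by rewrite divr_gt0// ltr_wpDl// normc_ge0.
exists N => m n mN nN.
have -> : ksub (kscale k (u m)) (kscale k (u n)) = kscale k (ksub (u m) (u n)).
  by apply/funext => p; rewrite /ksub /kscale mulrBr.
by apply: kbound_kscale_eps; [exact: ltW|exact: hN].
Qed.

Lemma repr_cscale k a u : repr a u -> repr (cscale k a) (fun n => kscale k (u n)).
Proof.
move=> ha; have [cu _] := ha; have [ca _] := repr_crepr a.
apply: (same_repr (u := fun n => kscale k (crepr a n))).
- exact/repr_cclass/cauchy_kscale.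
- exact: cauchy_kscale.
move=> e e0; have [|N hN] := repr_same (repr_crepr a) ha (e := e / (normc k + 1)).
  by rewrite divr_gt0// ltr_wpDl// normc_ge0.
exists N => n nN.
have -> : ksub (kscale k (crepr a n)) (kscale k (u n)) = kscale k (ksub (crepr a n) (u n)).
  by apply/funext => p; rewrite /ksub /kscale mulrBr.
by apply: kbound_kscale_eps; [exact: ltW|exact: hN].
Qed.

Lemma conv_out f g p : ~ hull_punc p.1 -> conv f g p = 0.
Proof. by move=> hp; rewrite /Defs.conv fsbig1// => S3 [/= hS3 _]; case: hp. Qed.

Lemma in_class1 S : hull_punc S -> in_class c T S [:: S].
Proof. by move=> hS x; rewrite inE => /eqP ->; exact: Rpunc_refl. Qed.

Lemma conv_support f S : Cc f -> hull_punc S -> exists E, [/\ uniq E, in_class c T S E &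
  forall g S', conv f g (S, S') = \sum_(z <- E) f (S, z) * g (z, S')].
Proof.
move=> Cf hS; have [E [uE hE fE]] := row_support Cf hS (in_class1 hS).
exists E; split=> // g S'; rewrite /Defs.conv /=; apply: fsum_cover => //.
move=> z _ fg; apply: (fE S); first by rewrite inE.
by move=> f0; apply: fg; rewrite f0 mul0r.
Qed.

Lemma conv_ksubr f g h : Cc f -> conv f (ksub g h) = ksub (conv f g) (conv f h).
Proof.
move=> Cf; apply/funext => -[S S']; have [hS|hS] := pselect (hull_punc S); last first.
  by rewrite /ksub !conv_out// subrr.
have [E [_ _ hE]] := conv_support Cf hS; rewrite /ksub !hE -sumrB.
by apply: eq_bigr => z _; rewrite mulrBr.
Qed.

Lemma conv_ksubl f g h : Cc f -> Cc g -> conv (ksub f g) h = ksub (conv f h) (conv g h).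
Proof.
move=> Cf Cg; apply/funext => -[S S']; have [hS|hS] := pselect (hull_punc S); last first.
  by rewrite /ksub !conv_out// subrr.
have [E1 [uE1 hE1 fE1]] := row_support Cf hS (in_class1 hS).
have [E2 [uE2 hE2 fE2]] := row_support Cg hS (in_class1 hS).
have hin : in_class c T S (undup (E1 ++ E2)).
  by move=> z; rewrite mem_undup mem_cat => /orP[/hE1|/hE2].
have SS : S \in [:: S] by rewrite inE.
have cov k : (forall z, k (S, z) <> 0 -> f (S, z) <> 0 \/ g (S, z) <> 0) ->
    conv k h (S, S') = \sum_(z <- undup (E1 ++ E2)) k (S, z) * h (z, S').
  move=> hk; rewrite /Defs.conv /=; apply: fsum_cover => //; first exact: undup_uniq.
  move=> z _ kh; rewrite mem_undup mem_cat; apply/orP.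
  have [|fz|gz] := hk z; first by move=> k0; apply: kh; rewrite k0 mul0r.
    by left; exact: fE1 fz.
  by right; exact: fE2 gz.
rewrite /ksub (cov (ksub f g)) => [|z]; last first.
  rewrite /ksub; have [-> h0|/eqP] := eqVneq (f (S, z)) 0; last by left.
  by right=> g0; apply: h0; rewrite g0 subrr.
rewrite (cov f); last by left.
rewrite (cov g); last by right.
by rewrite -sumrB; apply: eq_bigr => z _; rewrite mulrBl.
Qed.

(** Products of Cauchy sequences are estimated under a uniform bound, which is carried as a
    hypothesis and supplied for [AT_pin] by [AT_bounded]. *)
Definition bounded_seq u := exists2 C, 0 <= C & ev_bound C u.

Lemma bounded_same u v : bounded_seq u -> same u v -> bounded_seq v.
Proof.
move=> [C C0 hu] /same_sym/(_ 1 ltr01) h; exists (1 + C); first exact: addr_ge0.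
have [N hN] := ev_bound_kadd ler01 C0 h hu; exists N => n /hN.
rewrite (_ : kadd _ _ = v n)//.
by apply/funext => p; rewrite /Defs.kadd /ksub subrK.
Qed.

Lemma eps_split e C D : 0 < e -> 0 <= C -> 0 <= D ->
  exists2 d, 0 < d & d * D + C * d <= e.
Proof.
move=> e0 C0 D0; have CD : 0 < C + D + 1 by rewrite ltr_wpDl// addr_ge0.
exists (e / (C + D + 1)); first by rewrite divr_gt0.
rewrite mulrC -mulrDl addrC mulrCA ler_piMr ?(ltW e0)//.
by rewrite ler_pdivrMr// mul1r lerDl.
Qed.

Lemma same_conv u v u' v' : (forall n, Cc (u n)) -> (forall n, Cc (u' n)) ->
  bounded_seq u' -> bounded_seq v -> same u u' -> same v v' ->
  same (fun n => conv (u n) (v n)) (fun n => conv (u' n) (v' n)).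
Proof.
move=> Cu Cu' [C C0 [N hN]] [D D0 [M hM]] huu hvv e e0.
have [d d0 dCD] := eps_split e0 C0 D0.
have [N' hN'] := huu _ d0; have [M' hM'] := hvv _ d0.
exists (maxn (maxn N M) (maxn N' M')) => n; rewrite !geq_max.
move=> /andP[/andP[n1 n2] /andP[n3 n4]].
rewrite (ksub_triangle _ (conv (u' n) (v n))) -conv_ksubl// -conv_ksubr//.
apply: (@kbound_le _ _ _ (d * D + C * d)).
- by rewrite addr_ge0// mulr_ge0// ltW.
- exact: dCD.
apply: kbound_kadd; rewrite ?mulr_ge0 ?(ltW d0)//.
  by apply: kbound_conv; rewrite ?(ltW d0)//; [exact: Cc_ksub|exact: hN'|exact: hM].
by apply: kbound_conv => //; [exact: hN|exact: hM'].
Qed.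

Lemma cauchy_conv u v : cauchy_seq u -> cauchy_seq v -> bounded_seq u -> bounded_seq v ->
  cauchy_seq (fun n => conv (u n) (v n)).
Proof.
move=> /cauchy_seqP[Cu hu] /cauchy_seqP[Cv hv] [C C0 [N hN]] [D D0 [M hM]].
apply/cauchy_seqP; split=> [n|e e0]; first exact: Cc_conv.
have [d d0 dCD] := eps_split e0 C0 D0.
have [N' hN'] := hu _ d0; have [M' hM'] := hv _ d0.
exists (maxn (maxn N M) (maxn N' M')) => m n; rewrite !geq_max.
move=> /andP[/andP[m1 m2] /andP[m3 m4]] /andP[/andP[n1 n2] /andP[n3 n4]].
rewrite (ksub_triangle _ (conv (u n) (v m))) -conv_ksubl// -conv_ksubr//.
apply: (@kbound_le _ _ _ (d * D + C * d)).
- by rewrite addr_ge0// mulr_ge0// ltW.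
- exact: dCD.
apply: kbound_kadd; rewrite ?mulr_ge0 ?(ltW d0)//.
  by apply: kbound_conv; rewrite ?(ltW d0)//; [exact: Cc_ksub|exact: hN'|exact: hM].
by apply: kbound_conv => //; [exact: hN|exact: hM'].
Qed.

Lemma repr_cmul a b u v : repr a u -> repr b v -> bounded_seq u -> bounded_seq v ->
  repr (cmul a b) (fun n => conv (u n) (v n)).
Proof.
move=> ha hb bu bv; have [[cu _] [cv _]] := (ha, hb).
have [[ca _] [cb _]] := (repr_crepr a, repr_crepr b).
have ba := bounded_same bu (repr_same ha (repr_crepr a)).
have bb := bounded_same bv (repr_same hb (repr_crepr b)).
apply: (same_repr (u := fun n => conv (crepr a n) (crepr b n))).
- exact/repr_cclass/cauchy_conv.
- exact: cauchy_conv.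
apply: same_conv => //; [by case: ca|by case: cu|exact: repr_same (repr_crepr a) ha|].
exact: repr_same (repr_crepr b) hb.
Qed.

End Completion.

(** * Distances and values in the completion *)

Section Closure.
Context {R : realType} (c : planeOf R) (T : tilesetOf R).
Context {hc : interior_puncture c} {hT : pinwheel_hull c T}.

Local Open Scope complex_scope.

Local Notation Rpunc := (Rpunc c T).
Local Notation Cc := (Cc c T).
Local Notation rednorm := (rednorm c T).
Local Notation cauchy_seq := (Defs.cauchy_seq c T).
Local Notation cstar := (Defs.cstar c T).
Local Notation cdist := (@Defs.cdist R c T).
Local Notation kadd := (@Defs.kadd R).
Local Notation kbound := (kbound c T).
Local Notation ev_bound := (ev_bound c T).
Local Notation same := (same c T).
Local Notation normc := (@Normc.normc R).
Implicit Types (f g h : @pairfun R) (u v w : nat -> @pairfun R) (C D e : R) (a b : cstar).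

(** [rednorm] takes values in the extended reals. If some late difference has finite norm, then all
    late ones do and the norms form a real Cauchy sequence; otherwise they are eventually [+oo]. *)
Lemma seq_dist_cvg u v : cauchy_seq u -> cauchy_seq v ->
  cvgn (fun n => rednorm (ksub (u n) (v n))).
Proof.
move=> /cauchy_seqP[Cu hu] /cauchy_seqP[Cv hv]; pose w n := ksub (u n) (v n).
have Cw n : Cc (w n) by exact: Cc_ksub.
have hw e : 0 < e -> exists N, forall m n, (N <= m)%N -> (N <= n)%N ->
    kbound e (ksub (w m) (w n)).
  move=> e0; have e2 : 0 < e / 2 by rewrite divr_gt0.
  have [N hN] := hu _ e2; have [M hM] := hv _ e2.
  exists (maxn N M) => m n; rewrite !geq_max => /andP[m1 m2] /andP[n1 n2].
  have -> : ksub (w m) (w n) = kadd (ksub (u m) (u n)) (ksub (v n) (v m)).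
    by apply/funext => p; rewrite /w /ksub /Defs.kadd; ring.
  rewrite [e]splitr; apply: kbound_kadd; rewrite ?(ltW e2)//; [exact: hN|exact: hM].
have r0 n : (0 <= rednorm (w n))%E by apply: rednorm_ge0; exact: hull_punc_nonempty.
have step m n (r e : R) : 0 <= r -> 0 <= e -> (rednorm (w n) <= r%:E)%E ->
    kbound e (ksub (w m) (w n)) -> (rednorm (w m) <= (r + e)%:E)%E.
  move=> r00 e0 h1 h2; apply: kbound_rednorm => //; first exact: addr_ge0.
  have -> : w m = kadd (w n) (ksub (w m) (w n)).
    by apply/funext => p; rewrite /Defs.kadd /ksub addrC subrK.
  by apply: kbound_kadd => //; exact: rednorm_le_kbound.
have [N1 hN1] := hw 1 ltr01.
have [[n0 [n0N fin0]]|hinf] := pselect (exists n0, (N1 <= n0)%N /\ (rednorm (w n0) < +oo)%E).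
  have fin n : (N1 <= n)%N -> rednorm (w n) \is a fin_num.
    move=> nN; rewrite ge0_fin_numE//.
    have f0 : rednorm (w n0) \is a fin_num by rewrite ge0_fin_numE.
    have h : (rednorm (w n) <= (fine (rednorm (w n0)) + 1)%:E)%E.
      apply: (step n n0) => //; [exact: fine_ge0|by rewrite fineK|exact: hN1].
    by apply: le_lt_trans h _; rewrite ltry.
  have cr : cvgn (fun n => fine (rednorm (w n))).
    apply/cauchy_cvgP/cauchy_exP => e e0; have e2 : 0 < e / 2 by rewrite divr_gt0.
    have [N hN] := hw _ e2; pose M := maxn N N1.
    have MN : (N <= M)%N by rewrite leq_maxl.
    have MN1 : (N1 <= M)%N by rewrite leq_maxr.
    exists (fine (rednorm (w M))); exists M => // n /= Mn.
    have nN : (N <= n)%N by exact: leq_trans Mn.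
    have nN1 : (N1 <= n)%N by exact: leq_trans Mn.
    have a1 : (rednorm (w n) <= (fine (rednorm (w M)) + e / 2)%:E)%E.
      by apply: (step n M); rewrite ?fine_ge0 ?(ltW e2) ?fineK ?fin//; exact: hN.
    have a2 : (rednorm (w M) <= (fine (rednorm (w n)) + e / 2)%:E)%E.
      by apply: (step M n); rewrite ?fine_ge0 ?(ltW e2) ?fineK ?fin//; exact: hN.
    rewrite -ball_normE /ball_ /=.
    rewrite -(fineK (fin _ nN1)) lee_fin in a1; rewrite -(fineK (fin _ MN1)) lee_fin in a2.
    move: a1 a2; move: (fine _) (fine (rednorm (w n))) => x y a1 a2.
    by rewrite ltr_norml; apply/andP; split; lra.
  apply/cvg_ex; exists (limn (fun n => fine (rednorm (w n))))%:E.
  by apply/fine_cvgP; split; [exists N1 => // n /= /fin|exact: cr].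
apply/cvg_ex; exists +oo%E; apply: cvg_near_cst; exists N1 => // n /= nN.
apply: contrapT => /eqP hn; apply: hinf; exists n; split=> //.
by rewrite lt_def leey andbT eq_sym.
Qed.

Lemma cdist_lt a b u v e d : repr a u -> repr b v -> 0 <= e -> e < d ->
  ev_bound e (fun n => ksub (u n) (v n)) -> (cdist a b < d%:E)%E.
Proof.
move=> ha hb e0 ed h.
pose k := (d - e) / 4; have k0 : 0 < k by rewrite divr_gt0// subr_gt0.
have hA : same (crepr a) u by exact: repr_same (repr_crepr a) ha.
have hB : same v (crepr b) by exact: repr_same hb (repr_crepr b).
have [N hN] := ev_bound_kadd (addr_ge0 (ltW k0) e0) (ltW k0)
  (ev_bound_kadd (ltW k0) e0 (hA _ k0) h) (hB _ k0).
have [ca _] := repr_crepr a; have [cb _] := repr_crepr b.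
apply: (@le_lt_trans _ _ (k + e + k)%:E); last first.
  rewrite lte_fin /k; move: ed; lra.
apply: lime_le; first exact: seq_dist_cvg.
exists N => // n /= nN.
have {hN} := hN n nN; rewrite -!ksub_triangle => hk.
apply: kbound_rednorm => //; first by rewrite !addr_ge0// ltW.
by apply: Cc_ksub; [case: ca|case: cb].
Qed.

(** [cdist] refers to the chosen representatives; replacing them by [u] and [v] costs [e / 2] twice,
    hence the factor [2]. *)
Lemma lt_cdist a b u v e : repr a u -> repr b v -> 0 < e -> (cdist a b < e%:E)%E ->
  ev_bound (2 * e) (fun n => ksub (u n) (v n)).
Proof.
move=> ha hb e0 h; have e2 : 0 < e / 2 by rewrite divr_gt0.
have [ca _] := repr_crepr a; have [cb _] := repr_crepr b.
have hA : same u (crepr a) by exact: repr_same ha (repr_crepr a).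
have hB : same (crepr b) v by exact: repr_same (repr_crepr b) hb.
have hm : ev_bound e (fun n => ksub (crepr a n) (crepr b n)).
  have cv : (rednorm (ksub (crepr a n) (crepr b n)) @[n --> \oo] --> cdist a b)%E.
    exact: seq_dist_cvg.
  have /cv[N _ hN] : nbhs (cdist a b) [set y : \bar R | (y < e%:E)%E].
    exact: open_ereal_lt'.
  by exists N => n nN; apply: rednorm_lt_kbound => //; exact: hN.
have [N hN] := ev_bound_kadd (addr_ge0 (ltW e2) (ltW e0)) (ltW e2)
  (ev_bound_kadd (ltW e2) (ltW e0) (hA _ e2) hm) (hB _ e2).
exists N => n /hN; rewrite -!ksub_triangle.
by apply: kbound_le; [rewrite !addr_ge0// ltW|lra].
Qed.

Lemma finite_eventually (I : eqType) (s : seq I) (P : I -> nat -> Prop) :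
  (forall i, i \in s -> exists N, forall n, (N <= n)%N -> P i n) ->
  exists N, forall i n, i \in s -> (N <= n)%N -> P i n.
Proof.
elim: s => [_|i s IH h]; first by exists 0%N.
have [|N hN] := IH; first by move=> j js; apply: h; rewrite inE js orbT.
have [M hM] := h i (mem_head _ _).
exists (maxn N M) => j n; rewrite inE geq_max => /orP[/eqP ->|js] /andP[n1 n2].
  exact: hM.
exact: hN.
Qed.

Lemma normc_sum_le (I : eqType) (s : seq I) (F : I -> R[i]) :
  normc (\sum_(i <- s) F i) <= \sum_(i <- s) normc (F i).
Proof.
elim: s => [|i s IH]; first by rewrite !big_nil Normc.normc0.
by rewrite !big_cons; apply: le_trans (normcD _ _) _; rewrite lerD2l.
Qed.

Lemma sum_cst (I : Type) (s : seq I) (z : R) : \sum_(i <- s) z = (size s)%:R * z.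
Proof.
elim: s => [|i s IH]; first by rewrite big_nil mul0r.
by rewrite big_cons IH /= -natr1 mulrDl mul1r addrC.
Qed.

(* Lower semicontinuity of the norm under pointwise convergence. *)
Lemma pointwise_null u : cauchy_seq u ->
  (forall p, Rpunc p -> forall e, 0 < e -> exists N, forall n, (N <= n)%N -> normc (u n p) < e) ->
  forall e, 0 < e -> ev_bound e u.
Proof.
move=> /cauchy_seqP[Cu hu] hp e e0; have [N hN] := hu e e0; exists N => n nN.
move=> S hS A B xi uA uB hA hB.
pose X := Num.sqrt (sqnorm B xi); have X0 : 0 <= X by exact: sqrtr_ge0.
have X2 : X ^+ 2 = sqnorm B xi by rewrite sqr_sqrtr// sqnorm_ge0.
rewrite -X2 -exprMn.
pose L := sqnorm A (fun x => \sum_(y <- B) u n (x, y) * xi y).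
have L0 : 0 <= L by exact: sqnorm_ge0.
suff : Num.sqrt L <= e * X.
  by rewrite -(ler_pXn2r (n := 2)) ?nnegrE ?sqrtr_ge0 ?mulr_ge0 ?(ltW e0)// sqr_sqrtr.
apply/ler_addgt0Pr => d d0.
rewrite -(ler_pXn2r (n := 2)) ?nnegrE ?sqrtr_ge0 ?addr_ge0 ?mulr_ge0 ?(ltW e0) ?(ltW d0)//.
rewrite sqr_sqrtr//.
pose Y := \sum_(y <- B) normc (xi y).
have Y0 : 0 <= Y by apply: sumr_ge0 => y _; exact: normc_ge0.
(* Entries of modulus below [k] on the finite block make [u m] contribute at most [d] to the
   norm. *)
pose k := d / ((size A).+1%:R * (Y + 1)).
have den0 : 0 < (size A).+1%:R * (Y + 1) by rewrite mulr_gt0// ltr_wpDl.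
have k0 : 0 < k by rewrite divr_gt0.
have [M hM] : exists M, forall q m, q \in [seq (x, y) | x <- A, y <- B] -> (M <= m)%N ->
    normc (u m q) < k.
  apply: finite_eventually => _ /allpairsP[[x y] /= [xA yB ->]].
  by apply: hp => //; exact: eqclass_sub (hA _ xA) (hB _ yB).
pose m := maxn M N; have mM : (M <= m)%N by rewrite leq_maxl.
have mN : (N <= m)%N by rewrite leq_maxr.
have -> : L = sqnorm A (fun x => \sum_(y <- B) ksub (u n) (u m) (x, y) * xi y +
    \sum_(y <- B) u m (x, y) * xi y).
  apply: eq_bigr => x _; rewrite -big_split /=; congr (normc _ ^+ 2).
  by apply: eq_bigr => y _; rewrite -mulrDl /ksub subrK.
apply: sqnormD; rewrite ?mulr_ge0 ?(ltW e0) ?(ltW d0)//.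
  by rewrite exprMn X2; exact: (hN n m nN mN _ hS).
apply: (@le_trans _ _ (\sum_(x <- A) (k * Y) ^+ 2)).
  rewrite /sqnorm big_seq [leRHS]big_seq; apply: ler_sum => x xA.
  rewrite ler_pXn2r ?nnegrE ?normc_ge0 ?(mulr_ge0 (ltW k0) Y0)//.
  apply: le_trans (normc_sum_le _ _) _; rewrite /Y mulr_sumr.
  rewrite big_seq [leRHS]big_seq; apply: ler_sum => y yB.
  rewrite normcM ler_wpM2r ?normc_ge0// ltW//; apply: hM => //.
  by apply/allpairsP; exists (x, y).
rewrite sum_cst.
have s0 : (0 : R) <= (size A)%:R by [].
have -> : d = k * ((size A).+1%:R * (Y + 1)) by rewrite divfK ?gt_eqF.
rewrite exprMn [leRHS]exprMn mulrCA ler_wpM2l ?sqr_ge0// -natr1.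
move: (size A)%:R s0 => z s0.
have : z * Y ^+ 2 <= ((z + 1) * (Y + 1)) ^+ 2.
  have h1 : z <= (z + 1) ^+ 2 by nra.
  have h2 : Y ^+ 2 <= (Y + 1) ^+ 2 by nra.
  by rewrite exprMn; apply: ler_pM => //; exact: sqr_ge0.
by [].
Qed.

(** If all values tended to [0], the element would be zero by [pointwise_null]. The values of a
    Cauchy sequence at a point form a Cauchy sequence, so a value that does not tend to [0] stays
    away from it. *)
Lemma nonzero_value a u : repr a u -> a <> Defs.czero c T ->
  exists p k N, [/\ Rpunc p, 0 < k & forall n, (N <= n)%N -> k <= normc (u n p)].
Proof.
move=> ha nz; apply: contrapT => hN; apply: nz; have [cu _] := ha.
apply: repr_inj ha (repr_czero c T) _ => e e0.
have [|N hN'] := pointwise_null cu _ e0; last first.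
  exists N => n nN; rewrite (_ : ksub _ _ = u n); first exact: hN'.
  by apply/funext => p; rewrite /ksub /Defs.kzero subr0.
move=> p hp d d0; apply: contrapT => hd; apply: hN.
have [Cu hu] := (cauchy_seqP _).1 cu; have d2 : 0 < d / 2 by rewrite divr_gt0.
have [M hM] := hu _ d2; exists p, (d / 2), M; split=> // n nM.
rewrite leNgt; apply/negP => hn; apply: hd; exists M => m mM.
have h1 : normc (ksub (u m) (u n) p) <= d / 2.
  by apply: (kbound_point (ltW d2) _ hp); exact: hM.
have -> : u m p = ksub (u m) (u n) p + u n p by rewrite /ksub subrK.
by apply: le_lt_trans (normcD _ _) _; lra.
Qed.

Lemma cclosure_self (P : set cstar) a : P a -> Defs.cclosure P a.
Proof.
move=> Pa e e0; exists a => //; have ha := repr_crepr a.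
apply: (cdist_lt ha ha (lexx 0) e0); exists 0%N => n _; rewrite ksubxx.
exact: kbound0.
Qed.

End Closure.

(** * The algebra [AT_pin] and its closed ideals *)

Section Algebra.
Context {R : realType} (c : planeOf R) (T : tilesetOf R).
Context {hc : interior_puncture c} {hT : pinwheel_hull c T}.

Local Open Scope complex_scope.

Local Notation puncture := (puncture c).
Local Notation Cc := (Cc c T).
Local Notation conv := (Defs.conv c T).
Local Notation cauchy_seq := (Defs.cauchy_seq c T).
Local Notation cstar := (Defs.cstar c T).
Local Notation cembed := (Defs.cembed c T).
Local Notation kadd := (@Defs.kadd R).
Local Notation kbound := (kbound c T).
Local Notation ev_bound := (ev_bound c T).
Local Notation bounded_seq := (bounded_seq c T).
Local Notation gens := (AN_generators c T).
Local Notation AT_pin := (@Defs.AT_pin R c T).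
Local Notation normc := (@Normc.normc R).
Implicit Types (f g h : @pairfun R) (u v w : nat -> @pairfun R) (C D e : R) (a b : cstar).

(** These are weighted partial permutation matrices: with at most one nonzero entry in each row and
    column no cross terms arise, and the largest modulus bounds the norm. *)
Lemma kbound_partial C f : 0 <= C -> (forall p, normc (f p) <= C) ->
  (forall x y y', f (x, y) <> 0 -> f (x, y') <> 0 -> y = y') ->
  (forall x x' y, f (x, y) <> 0 -> f (x', y) <> 0 -> x = x') -> kbound C f.
Proof.
move=> C0 fC row col S hS A B xi uA uB _ _.
have row1 x : normc (\sum_(y <- B) f (x, y) * xi y) ^+ 2 <=
    \sum_(y <- B | f (x, y) != 0) C ^+ 2 * normc (xi y) ^+ 2.
  have [[y [yB fy]]|hN] := pselect (exists y, y \in B /\ f (x, y) <> 0); last first.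
    rewrite big_seq big1 ?Normc.normc0 ?expr0n/=.
      by apply: sumr_ge0 => y _; rewrite mulr_ge0 ?sqr_ge0.
    move=> y yB; have [->|/eqP fy] := eqVneq (f (x, y)) 0; first by rewrite mul0r.
    by exfalso; apply: hN; exists y.
  rewrite (bigD1_seq y)//= big1_seq ?addr0; last first.
    move=> z /andP[zy _]; have [->|/eqP fz] := eqVneq (f (x, z)) 0; first by rewrite mul0r.
    by move: zy; rewrite (row _ _ _ fz fy) eqxx.
  rewrite (bigID (pred1 y)) /= -[leLHS]addr0; apply: lerD; last first.
    by apply: sumr_ge0 => z _; rewrite mulr_ge0 ?sqr_ge0.
  rewrite (eq_bigl (pred1 y)); last first.
    by move=> z /=; have [->|] := eqVneq z y; rewrite ?andbF// andbT; apply/eqP.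
  rewrite -big_filter filter_pred1_uniq// big_seq1 normcM exprMn.
  by rewrite ler_wpM2r ?sqr_ge0// ler_pXn2r ?nnegrE ?normc_ge0.
apply: le_trans (ler_sum _ (fun x _ => row1 x)) _.
under eq_bigr do rewrite big_mkcond.
rewrite exchange_big /= /sqnorm mulr_sumr; apply: ler_sum => y _.
rewrite -big_mkcond /=.
have z0 : 0 <= C ^+ 2 * normc (xi y) ^+ 2 by rewrite mulr_ge0 ?sqr_ge0.
have [[x [xA fx]]|hN] := pselect (exists x, x \in A /\ f (x, y) <> 0); last first.
  rewrite big_seq_cond big1//= => x /andP[xA fx]; exfalso; apply: hN; exists x.
  by split=> //; apply/eqP.
rewrite (eq_bigl (pred1 x)); last first.
  by move=> z /=; apply/idP/eqP => [/eqP fz|->]; [exact: col fz fx|apply/eqP].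
by rewrite -big_filter filter_pred1_uniq// big_seq1.
Qed.

Lemma kbound_gen k N i t t' : omega_iter_proto c N i t -> omega_iter_proto c N i t' ->
  kbound 1 (gen c T k N i t t').
Proof.
move=> ht ht'; have nz p : gen c T k N i t t' p <> 0 -> VN c T N i t t' p.
  by rewrite genE//; case: asboolP.
apply: kbound_partial => //.
- move=> p; rewrite genE//; case: asboolP => _; last by rewrite Normc.normc0.
  by rewrite normc_exprz// normc_zeta.
- move=> x y y' /nz/(VNP T _ ht ht')[ph h /= e] /nz/(VNP T _ ht ht')[ph' h' /= e'].
  by have [_ er _] := addr_unique h h'; rewrite e e' er.
move=> x x' y /nz/(VNP T _ ht ht')[ph h /= e] /nz/(VNP T _ ht ht')[ph' h' /= e'].
have b1 := addr_shift h ht'; have b2 := addr_shift h' ht'.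
rewrite -e in b1; rewrite -e' in b2; have [_ er _] := addr_unique b1 b2.
have : sact 0 (- (rotmx ph *m (puncture t - puncture t'))) y =
  sact 0 (- (rotmx ph' *m (puncture t - puncture t'))) y by rewrite er.
by rewrite {1}e e' !sact0D !subrr !sact_id.
Qed.

Lemma kspan_ind (G : set (@pairfun R)) (Q : @pairfun R -> Prop) f :
  Q (@Defs.kzero R) -> (forall g h, Q g -> Q h -> Q (kadd g h)) ->
  (forall k g, G g -> Q (kscale k g)) -> kspan G f -> Q f.
Proof.
move=> Q0 QD QZ [n [a [g [hg ->]]]]; elim: n a g hg => [|n IH] a g hg.
  rewrite (_ : (fun _ => _) = @Defs.kzero R)//.
  by apply/funext => p; rewrite big_ord0.
rewrite (_ : (fun _ => _) = kadd (kscale (a ord0) (g ord0))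
    (fun p => \sum_j a (lift ord0 j) * g (lift ord0 j) p)).
  by apply: QD; [exact: QZ|apply: IH => j].
by apply/funext => p; rewrite big_ord_recl.
Qed.

Lemma Cc_span N f : kspan (gens N) f -> Cc f.
Proof.
apply: kspan_ind; [exact: Cc0|exact: Cc_kadd|].
by move=> k g [k' [i [t [t' [ht ht' ->]]]]]; apply: Cc_kscale; exact: Cc_gen.
Qed.

Lemma kbound_span N f : kspan (gens N) f -> exists2 C, 0 <= C & kbound C f.
Proof.
apply: (kspan_ind (Q := fun g => exists2 C, 0 <= C & kbound C g)).
- by exists 0 => //; exact: kbound0.
- move=> g h [C C0 hg] [D D0 hh]; exists (C + D); first exact: addr_ge0.
  exact: kbound_kadd.
move=> k g [k' [i [t [t' [ht ht' ->]]]]]; exists (normc k * 1).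
  by rewrite mulr1 normc_ge0.
by apply: kbound_kscale; exact: kbound_gen.
Qed.

Lemma kspan_gen N k i t t' : omega_iter_proto c N i t -> omega_iter_proto c N i t' ->
  kspan (gens N) (gen c T k N i t t').
Proof.
move=> ht ht'; exists 1%N, (fun=> 1), (fun=> gen c T k N i t t'); split.
  by move=> _; exists k, i, t, t'.
by apply/funext => p; rewrite big_ord1 mul1r.
Qed.

Lemma kspan_sum (G : set (@pairfun R)) n (a : 'I_n -> R[i]) (g : 'I_n -> @pairfun R) :
  (forall j, G (g j)) -> kspan G (fun p => \sum_j a j * g j p).
Proof. by move=> hg; exists n, a, g. Qed.

Lemma span_AT N f : kspan (gens N) f -> AT_pin (cembed f).
Proof.
move=> hf; apply: cclosure_self; exists N => //.
by apply: cclosure_self; exists f.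
Qed.

Lemma AT_approx a u e : AT_pin a -> repr a u -> 0 < e ->
  exists N f, kspan (gens N) f /\ ev_bound e (fun n => ksub (u n) f).
Proof.
(* Two closures are crossed and [lt_cdist] doubles each distance, so quarters of [e] are needed. *)
move=> ha hu e0; have e8 : 0 < e / 4 by rewrite divr_gt0.
have e4 : 0 <= 2 * (e / 4) by rewrite mulr_ge0// ltW.
have [b [N _ hb] hab] := ha _ e8; have [_ [f hf <-] hbf] := hb _ e8.
exists N, f; split=> //.
have h1 : ev_bound (2 * (e / 4)) (fun n => ksub (u n) (crepr b n)).
  exact: lt_cdist hu (repr_crepr b) e8 hab.
have h2 : ev_bound (2 * (e / 4)) (fun n => ksub (crepr b n) f).
  exact: lt_cdist (repr_crepr b) (repr_cembed (Cc_span hf)) e8 hbf.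
have [M hM] := ev_bound_kadd e4 e4 h1 h2; exists M => n /hM.
rewrite -ksub_triangle.
by apply: kbound_le; [exact: addr_ge0|lra].
Qed.

Lemma AT_bounded a u : AT_pin a -> repr a u -> bounded_seq u.
Proof.
move=> ha hu; have [N [f [hf h]]] := AT_approx ha hu ltr01.
have [C C0 hC] := kbound_span hf; exists (1 + C); first exact: addr_ge0.
have hf' : ev_bound C (fun=> f) by exists 0%N.
have [M hM] := ev_bound_kadd ler01 C0 h hf'; exists M => n /hM.
rewrite (_ : kadd _ _ = u n)//.
by apply/funext => p; rewrite /Defs.kadd /ksub subrK.
Qed.

Lemma bounded_const N f : kspan (gens N) f -> bounded_seq (fun=> f).
Proof. by move=> /kbound_span[C C0 hC]; exists C => //; exists 0%N. Qed.

Section Ideal.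
Variable I : set cstar.
Hypothesis hI : closed_ideal AT_pin I.

Definition ideal_seq u := exists2 a, I a & repr a u.

Lemma ideal_seq_cauchy u : ideal_seq u -> cauchy_seq u.
Proof. by move=> [a _ []]. Qed.

Lemma ideal_seq_bounded u : ideal_seq u -> bounded_seq u.
Proof. by move=> [a Ia hu]; case: hI => IS _ _ _; exact: AT_bounded (IS _ Ia) hu. Qed.

Lemma ideal_seq_add u v : ideal_seq u -> ideal_seq v -> ideal_seq (fun n => kadd (u n) (v n)).
Proof.
move=> [a Ia ha] [b Ib hb]; case: hI => _ [_ h _] _ _; exists (Defs.cadd a b); first exact: h.
exact: repr_cadd.
Qed.

Lemma ideal_seq_scale k u : ideal_seq u -> ideal_seq (fun n => kscale k (u n)).
Proof.
move=> [a Ia ha]; case: hI => _ [_ _ h] _ _; exists (Defs.cscale k a); first exact: h.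
exact: repr_cscale.
Qed.

Lemma ideal_seq_mull N s u : kspan (gens N) s -> ideal_seq u -> ideal_seq (fun n => conv s (u n)).
Proof.
move=> hs hu; have bu := ideal_seq_bounded hu; case: hu => a Ia ha.
case: hI => _ _ h _; exists (Defs.cmul (cembed s) a).
  by have [] := h (cembed s) a (span_AT hs) Ia.
apply: repr_cmul => //; [exact: repr_cembed (Cc_span hs)|exact: bounded_const hs].
Qed.

Lemma ideal_seq_mulr N s u : kspan (gens N) s -> ideal_seq u -> ideal_seq (fun n => conv (u n) s).
Proof.
move=> hs hu; have bu := ideal_seq_bounded hu; case: hu => a Ia ha.
case: hI => _ _ h _; exists (Defs.cmul a (cembed s)).
  by have [] := h (cembed s) a (span_AT hs) Ia.
apply: repr_cmul => //; [exact: repr_cembed (Cc_span hs)|exact: bounded_const hs].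
Qed.

Lemma ideal_seq_mul a u v : AT_pin a -> repr a u -> ideal_seq v ->
  ideal_seq (fun n => conv (u n) (v n)).
Proof.
move=> Sa ha hv; have bv := ideal_seq_bounded hv; case: hv => b Ib hb.
case: hI => _ _ h _; exists (Defs.cmul a b); first by have [] := h _ _ Sa Ib.
by apply: repr_cmul => //; exact: AT_bounded ha.
Qed.

Lemma ideal_seqM u v : ideal_seq u -> ideal_seq v -> ideal_seq (fun n => conv (u n) (v n)).
Proof. by move=> [a Ia ha]; case: hI => IS _ _ _; exact: ideal_seq_mul (IS _ Ia) ha. Qed.

Lemma ideal_seq0 : ideal_seq (fun=> @Defs.kzero R).
Proof. by case: hI => _ [h _ _] _ _; exists (Defs.czero c T) => //; exact: repr_czero. Qed.

Lemma ideal_seq_close v : cauchy_seq v ->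
  (forall e, 0 < e -> exists2 u, ideal_seq u & ev_bound e (fun n => ksub (v n) (u n))) ->
  ideal_seq v.
Proof.
move=> cv h; have hv := repr_cclass cv; exists (Defs.cclass c T v) => //.
case: hI => _ _ _; apply=> e e0; have e2 : 0 < e / 2 by rewrite divr_gt0.
have [u [a Ia ha] hu] := h _ e2; exists a => //.
apply: (cdist_lt hv ha (ltW e2) _ hu); lra.
Qed.

End Ideal.

End Algebra.

(** * Mean squares of polynomials on the circle and along orbits *)

Section TrigonometricAverages.
Context {R : realType}.

Local Open Scope complex_scope.

Local Notation C := R[i].
Local Notation normc := (@Normc.normc R).
Implicit Types (P : {poly C}) (x y z w u : C).

Lemma realC_inj (a b : R) : a%:C = b%:C -> a = b.
Proof. by case. Qed.

Lemma normc_conj z : normc (z^*)%R = normc z.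
Proof. by apply: realC_inj; rewrite -!normcE norm_conjC. Qed.

Lemma normc_sqrC z : (normc z ^+ 2)%:C = z * (z^*)%R.
Proof. by rewrite -normCK normcE -rmorphXn. Qed.

Lemma normc_real (a : R) : normc a%:C = `|a|.
Proof. by rewrite /Normc.normc /= expr0n addr0 sqrtr_sqr. Qed.

Lemma normcX z n : normc (z ^+ n) = normc z ^+ n.
Proof.
by elim: n => [|n IH]; rewrite ?expr0 ?Normc.normc1// !exprS normcM IH.
Qed.

Lemma unit_conj y : normc y = 1 -> y * (y^*)%R = 1.
Proof. by move=> y1; rewrite -normc_sqrC y1 expr1n. Qed.

(** By Parseval this is the mean of [|P|^2] over the unit circle. *)
Definition coef_sq P : R := \sum_(k < size P) normc P`_k ^+ 2.

Lemma coef_sq_ge0 P : 0 <= coef_sq P.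
Proof. by apply: sumr_ge0 => k _; exact: sqr_ge0. Qed.

Lemma geometric_bound w n : normc w = 1 -> w != 1 ->
  normc (\sum_(b < n) w ^+ b) <= 2 / normc (w - 1).
Proof.
move=> w1 wn1; have d0 : 0 < normc (w - 1).
  rewrite lt_def normc_ge0 andbT; apply/eqP => /Normc.eq0_normc/eqP.
  by rewrite subr_eq0 (negbTE wn1).
rewrite ler_pdivlMr// mulrC -normcM -subrX1.
apply: le_trans (normcD _ _) _; rewrite normcN Normc.normc1 normcX w1 expr1n.
by lra.
Qed.

(* Expand [|P|^2]: the diagonal terms give [coef_sq P], and the term of exponent
   [k - l <> 0] is a geometric sum of ratio [u ^ (k - l) <> 1]. *)
Lemma orbit_average P u : normc u = 1 -> (forall k, u ^+ k.+1 <> 1) ->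
  exists2 K : R, 0 <= K & forall B x, normc x = 1 ->
    `|\sum_(b < B) normc P.[x * u ^+ b] ^+ 2 - B%:R * coef_sq P| <= K.
Proof.
move=> u1 un1.
pose wkl (k l : nat) : C := u ^+ k * (u^*)%R ^+ l.
have w1 k l : normc (wkl k l) = 1.
  by rewrite normcM !normcX normc_conj u1 !expr1n mulr1.
have wn1 k l : k != l -> wkl k l != 1.
  move=> kl; apply/eqP => e.
  have e2 : u ^+ k = u ^+ l.
    rewrite -[RHS]mul1r -e /wkl -mulrA -exprMn (mulrC (u^*)%R) unit_conj// expr1n.
    by rewrite mulr1.
  have u0 : u != 0.
    by apply/eqP => u0; move: u1; rewrite u0 Normc.normc0 => /eqP; rewrite eq_sym oner_eq0.
  have aux (m n : nat) : (m < n)%N -> u ^+ m = u ^+ n -> False.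
    move=> mn; rewrite -(subnKC (ltnW mn)) exprD -[LHS]mulr1.
    move=> /(mulfI (expf_neq0 m u0)); case: (n - m)%N (subn_gt0 m n) => [|d _ /esym/un1//].
    by rewrite mn.
  by move: kl; case: ltngtP => // kl _; [exact: aux kl e2|exact: aux kl (esym e2)].
pose M (k l : nat) : R := if k == l then 0 else 2 / normc (wkl k l - 1).
have M0 k l : 0 <= M k l by rewrite /M; case: ifP => // _; rewrite divr_ge0// normc_ge0.
exists (\sum_(k < size P) \sum_(l < size P) normc P`_k * normc P`_l * M k l).
  by apply: sumr_ge0 => k _; apply: sumr_ge0 => l _; rewrite !mulr_ge0 ?normc_ge0.
move=> B x x1; pose y b := x * u ^+ b.
have y1 b : normc (y b) = 1 by rewrite normcM normcX x1 u1 expr1n mulr1.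
pose E (k l : nat) : C := \sum_(b < B) y b ^+ k * ((y b)^*)%R ^+ l - (k == l)%:R * B%:R.
have EM k l : normc (E k l) <= M k l.
  rewrite /E /M; have [->|kl] := eqVneq k l.
    under eq_bigr do rewrite -exprMn unit_conj// expr1n.
    by rewrite sumr_const card_ord mul1r subrr Normc.normc0.
  rewrite mul0r subr0.
  have -> : \sum_(b < B) y b ^+ k * ((y b)^*)%R ^+ l =
      x ^+ k * (x^*)%R ^+ l * \sum_(b < B) wkl k l ^+ b.
    rewrite mulr_sumr; apply: eq_bigr => b _.
    by rewrite /y /wkl rmorphM rmorphXn !exprMn -!exprM mulrACA !(mulnC b).
  rewrite !normcM !normcX normc_conj x1 !expr1n !mul1r.
  exact: geometric_bound (w1 _ _) (wn1 _ _ kl).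
rewrite -normc_real rmorphB rmorph_sum rmorphM /=.
have -> : \sum_(b < B) (normc P.[x * u ^+ b] ^+ 2)%:C - B%:R%:C * (coef_sq P)%:C =
    \sum_(k < size P) \sum_(l < size P) P`_k * ((P`_l)^*)%R * E k l.
  have -> : \sum_(b < B) (normc P.[x * u ^+ b] ^+ 2)%:C =
      \sum_(k < size P) \sum_(l < size P) P`_k * ((P`_l)^*)%R *
        \sum_(b < B) y b ^+ k * ((y b)^*)%R ^+ l.
    transitivity (\sum_(b < B) \sum_(k < size P) \sum_(l < size P)
        P`_k * ((P`_l)^*)%R * (y b ^+ k * ((y b)^*)%R ^+ l)).
      apply: eq_bigr => b _; rewrite normc_sqrC -/(y b) horner_coef rmorph_sum mulr_suml.
      apply: eq_bigr => k _; rewrite mulr_sumr; apply: eq_bigr => l _.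
      by rewrite rmorphM rmorphXn mulrACA.
    rewrite exchange_big; apply: eq_bigr => k _; rewrite exchange_big.
    by apply: eq_bigr => l _; rewrite mulr_sumr.
  have -> : B%:R%:C * (coef_sq P)%:C = \sum_(k < size P) \sum_(l < size P)
      P`_k * ((P`_l)^*)%R * ((nat_of_ord k == l)%:R * B%:R).
    rewrite /coef_sq rmorph_sum mulr_sumr; apply: eq_bigr => k _.
    rewrite (bigD1 k)//= big1 ?addr0.
      by rewrite eqxx mul1r normc_sqrC mulrC rmorph_nat.
    by move=> l lk; rewrite (_ : (_ == _) = false) ?mul0r ?mulr0//; rewrite eq_sym; exact: negbTE lk.
  rewrite -sumrB; apply: eq_bigr => k _; rewrite -sumrB; apply: eq_bigr => l _.
  by rewrite -mulrBr.
apply: le_trans (normc_sum_le _ _) _; apply: ler_sum => k _.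
apply: le_trans (normc_sum_le _ _) _; apply: ler_sum => l _.
by rewrite !normcM normc_conj ler_wpM2l ?mulr_ge0 ?normc_ge0.
Qed.

(** Cauchy-Schwarz against the constant [1]. The factor [size P] grows at most linearly along
    powers, which is harmless in [coef_sq_pow_ratio]. *)
Lemma coef_sq_horner P z : normc z = 1 ->
  normc P.[z] ^+ 2 <= (size P)%:R * coef_sq P.
Proof.
move=> z1; rewrite horner_coef.
apply: (@le_trans _ _ ((\sum_(k < size P) 1 * normc P`_k) ^+ 2)).
  rewrite ler_pXn2r ?nnegrE ?normc_ge0//; last first.
    by apply: sumr_ge0 => k _; rewrite mul1r normc_ge0.
  apply: le_trans (normc_sum_le _ _) _; apply: ler_sum => k _.
  by rewrite normcM normcX z1 expr1n mulr1 mul1r.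
apply: le_trans (cauchy_schwarz_sum _ _ _) _.
by under eq_bigr do rewrite expr1n; rewrite sumr_const card_ord.
Qed.

(** If the ratio were always below [t], then [coef_sq (P ^+ M)] would be at most [t ^+ M], while the
    value at [z] shows that it is at least [(2 * t) ^+ M] divided by the size of [P ^+ M]. So
    [2 ^ M] would grow at most linearly; the factor [2] in the hypothesis is there for this
    contradiction. *)
Lemma coef_sq_pow_ratio P z (t : R) : normc z = 1 -> 0 < t -> 2 * t <= normc P.[z] ^+ 2 ->
  exists M, 0 < coef_sq (P ^+ M) /\ t * coef_sq (P ^+ M) <= coef_sq (P ^+ M.+1).
Proof.
move=> z1 t0 ht.
have t2 : 0 < 2 * t by rewrite mulr_gt0.
have low M : (2 * t) ^+ M <= (size (P ^+ M))%:R * coef_sq (P ^+ M).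
  apply: le_trans (coef_sq_horner _ z1); rewrite horner_exp normcX exprAC.
  by apply: lerXn2r; rewrite ?nnegrE ?(ltW t2)// (le_trans (ltW t2)).
have pos M : 0 < coef_sq (P ^+ M).
  rewrite lt_def coef_sq_ge0 andbT; apply/eqP => e.
  by have := low M; rewrite e mulr0 leNgt exprn_gt0.
suff [M hM] : exists M, t * coef_sq (P ^+ M) <= coef_sq (P ^+ M.+1) by exists M.
apply: contrapT => hN.
have step M : coef_sq (P ^+ M.+1) < t * coef_sq (P ^+ M).
  by rewrite ltNge; apply/negP => h; apply: hN; exists M.
have up M : coef_sq (P ^+ M) <= t ^+ M.
  elim: M => [|M IH].
    by rewrite !expr0 /coef_sq size_poly1 big_ord1 coef1 eqxx Normc.normc1 expr1n.
  rewrite [leRHS]exprS; apply: le_trans (ltW (step M)) _.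
  by rewrite ler_wpM2l// ltW.
have bad M : (2 ^ M <= M * size P + 1)%N.
  have h1 : (size (P ^+ M) <= M * size P + 1)%N.
    apply: leq_trans (size_poly_exp_leq _ _) _; rewrite addn1 ltnS mulnC leq_mul//.
    exact: leq_pred.
  rewrite -(ler_nat R) natrX -(@ler_pM2r _ (t ^+ M)) ?exprn_gt0// -exprMn.
  apply: le_trans (low M) _; apply: ler_pM => //; first exact: coef_sq_ge0.
  by rewrite ler_nat.
(* For the exponent [2 * k] the linear bound is [2 * k * size P + 1 = k * (k - 1) + 1], less than
   [(k + 1) ^ 2 <= 2 ^ (2 * k)]. *)
pose k := (2 * size P).+1.
have h1 : (k.+1 * k.+1 <= 2 ^ (2 * k))%N.
  by rewrite mul2n -addnn expnD leq_mul// ltn_expl.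
by have := leq_trans h1 (bad (2 * k)%N); rewrite /k; nia.
Qed.

End TrigonometricAverages.

(** * Irrationality of the pinwheel angle *)

Section IrrationalAngle.
Context {R : realType}.

Local Open Scope complex_scope.
Local Notation lam := (@lambda R).

Lemma expiN (a : R) : expi (- a) * expi a = 1.
Proof. by rewrite -expiD addNr /expi cos0 sin0. Qed.

Lemma expiM (a : R) n : expi (n%:R * a) = expi a ^+ n.
Proof.
elim: n => [|n IH]; first by rewrite mul0r expr0 /expi cos0 sin0.
by rewrite -natr1 mulrDl mul1r expiD IH exprSr.
Qed.

(* [5 e^(2 i theta) = 3 + 4 i] and the powers of [3 + 4 i] are all congruent to
   it modulo [5]. *)
Lemma pow_3_4i n : exists a b : int,
  (3 +i* 4 : R[i]) ^+ n.+1 = (5 * a + 3)%:~R +i* (5 * b + 4)%:~R.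
Proof.
elim: n => [|n [a [b IH]]].
  by exists 0, 0; rewrite expr1 !mulr0 !add0r.
exists (3 * a - 4 * b - 2), (4 * a + 3 * b + 4); rewrite exprS IH; simpc.
by congr (_ +i* _); rewrite !(rmorphD, rmorphB, rmorphM, rmorphN) /=; ring.
Qed.

Lemma expi_2theta : expi (2 * @theta R) = (3 / 5) +i* (4 / 5).
Proof.
have [ct st] := @thetaP R; have l2 := @lambda_sqr R; have l0 := @lambda_neq0 R.
rewrite (_ : 2 * theta = theta + theta); last by ring.
rewrite /expi cosD sinD ct st; congr (_ +i* _).
  transitivity (3 / lam ^+ 2); [by field|by rewrite l2].
transitivity (4 / lam ^+ 2); [by field|by rewrite l2].
Qed.

(** Otherwise [(3 + 4 i) ^+ n.+1] would be real, although its imaginary part is [4] modulo [5]. *)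
Lemma theta_irrational n : expi (2 * @theta R) ^+ n.+1 <> 1.
Proof.
rewrite expi_2theta => h; have [a [b e]] := pow_3_4i n.
have e5 : (3 +i* 4 : R[i]) = 5%:C * ((3 / 5) +i* (4 / 5)).
  by simpc; congr (_ +i* _); field.
move: e; rewrite e5 exprMn h mulr1 -rmorphXn /= => -[_ /esym/eqP].
by rewrite intr_eq0 => /eqP; lia.
Qed.

Lemma theta_irrational_sign j n : expi (- (2 * (orient j * @theta R))) ^+ n.+1 <> 1.
Proof.
case: j; rewrite /orient.
  by rewrite mulN1r mulrN opprK; exact: theta_irrational.
rewrite mul1r => h; apply: (@theta_irrational n).
by rewrite -[LHS]mul1r -{1}h -exprMn expiN expr1n.
Qed.

End IrrationalAngle.

(** * Kernels in the corner of a subtile *)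

Section Corner.
Context {R : realType} (c : planeOf R) (T : tilesetOf R).
Context {hc : interior_puncture c} {hT : pinwheel_hull c T}.

Local Open Scope complex_scope.

Local Notation tile := (tileOf R).
Local Notation tileset := (tilesetOf R).
Local Notation puncture := (puncture c).
Local Notation Rpunc := (Rpunc c T).
Local Notation eqclass := (eqclass c T).
Local Notation conv := (Defs.conv c T).
Local Notation kbound := (kbound c T).
Local Notation gens := (AN_generators c T).
Local Notation gen := (gen c T).
Local Notation addr := (addr c T).
Local Notation zeta := (zeta c).
Local Notation normc := (@Normc.normc R).
Implicit Types (f g w : @pairfun R) (x y z : tileset) (q : tile) (e : R).

Lemma conv_single_l f g x z y : eqclass x z -> (forall z', f (x, z') <> 0 -> z' = z) ->
  conv f g (x, y) = f (x, z) * g (z, y).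
Proof.
move=> xz hf; rewrite /Defs.conv /= (@fsum_cover _ _ _ [:: z]) ?big_seq1//.
  by move=> z'; rewrite inE => /eqP ->.
move=> z' _ fg; rewrite inE; apply/eqP; apply: hf => f0; apply: fg.
by rewrite f0 mul0r.
Qed.

Lemma conv_single_r f g x z y : eqclass x z -> (forall z', g (z', y) <> 0 -> z' = z) ->
  conv f g (x, y) = f (x, z) * g (z, y).
Proof.
move=> xz hg; rewrite /Defs.conv /= (@fsum_cover _ _ _ [:: z]) ?big_seq1//.
  by move=> z'; rewrite inE => /eqP ->.
move=> z' _ fg; rewrite inE; apply/eqP; apply: hg => g0; apply: fg.
by rewrite g0 mulr0.
Qed.

Variables (L : nat) (j : bool).
Local Notation sub q := (omega_iter_proto c L j q).
Local Notation VN := (VN c T L j).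

(* [sh q1 q2] moves the origin from the subtile [q1] to the subtile [q2] of the same
   supertile; it is defined on [inU q1], and [sh q1 q2 x = x] elsewhere. *)
Definition sh q1 q2 x := xget x [set x' | VN q1 q2 (x, x')].
Definition inU q x := exists ph, addr L j ph q x.

Lemma VN_unique q1 q2 x y y' : sub q1 -> sub q2 ->
  VN q1 q2 (x, y) -> VN q1 q2 (x, y') -> y = y'.
Proof.
move=> h1 h2 /(VNP T _ h1 h2)[ph a /= e] /(VNP T _ h1 h2)[ph' a' /= e'].
by have [_ er _] := addr_unique a a'; rewrite e e' er.
Qed.

Lemma shP q1 q2 ph x : addr L j ph q1 x -> sub q2 ->
  sh q1 q2 x = sact 0 (rotmx ph *m (puncture q1 - puncture q2)) x.
Proof.
move=> a h2; have h1 := addr_sub a.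
have hV : VN q1 q2 (x, sact 0 (rotmx ph *m (puncture q1 - puncture q2)) x).
  by apply/VNP => //; exists ph.
by apply: xget_unique => // y hy; exact: VN_unique hy hV.
Qed.

Lemma sh_addr q1 q2 ph x : addr L j ph q1 x -> sub q2 -> addr L j ph q2 (sh q1 q2 x).
Proof. by move=> a h2; rewrite (shP a h2); exact: addr_shift. Qed.

Lemma shK q1 q2 x : sub q2 -> inU q1 x -> sh q2 q1 (sh q1 q2 x) = x.
Proof.
move=> h2 [ph a]; rewrite (shP (sh_addr a h2) (addr_sub a)) (shP a h2) sact0D.
by rewrite -mulmxDr addrA subrK subrr mulmx0 sact_id.
Qed.

Lemma VN_sh q1 q2 x y : sub q1 -> sub q2 ->
  VN q1 q2 (x, y) <-> inU q1 x /\ y = sh q1 q2 x.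
Proof.
move=> h1 h2; split=> [/(VNP T _ h1 h2)[ph a /= e]|[[ph a] ->]].
  by split; [exists ph|rewrite (shP a h2)].
by apply/VNP => //; exists ph => //=; rewrite (shP a h2).
Qed.

Lemma sh_class q1 q2 x : sub q2 -> inU q1 x -> eqclass x (sh q1 q2 x).
Proof.
move=> h2 hx; have [ph a] := hx; apply: (VN_Rpunc (addr_sub a) h2).
by apply/VN_sh => //; exact: addr_sub a.
Qed.

Lemma VN_inU2 q1 q2 x y : sub q1 -> sub q2 -> VN q1 q2 (x, y) ->
  inU q2 y /\ x = sh q2 q1 y.
Proof.
move=> h1 h2 /(VN_sh _ _ h1 h2)[hx ->]; split; last by rewrite shK.
by have [ph a] := hx; exists ph; exact: sh_addr.
Qed.

(** A Laurent polynomial in [z] times the partial isometry [e_L(p_j, q1, q2)]. *)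
Definition laurent_kernel n (a : 'I_n -> R[i]) (k : 'I_n -> int) q1 q2 : @pairfun R :=
  fun p => \sum_l a l * gen (k l) L j q1 q2 p.

Lemma laurent_kernelE n (a : 'I_n -> R[i]) k q1 q2 p : sub q1 -> sub q2 ->
  laurent_kernel a k q1 q2 p =
  if `[< VN q1 q2 p >] then \sum_l a l * zeta p.1 ^ k l else 0.
Proof.
move=> h1 h2; rewrite /laurent_kernel.
have [hV|hV] := asboolP (VN q1 q2 p).
  by apply: eq_bigr => l _; rewrite genE// (asboolT hV).
by rewrite big1// => l _; rewrite genE// (asboolF hV) mulr0.
Qed.

Lemma laurent_kernel_span n (a : 'I_n -> R[i]) k q1 q2 : sub q1 -> sub q2 ->
  kspan (gens L) (laurent_kernel a k q1 q2).
Proof. by move=> h1 h2; apply: kspan_sum => l; exists (k l), j, q1, q2. Qed.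

(** From [x] the kernel [s1] leads only to [sh q q1 x], and [s2] reaches [y] only from [sh q q2 y],
    so both convolutions have one term. *)
Lemma corner_conv q q1 q2 s1 s2 w x y : sub q -> sub q1 -> sub q2 ->
  (forall p, s1 p <> 0 -> VN q q1 p) -> (forall p, s2 p <> 0 -> VN q2 q p) ->
  (forall p, ~ Rpunc p -> w p = 0) ->
  conv (conv s1 w) s2 (x, y) = if `[< inU q x /\ inU q y >] then
    s1 (x, sh q q1 x) * w (sh q q1 x, sh q q2 y) * s2 (sh q q2 y, y) else 0.
Proof.
move=> h h1 h2 hs1 hs2 hw; case: asboolP => [[hx hy]|hN]; last first.
  apply: contrapT => /conv_neq0[z _ [/= /conv_neq0[z' _ [/= a1 _]] a2]]; apply: hN.
  split; first by have /(VN_sh _ _ h h1)[] := hs1 _ a1.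
  by have [] := VN_inU2 h2 h (hs2 _ a2).
have e1 z : conv s1 w (x, z) = s1 (x, sh q q1 x) * w (sh q q1 x, z).
  apply: conv_single_l; first exact: sh_class.
  by move=> z' /hs1/(VN_sh _ _ h h1)[].
have only z : s2 (z, y) <> 0 -> z = sh q q2 y.
  by move=> /hs2/(VN_inU2 h2 h)[].
have [xy|nxy] := pselect (eqclass x (sh q q2 y)).
  by rewrite (conv_single_r _ xy only) e1.
(* The two shifted tilings are not equivalent: [w] vanishes there, and the sum over the class of [x]
   does not contain the only possible intermediate tiling. *)
rewrite (hw (sh q q1 x, _)); last first.
  by move=> hR; apply: nxy; exact: Rpunc_trans (sh_class h1 hx) hR.
rewrite mulr0 mul0r; apply: contrapT => /conv_neq0[z xz [_ /= /only ez]].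
by apply: nxy; rewrite -ez.
Qed.

(* Cauchy-Schwarz over the averaging index [b] makes the bound depend only on the
   averages of [|c1 b x|^2] and [|c2 b x|^2], and not on their suprema. *)
Lemma corner_average_bound q (q1 q2 : nat -> tile) B (c1 c2 : nat -> tileset -> R[i])
    w e (K1 K2 : R) :
  sub q -> (forall b, (b < B)%N -> sub (q1 b)) -> (forall b, (b < B)%N -> sub (q2 b)) ->
  (0 < B)%N -> 0 <= e -> 0 <= K1 -> 0 <= K2 ->
  (forall x, inU q x -> \sum_(b < B) normc (c1 b x) ^+ 2 <= B%:R * K1) ->
  (forall x, inU q x -> \sum_(b < B) normc (c2 b x) ^+ 2 <= B%:R * K2) ->
  kbound e w ->
  kbound (e * Num.sqrt (K1 * K2)) (fun p => B%:R^-1 * \sum_(b < B)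
    if `[< inU q p.1 /\ inU q p.2 >] then
      c1 b p.1 * w (sh q (q1 b) p.1, sh q (q2 b) p.2) * c2 b p.2 else 0).
Proof.
move=> h h1 h2 B0 e0 K10 K20 hc1 hc2 hw S hS A D xi uA uD hA hD.
have BR0 : 0 < B%:R :> R by rewrite ltr0n.
have nB : normc (B%:R^-1 : R[i]) = B%:R^-1.
  have -> : (B%:R^-1 : R[i]) = (B%:R^-1)%:C by rewrite fmorphV rmorph_nat.
  by rewrite normc_real ger0_norm// invr_ge0 ltW.
rewrite exprMn sqr_sqrtr ?mulr_ge0//.
pose AU := [seq x <- A | `[< inU q x >]]; pose DU := [seq y <- D | `[< inU q y >]].
pose Z b x := \sum_(y <- DU) w (sh q (q1 b) x, sh q (q2 b) y) * (c2 b y * xi y).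
have bound_x x : normc (\sum_(y <- D) (B%:R^-1 * \sum_(b < B)
    if `[< inU q x /\ inU q y >] then
      c1 b x * w (sh q (q1 b) x, sh q (q2 b) y) * c2 b y else 0) * xi y) ^+ 2 <=
    if `[< inU q x >] then B%:R^-1 * K1 * \sum_(b < B) normc (Z b x) ^+ 2 else 0.
  have [hx|hx] := asboolP (inU q x); last first.
    rewrite big1 ?Normc.normc0 ?expr0n// => y _; rewrite big1 ?mulr0 ?mul0r// => b _.
    by case: asboolP => // -[].
  have -> : \sum_(y <- D) (B%:R^-1 * \sum_(b < B)
      if `[< inU q x /\ inU q y >] then
        c1 b x * w (sh q (q1 b) x, sh q (q2 b) y) * c2 b y else 0) * xi y =
      B%:R^-1 * \sum_(b < B) c1 b x * Z b x.
    transitivity (\sum_(y <- DU) B%:R^-1 * \sum_(b < B)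
        c1 b x * (w (sh q (q1 b) x, sh q (q2 b) y) * (c2 b y * xi y))).
      rewrite big_filter [RHS]big_mkcond; apply: eq_bigr => y _.
      have [hy|hy] := asboolP (inU q y).
        rewrite -mulrA mulr_suml; congr (_ * _); apply: eq_bigr => b _.
        by rewrite asboolT// !mulrA.
      rewrite big1 ?mulr0 ?mul0r// => b _.
      by rewrite asboolF// => -[].
    rewrite -mulr_sumr exchange_big; congr (_ * _); apply: eq_bigr => b _.
    by rewrite mulr_sumr.
  rewrite normcM exprMn nB.
  have : normc (\sum_(b < B) c1 b x * Z b x) ^+ 2 <=
      (B%:R * K1) * \sum_(b < B) normc (Z b x) ^+ 2.
    apply: (@le_trans _ _ ((\sum_(b < B) normc (c1 b x) * normc (Z b x)) ^+ 2)).
      rewrite ler_pXn2r ?nnegrE ?normc_ge0//; last first.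
        by apply: sumr_ge0 => b _; rewrite mulr_ge0 ?normc_ge0.
      apply: le_trans (normc_sum_le _ _) _; apply: ler_sum => b _.
      by rewrite normcM.
    apply: le_trans (cauchy_schwarz_sum _ _ _) _.
    by apply: ler_wpM2r; [exact: sum_sqr_ge0|exact: hc1].
  move=> /(ler_wpM2l (sqr_ge0 (B%:R^-1 : R)))/le_trans; apply.
  rewrite le_eqVlt; apply/orP; left; apply/eqP; field; exact: lt0r_neq0.
apply: le_trans (ler_sum _ (fun x _ => bound_x x)) _.
rewrite -big_mkcond /= -big_filter -/AU -mulr_sumr exchange_big /=.
have Zb (b : 'I_B) : \sum_(x <- AU) normc (Z b x) ^+ 2 <=
    e ^+ 2 * \sum_(y <- DU) normc (c2 b y * xi y) ^+ 2.
  have hq1 := h1 b (ltn_ord b); have hq2 := h2 b (ltn_ord b).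
  (* The bound on [w] is applied to the images of [AU] and [DU] under the injective shifts, with the
     vector [c2 b y * xi y] transported to [sh q (q2 b) y]. *)
  pose eta z := c2 b (sh (q2 b) q z) * xi (sh (q2 b) q z).
  have inAU x : x \in AU -> x \in A /\ inU q x.
    by rewrite mem_filter => /andP[/asboolP].
  have inDU y : y \in DU -> y \in D /\ inU q y.
    by rewrite mem_filter => /andP[/asboolP].
  have := hw _ hS (map (sh q (q1 b)) AU) (map (sh q (q2 b)) DU) eta.
  rewrite /sqnorm !big_map /=.
  have -> : \sum_(x <- AU) normc (\sum_(y <- map (sh q (q2 b)) DU)
      w (sh q (q1 b) x, y) * eta y) ^+ 2 = \sum_(x <- AU) normc (Z b x) ^+ 2.
    apply: eq_bigr => x _; rewrite big_map /Z; congr (normc _ ^+ 2).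
    rewrite big_seq [RHS]big_seq; apply: eq_bigr => y /inDU[_ hy].
    by rewrite /eta shK.
  have -> : \sum_(y <- DU) normc (eta (sh q (q2 b) y)) ^+ 2 =
      \sum_(y <- DU) normc (c2 b y * xi y) ^+ 2.
    rewrite big_seq [RHS]big_seq; apply: eq_bigr => y /inDU[_ hy].
    by rewrite /eta shK.
  apply.
  - rewrite map_inj_in_uniq ?filter_uniq// => x x' /inAU[_ hx] /inAU[_ hx'].
    by move=> /(congr1 (sh (q1 b) q)); rewrite !shK.
  - rewrite map_inj_in_uniq ?filter_uniq// => x x' /inDU[_ hx] /inDU[_ hx'].
    by move=> /(congr1 (sh (q2 b) q)); rewrite !shK.
  - move=> _ /mapP[x /inAU[xA hx] ->]; exact: Rpunc_trans (hA _ xA) (sh_class hq1 hx).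
  - move=> _ /mapP[x /inDU[xA hx] ->]; exact: Rpunc_trans (hD _ xA) (sh_class hq2 hx).
apply: (@le_trans _ _ (B%:R^-1 * K1 * (e ^+ 2 * (B%:R * K2 * sqnorm D xi)))).
  rewrite ler_wpM2l//; first by rewrite mulr_ge0// invr_ge0 ltW.
  apply: le_trans (ler_sum _ (fun b _ => Zb b)) _.
  rewrite -mulr_sumr ler_wpM2l ?sqr_ge0// exchange_big /=.
  rewrite /sqnorm mulr_sumr big_filter big_mkcond /=; apply: ler_sum => y _.
  case: asboolP => [hy|_]; last by rewrite mulr_ge0 ?sqr_ge0// mulr_ge0// ltW.
  under eq_bigr do rewrite normcM exprMn.
  by rewrite -mulr_suml ler_wpM2r ?sqr_ge0//; exact: hc2.
rewrite le_eqVlt; apply/orP; left; apply/eqP; field; exact: lt0r_neq0.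
Qed.

End Corner.

(** * Laurent form of the span, and inversion in a corner *)

Section Simplicity.
Context {R : realType} (c : planeOf R) (T : tilesetOf R).
Context {hc : interior_puncture c} {hT : pinwheel_hull c T}.

Local Open Scope complex_scope.

Local Notation tile := (tileOf R).
Local Notation tileset := (tilesetOf R).
Local Notation puncture := (puncture c).
Local Notation hull_punc := (hull_punc c T).
Local Notation Rpunc := (Rpunc c T).
Local Notation Cc := (Cc c T).
Local Notation conv := (Defs.conv c T).
Local Notation cstar := (Defs.cstar c T).
Local Notation AT_pin := (@Defs.AT_pin R c T).
Local Notation kadd := (@Defs.kadd R).
Local Notation kbound := (kbound c T).
Local Notation ev_bound := (ev_bound c T).
Local Notation gens := (AN_generators c T).
Local Notation gen := (gen c T).
Local Notation addr := (addr c T).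
Local Notation zeta := (zeta c).
Local Notation inU := (inU c T).
Implicit Types (f g : @pairfun R) (u v w : nat -> @pairfun R) (x y z : tileset) (q : tile)
  (e : R).

Lemma VN_addr N i t t' x y : omega_iter_proto c N i t -> omega_iter_proto c N i t' ->
  VN c T N i t t' (x, y) -> exists ph, [/\ addr N i ph t x, addr N i ph t' y &
    y = sact 0 (rotmx ph *m (puncture t - puncture t')) x].
Proof.
move=> ht ht' /(VNP T _ ht ht')[ph a /= e]; exists ph; split=> //.
by rewrite e; exact: addr_shift.
Qed.

Lemma span_support N f p : kspan (gens N) f -> f p <> 0 -> exists i t t',
  [/\ omega_iter_proto c N i t, omega_iter_proto c N i t' & VN c T N i t t' p].
Proof.
pose Q f := f p <> 0 -> exists i t t',
  [/\ omega_iter_proto c N i t, omega_iter_proto c N i t' & VN c T N i t t' p].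
apply: (kspan_ind (Q := Q)) => [//|g h hg hh|k g [k' [i [t [t' [ht ht' ->]]]]]].
  rewrite /Q /Defs.kadd; have [->|/eqP gp _] := eqVneq (g p) 0; last exact: hg.
  by rewrite add0r; exact: hh.
rewrite /Q /kscale -/(gen k' N i t t') genE//; case: asboolP => [hV _|_].
  by exists i, t, t'.
by rewrite mulr0.
Qed.

(** By uniqueness of addresses, generators with other indices vanish on this [V_N], and those with
    the same indices are powers of [z] there; [d] clears the negative exponents. *)
Lemma span_laurent N f i t t' : kspan (gens N) f ->
  omega_iter_proto c N i t -> omega_iter_proto c N i t' ->
  exists d (p : {poly R[i]}), forall r, VN c T N i t t' r ->
    zeta r.1 ^+ d * f r = p.[zeta r.1].
Proof.
move=> hf ht ht'; move: hf.
pose Q f := exists d (p : {poly R[i]}), forall r, VN c T N i t t' r ->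
    zeta r.1 ^+ d * f r = p.[zeta r.1].
apply: (kspan_ind (Q := Q)).
- by exists 0%N, 0 => x _; rewrite horner0 mulr0.
- move=> g h [d1 [p1 h1]] [d2 [p2 h2]].
  exists (d1 + d2)%N, ('X^d2 * p1 + 'X^d1 * p2) => x hx.
  rewrite hornerD !hornerM !hornerXn -h1// -h2// exprD /Defs.kadd; ring.
move=> k g [k' [i1 [t1 [t1' [ht1 ht1' ->]]]]]; rewrite -/(gen k' N i1 t1 t1').
have [[? ? ?]|ne] := pselect ([/\ i1 = i, t1 = t & t1' = t']).
  subst i1 t1 t1'; case: k' => n.
    exists 0%N, (k *: 'X^n) => x hx.
    by rewrite hornerZ hornerXn /kscale genE// (asboolT hx) mul1r -exprnP.
  exists n.+1, k%:P => x hx.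
  rewrite hornerC /kscale genE// (asboolT hx) NegzE -exprnN mulrCA divff ?mulr1//.
  by rewrite expf_neq0// zeta_neq0.
exists 0%N, 0 => -[x y] hx; rewrite horner0 /kscale genE//; case: asboolP => [hV|_].
  exfalso; apply: ne; have [ph [a1 a2 _]] := VN_addr ht ht' hx.
  have [ph' [b1 b2 _]] := VN_addr ht1 ht1' hV.
  by have [-> _ ->] := addr_unique b1 a1; have [_ _ ->] := addr_unique b2 a2.
by rewrite !mulr0.
Qed.

Section Ideal.
Variable I : set cstar.
Hypothesis hI : closed_ideal AT_pin I.
Local Notation ideal_seq := (ideal_seq I).

Lemma ideal_seq_sum B (F : nat -> nat -> @pairfun R) :
  (forall b, (b < B)%N -> ideal_seq (F b)) ->
  ideal_seq (fun n p => \sum_(b < B) F b n p).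
Proof.
elim: B => [_|B IH hF].
  rewrite (_ : (fun _ _ => _) = fun=> @Defs.kzero R); first exact: (ideal_seq0 hI).
  by apply/funext => n; apply/funext => p; rewrite big_ord0.
rewrite (_ : (fun _ _ => _) = fun n => kadd (fun p => \sum_(b < B) F b n p) (F B n)).
  by apply: (ideal_seq_add hI); [apply: IH => b bB; exact/hF/ltnW|exact: hF].
by apply/funext => n; apply/funext => p; rewrite big_ord_recr.
Qed.

Section Corner.
Variables (L : nat) (j : bool) (q : tile).
Hypothesis hq : omega_iter_proto c L j q.
Local Notation F := (gen 0 L j q q).

Lemma cornerE p : F p = if `[< p.1 = p.2 /\ inU L j q p.1 >] then 1 else 0.
Proof.
case: p => x y; rewrite genE//= expr0z.
have e : VN c T L j q q (x, y) <-> x = y /\ inU L j q x.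
  have shx : inU L j q x -> sh c T L j q q x = x.
    by move=> [ph a]; rewrite (shP a hq) subrr mulmx0 sact_id.
  split=> [/(VN_sh _ _ hq hq)[hx ->]|[<- hx]]; first by rewrite shx.
  by apply/VN_sh => //; rewrite shx.
by congr (if _ then _ else _); apply/asboolP/asboolP => /e.
Qed.

Lemma inU_punc x : inU L j q x -> hull_punc x.
Proof. by move=> [ph /addr_punc]. Qed.

Lemma conv_corner_r g : (forall p, g p <> 0 -> Rpunc p /\ inU L j q p.2) -> conv g F = g.
Proof.
move=> hg; apply/funext => -[x y].
have [g0|/eqP /hg[hp /= hy]] := eqVneq (g (x, y)) 0.
  rewrite g0; apply: contrapT => /conv_neq0[z _ [/= gz]]; rewrite cornerE /=.
  by case: asboolP => // -[ez _] _; apply: gz; rewrite ez.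
rewrite (conv_single_r _ (z := y)) ?cornerE /=//.
  by rewrite asboolT ?mulr1.
by move=> z'; rewrite cornerE /=; case: asboolP => // -[].
Qed.

Lemma conv_corner_l g : (forall p, g p <> 0 -> Rpunc p /\ inU L j q p.1) -> conv F g = g.
Proof.
move=> hg; apply/funext => -[x y].
have [g0|/eqP /hg[hp /= hx]] := eqVneq (g (x, y)) 0.
  rewrite g0; apply: contrapT => /conv_neq0[z _ [/=]]; rewrite cornerE /=.
  by case: asboolP => // -[ez _] _; rewrite -ez.
rewrite (conv_single_l _ (z := x)) ?cornerE /=//.
- by rewrite asboolT ?mul1r.
- exact/Rpunc_refl/inU_punc.
by move=> z'; rewrite cornerE /=; case: asboolP => // -[->].
Qed.

(* [ap k n] are the partial sums of the Neumann series for [F = v^-1 v] in the corner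
   cut by the projection [F]. *)
Lemma corner_neumann v : ideal_seq v ->
  (forall n p, v n p <> 0 -> inU L j q p.1 /\ inU L j q p.2) ->
  ev_bound (1 / 2) (fun n => ksub F (v n)) -> ideal_seq (fun=> F).
Proof.
move=> iv hv [N0 hN0].
have CF : Cc F by exact: Cc_gen.
have Cv n : Cc (v n) by have [] := ideal_seq_cauchy iv.
pose ap k n := iter k (fun g => kadd g (ksub (v n) (conv g (v n)))) (@Defs.kzero R).
have iap k : ideal_seq (ap k).
  elim: k => [|k IH]; first exact: (ideal_seq0 hI).
  have -> : ap k.+1 =
      fun n => kadd (ap k n) (kadd (v n) (kscale (-1) (conv (ap k n) (v n)))).
    by apply/funext => n; rewrite /ap iterS ksubE.
  exact: (ideal_seq_add hI IH
    (ideal_seq_add hI iv (ideal_seq_scale hI (-1) (ideal_seqM hI IH iv)))).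
have Cap k n : Cc (ap k n) by have [] := ideal_seq_cauchy (iap k).
have colU k n p : ap k n p <> 0 -> inU L j q p.2.
  elim: k p => [|k IH] p //=; rewrite /Defs.kadd /ksub.
  have [->|/eqP /IH//] := eqVneq (ap k n p) 0; rewrite add0r.
  have [->|/eqP /hv[]//] := eqVneq (v n p) 0; rewrite sub0r => h.
  have /conv_neq0[z _ [_ /= /hv[]//]] : conv (ap k n) (v n) p <> 0.
  by move=> h0; apply: h; rewrite h0 oppr0.
have bnd k n : (N0 <= n)%N -> kbound ((1 / 2) ^+ k) (ksub F (ap k n)).
  move=> nN; elim: k => [|k IH].
    rewrite expr0 /= (_ : ksub _ _ = F); first exact: kbound_gen.
    by apply/funext => p; rewrite /ksub /Defs.kzero subr0.
  (* The recursion for [ap] is made for this identity, by which each step multiplies the error by at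
     most [1 / 2]. The support conditions are used here: [F] is a left unit for [v n] and a right
     unit for [ap k n]. *)
  have -> : ksub F (ap k.+1 n) = conv (ksub F (ap k n)) (ksub F (v n)).
    rewrite conv_ksubr; last exact: Cc_ksub.
    rewrite !conv_ksubl// (conv_corner_r (g := F)); last first.
      move=> [x y] Fp; split; first exact: Cc_supp Fp.
      by move: Fp; rewrite cornerE /=; case: asboolP => // -[->].
    rewrite (conv_corner_r (g := ap k n)); last first.
      by move=> p hp; split; [exact: Cc_supp hp|exact: colU hp].
    rewrite conv_corner_l; last first.
      by move=> p hp; split; [exact: Cc_supp hp|have [] := hv _ _ hp].
    by apply/funext => p; rewrite /= /ksub /Defs.kadd; ring.
  have h2 : (0 : R) <= (1 / 2) ^+ k by rewrite exprn_ge0// divr_ge0.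
  have CC : Cc (ksub F (ap k n)) by exact: Cc_ksub.
  by rewrite exprSr; exact: (kbound_conv h2 CC IH (hN0 n nN)).
apply: (ideal_seq_close hI) => //; first exact: cauchy_const.
move=> e e0; have [k hk] : exists k, (1 / 2) ^+ k <= e.
  have [k _ hk] := near_infty_natSinv_lt (PosNum e0).
  exists k; apply: le_trans (ltW (hk k (leqnn k))) => /=.
  rewrite expr_div_n expr1n div1r lef_pV2 ?posrE ?exprn_gt0 ?ltr0n//.
  by rewrite -natrX ler_nat ltn_expl.
exists (ap k); first exact: iap.
exists N0 => n nN; apply: kbound_le (bnd k n nN); last exact: hk.
by rewrite exprn_ge0// divr_ge0.
Qed.

End Corner.

End Ideal.

End Simplicity.

(** * The averaged element of the ideal *)

Section MainArgument.
Context {R : realType} (c : planeOf R) (T : tilesetOf R).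
Context {hc : interior_puncture c} {hT : pinwheel_hull c T}.

Local Open Scope complex_scope.

Local Notation plane := (planeOf R).
Local Notation tile := (tileOf R).
Local Notation tileset := (tilesetOf R).
Local Notation puncture := (puncture c).
Local Notation Rpunc := (Rpunc c T).
Local Notation Cc := (Cc c T).
Local Notation conv := (Defs.conv c T).
Local Notation cstar := (Defs.cstar c T).
Local Notation AT_pin := (@Defs.AT_pin R c T).
Local Notation kadd := (@Defs.kadd R).
Local Notation kbound := (kbound c T).
Local Notation ev_bound := (ev_bound c T).
Local Notation gens := (AN_generators c T).
Local Notation gen := (gen c T).
Local Notation addr := (addr c T).
Local Notation zeta := (zeta c).
Local Notation inU := (inU c T).
Local Notation sh := (sh c T).
Local Notation lam := (@lambda R).
Local Notation normc := (@Normc.normc R).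
Implicit Types (x y z : tileset) (q : tile).

(** The increment of the orientations of successive copies in [reach_progression]. *)
Definition step_angle (j : bool) : R := - (2 * (orient j * theta)).
Definition rot_unit j : R[i] := expi (step_angle j).

Section Corner.
Variables (I : set cstar) (u : nat -> @pairfun R) (N : nat) (f : @pairfun R).
Hypotheses (hI : closed_ideal AT_pin I) (iu : ideal_seq I u) (sf : kspan (gens N) f).
Variables (i : bool) (t t' : tile) (d : nat) (p : {poly R[i]}).
Hypotheses (ht : omega_iter_proto c N i t) (ht' : omega_iter_proto c N i t').
Hypothesis (hp : forall r, VN c T N i t t' r -> zeta r.1 ^+ d * f r = p.[zeta r.1]).
Variables (M B : nat) (eps eta : R).
Local Notation P1 := (p ^+ M.+1).
Local Notation P0 := (p ^+ M).
Local Notation S1 := (coef_sq P1).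
Local Notation S0 := (coef_sq P0).
Hypotheses (B0 : (0 < B)%N) (S10 : 0 < S1) (eps0 : 0 <= eps) (eta0 : 0 <= eta).
Hypothesis (hu : ev_bound eps (fun n => ksub (u n) f)).
Hypothesis (avg1 : forall (j : bool) (x : R[i]), normc x = 1 ->
  `|\sum_(b < B) normc P1.[x * rot_unit j ^+ b] ^+ 2 - B%:R * S1| <= B%:R * eta).
Hypothesis (avg0 : forall (j : bool) (x : R[i]), normc x = 1 ->
  `|\sum_(b < B) normc P0.[x * rot_unit j ^+ b] ^+ 2 - B%:R * S0| <= B%:R * eta).
(** [eta] bounds the discrepancy of the orbit averages. The left side of [eps_small] is the bound of
    [corner_average_bound] for the error [f - u n], with multipliers of mean square at most
    [S1 + eta] and [S0 + eta]. Both right sides become [1 / 4] on division by [S1]. *)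
Hypothesis (eta_small : eta <= S1 / 4).
Hypothesis (eps_small : eps * Num.sqrt ((S1 + eta) * (S0 + eta)) <= S1 / 4).

Variables (j : bool) (q : tile).
Local Notation L := (N + B.+1)%N.
Hypothesis hq : omega_iter_proto c L j q.

Variables (C0 : R) (wv : nat -> plane).
Local Notation al b := (C0 - (2 * b)%:R * (orient j * theta)).
Hypothesis hwv : forall b, (b < B)%N -> omega_iter_proto c B.+1 j (placed c i (al b) (wv b)).

Let q1 b := tact (al b) (lam ^+ N *: wv b) t.
Let q2 b := tact (al b) (lam ^+ N *: wv b) t'.

Let hq1 b : (b < B)%N -> omega_iter_proto c L j (q1 b).
Proof. by move=> bB; exact: omega_iter_protoD (hwv bB) ht. Qed.

Let hq2 b : (b < B)%N -> omega_iter_proto c L j (q2 b).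
Proof. by move=> bB; exact: omega_iter_protoD (hwv bB) ht'. Qed.

Let kap b x := zeta (sh L j q (q1 b) x).

(** All dependence on [b] is in the power of [rot_unit j]: for every [x] the values of [z] at the
    copies of [t] form an orbit of one irrational rotation. *)
Let kap_orbit ph b x : (b < B)%N -> addr L j ph q x ->
  kap b x = expi ph * expi C0 * expi (angle c t) * rot_unit j ^+ b.
Proof.
move=> bB a; rewrite /kap (zeta_addr (sh_addr a (hq1 bB))) /rot_unit -expiM.
have -> : expi (angle c (q1 b)) = expi (al b + angle c t).
  by apply: expi_rot; apply: angle_tact; exact: tiles_omega_iter_proto ht.
rewrite -!expiD; congr expi; rewrite /step_angle natrM; ring.
Qed.

Let kap_ratio b x : (b < B)%N -> inU L j q x ->
  kap b x = expi (angle c (q1 b) - angle c q) * zeta x.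
Proof.
move=> bB [ph a]; rewrite /kap (zeta_addr (sh_addr a (hq1 bB))) (zeta_addr a) -!expiD.
by congr expi; ring.
Qed.

Let kap_ratio2 b y : (b < B)%N -> inU L j q y ->
  kap b y = expi (angle c (q1 b) - angle c (q2 b)) * zeta (sh L j q (q2 b) y).
Proof.
move=> bB [ph a]; rewrite /kap (zeta_addr (sh_addr a (hq1 bB))).
rewrite (zeta_addr (sh_addr a (hq2 bB))) -!expiD.
by congr expi; ring.
Qed.

(** The power [kap b x ^+ d] cancels the factor [z^(-d)] of [f]; with [c2] the product becomes
    [conj(P1) * p * P0], which is [|P1|^2]. *)
Let c1 b x := (P1.[kap b x]^*)%R * kap b x ^+ d.
Let c2 b y := P0.[kap b y].

Let rho1 b := expi (angle c (q1 b) - angle c q).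
Let rho2 b := expi (angle c (q1 b) - angle c (q2 b)).

(** [s1] and [s2] realise [c1] and [c2] as Laurent polynomials in [z] at the first entry of a pair;
    [rho1 b] and [rho2 b] are the constant ratios to [kap b]. The exponents [d - l] arise because
    conjugation is inversion on the unit circle. *)
Let s1 b : @pairfun R := laurent_kernel c T L j
  (fun l : 'I_(size P1) => ((P1`_l)^*)%R * ((rho1 b)^*)%R ^+ l * rho1 b ^+ d)
  (fun l => (d%:Z - (l : nat)%:Z)) q (q1 b).

Let s2 b : @pairfun R := laurent_kernel c T L j
  (fun l : 'I_(size P0) => P0`_l * rho2 b ^+ l) (fun l => (l : nat)%:Z) (q2 b) q.

Lemma unit_exprzB (z : R[i]) (m n : nat) : normc z = 1 ->
  z ^ (m%:Z - n%:Z) = z ^+ m * (z^*)%R ^+ n.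
Proof.
move=> z1; have z0 : z != 0.
  by apply/eqP => e; move: z1; rewrite e Normc.normc0 => /eqP; rewrite eq_sym oner_eq0.
have -> : (z^*)%R = z^-1 by apply: (mulfI z0); rewrite unit_conj// divff.
by rewrite expfzDr// -exprnP -exprnN exprVn.
Qed.

Let s1_val b x : (b < B)%N -> inU L j q x -> s1 b (x, sh L j q (q1 b) x) = c1 b x.
Proof.
move=> bB hx; rewrite /s1 laurent_kernelE//; last exact: hq1.
rewrite asboolT; last by apply/VN_sh => //; exact: hq1.
rewrite /c1 (kap_ratio bB hx) -/(rho1 b) horner_coef rmorph_sum mulr_suml.
apply: eq_bigr => l _; rewrite unit_exprzB ?normc_zeta//=.
rewrite !(rmorphM, rmorphXn) /= !exprMn; ring.
Qed.

Let s2_val b y : (b < B)%N -> inU L j q y -> s2 b (sh L j q (q2 b) y, y) = c2 b y.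
Proof.
move=> bB hy; rewrite /s2 laurent_kernelE//; last exact: hq2.
rewrite asboolT; last first.
  apply/VN_sh => //; first exact: hq2.
  by rewrite shK//; [split=> //; have [ph a] := hy; exists ph; exact: sh_addr (hq2 bB)|
    exact: hq2].
rewrite /c2 (kap_ratio2 bB hy) -/(rho2 b) horner_coef.
by apply: eq_bigr => l _; rewrite exprMn mulrA.
Qed.

(* [Y w] is the average of [s1 b * w * s2 b]. For [w = f] it is diagonal, with value the
   average of [|P1|^2] along an orbit of the rotation by [step_angle j]. *)
Let Y (w : @pairfun R) : @pairfun R := fun r => B%:R^-1 * \sum_(b < B)
  if `[< inU L j q r.1 /\ inU L j q r.2 >] then
    c1 b r.1 * w (sh L j q (q1 b) r.1, sh L j q (q2 b) r.2) * c2 b r.2 else 0.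

Let YE (w : @pairfun R) : (forall r, ~ Rpunc r -> w r = 0) ->
  Y w = fun r => B%:R^-1 * \sum_(b < B) conv (conv (s1 b) w) (s2 b) r.
Proof.
move=> hw; apply/funext => -[x y]; rewrite /Y; congr (_ * _); apply: eq_bigr => b _.
have bB := ltn_ord b.
rewrite (@corner_conv _ c T _ _ L j q (q1 b) (q2 b))//.
- by case: asboolP => // -[hx hy]; rewrite s1_val// s2_val.
- exact: hq1.
- exact: hq2.
- by move=> r; rewrite /s1 laurent_kernelE//; [case: asboolP|exact: hq1].
by move=> r; rewrite /s2 laurent_kernelE//; [case: asboolP|exact: hq2].
Qed.

Let Yu_ideal : ideal_seq I (fun n => Y (u n)).
Proof.
have Cu n : Cc (u n) by have [] := ideal_seq_cauchy iu.
have -> : (fun n => Y (u n)) = fun n => kscale (B%:R^-1)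
    (fun r => \sum_(b < B) conv (conv (s1 b) (u n)) (s2 b) r).
  by apply/funext => n; rewrite YE//; case: (Cu n).
apply: (ideal_seq_scale hI).
apply: (ideal_seq_sum hI (F := fun b n => conv (conv (s1 b) (u n)) (s2 b))) => b bB.
have k1 : kspan (gens L) (s1 b) by apply: laurent_kernel_span => //; exact: hq1.
have k2 : kspan (gens L) (s2 b) by apply: laurent_kernel_span => //; exact: hq2.
exact: (ideal_seq_mulr hI k2 (ideal_seq_mull hI k1 iu)).
Qed.

Let refine1 ph b x : (b < B)%N -> addr L j ph q x ->
  addr N i (ph + al b) t (sh L j q (q1 b) x).
Proof. by move=> bB a; apply: addr_refine (hwv bB) ht _; exact: sh_addr a (hq1 bB). Qed.

Let refine2 ph b x : (b < B)%N -> addr L j ph q x ->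
  addr N i (ph + al b) t' (sh L j q (q2 b) x).
Proof. by move=> bB a; apply: addr_refine (hwv bB) ht' _; exact: sh_addr a (hq2 bB). Qed.

Let pq b : puncture (q1 b) - puncture (q2 b) = rotmx (al b) *m (puncture t - puncture t').
Proof.
rewrite /q1 /q2 !puncture_tact; [|exact: tiles_omega_iter_proto ht'|
  exact: tiles_omega_iter_proto ht].
by rewrite opprD addrACA subrr addr0 mulmxBr.
Qed.

(** A nonzero entry of [f] lies in some [V_N]. Both shifted tilings have known addresses in the
    [b]-th copies, so uniqueness forces the indices [t], [t'] and equal orientations of the two
    large supertiles; undoing the shifts gives the same tiling. *)
Let f_shift b x y : (b < B)%N -> inU L j q x -> inU L j q y ->
  f (sh L j q (q1 b) x, sh L j q (q2 b) y) <> 0 -> x = y.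
Proof.
move=> bB [ph a] [ph' a'] /(span_support sf)[i1 [t1 [t1' [h1 h1' hV]]]].
have [psi [b1 b2 e]] := VN_addr h1 h1' hV.
have [? er ?] := addr_unique b1 (refine1 bB a); subst i1 t1.
have [_ er' ?] := addr_unique b2 (refine2 bB a'); subst t1'.
have pp : rotmx ph = rotmx ph'.
  by apply: (@rotmx_addI R (al b)); rewrite addrC -er er' addrC.
move: e; rewrite er (shP a (hq1 bB)) (shP a' (hq2 bB)) sact0D -pp rotmxD -mulmxA -pq.
rewrite -mulmxDr addrA subrK => /(congr1 (sact 0 (- (rotmx ph *m (puncture q - puncture (q2 b)))))).
by rewrite !sact0D !subrr !sact_id.
Qed.

Let f_diag b x : (b < B)%N -> inU L j q x ->
  VN c T N i t t' (sh L j q (q1 b) x, sh L j q (q2 b) x).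
Proof.
move=> bB [ph a]; apply/VNP => //; exists (ph + al b); first exact: refine1.
rewrite /= (shP a (hq1 bB)) (shP a (hq2 bB)) sact0D rotmxD -mulmxA -pq -mulmxDr.
by rewrite addrA subrK.
Qed.

Let sumP1 x : R := B%:R^-1 * \sum_(b < B) normc P1.[kap b x] ^+ 2.

Let Yf r : Y f r = if `[< r.1 = r.2 /\ inU L j q r.1 >] then (sumP1 r.1)%:C else 0.
Proof.
case: r => x y; rewrite /Y /=; have [[<- hx]|hN] := asboolP (x = y /\ inU L j q x).
  rewrite /sumP1 rmorphM fmorphV rmorph_nat rmorph_sum; congr (_ * _).
  apply: eq_bigr => b _; have bB := ltn_ord b.
  rewrite asboolT//= normc_sqrC /c1 /c2.
  have := hp (f_diag bB hx); rewrite /= -/(kap b x) => e.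
  have -> : (P1.[kap b x]^*)%R * kap b x ^+ d *
      f (sh L j q (q1 b) x, sh L j q (q2 b) x) * P0.[kap b x] =
    (P1.[kap b x]^*)%R * (kap b x ^+ d * f (sh L j q (q1 b) x, sh L j q (q2 b) x)) *
      P0.[kap b x] by rewrite !mulrA.
  by rewrite e -mulrA -hornerM -exprS mulrC.
rewrite big1 ?mulr0// => b _; case: asboolP => // -[hx hy].
have [->|/eqP fn] := eqVneq (f (sh L j q (q1 b) x, sh L j q (q2 b) y)) 0.
  by rewrite mulr0 mul0r.
by exfalso; apply: hN; split=> //; exact: f_shift (ltn_ord b) hx hy fn.
Qed.

Let BR0 : 0 < B%:R :> R. Proof. by rewrite ltr0n. Qed.

Let x0P x : inU L j q x -> exists2 x0 : R[i], normc x0 = 1 &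
  forall b, (b < B)%N -> kap b x = x0 * rot_unit j ^+ b.
Proof.
move=> [ph a]; exists (expi ph * expi C0 * expi (angle c t)).
  by rewrite !normcM !normc_expi !mulr1.
by move=> b bB; exact: kap_orbit.
Qed.

Let sum1 x : inU L j q x ->
  `|\sum_(b < B) normc P1.[kap b x] ^+ 2 - B%:R * S1| <= B%:R * eta.
Proof.
move=> /x0P[x0 n0 hx]; under eq_bigr => b _ do rewrite hx//.
exact: avg1.
Qed.

Let sum0 x : inU L j q x ->
  `|\sum_(b < B) normc P0.[kap b x] ^+ 2 - B%:R * S0| <= B%:R * eta.
Proof.
move=> /x0P[x0 n0 hx]; under eq_bigr => b _ do rewrite hx//.
exact: avg0.
Qed.

(** [Y (u n)] divided by [S1] lies in the ideal and within [1 / 2] of the projection, so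
    [corner_neumann] applies. *)
Lemma corner_in_ideal : ideal_seq I (fun=> gen 0 L j q q).
Proof.
have S00 : 0 <= S0 by exact: coef_sq_ge0.
apply: (corner_neumann hI hq (v := fun n => kscale (S1^-1)%:C (Y (u n)))).
- exact: (ideal_seq_scale hI).
- move=> n r; rewrite /kscale /Y; case: asboolP => // _ h.
  by exfalso; apply: h; rewrite big1 ?mulr0.
have nS : normc (S1^-1)%:C = S1^-1 by rewrite normc_real ger0_norm// invr_ge0 ltW.
have [N0 hN0] := hu; exists N0 => n nN.
have -> : ksub (gen 0 L j q q) (kscale (S1^-1)%:C (Y (u n))) =
    kadd (ksub (gen 0 L j q q) (kscale (S1^-1)%:C (Y f)))
      (kscale (S1^-1)%:C (Y (ksub f (u n)))).
  apply/funext => r; rewrite /ksub /kscale /Defs.kadd.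
  have -> : Y (fun p0 => f p0 - u n p0) r = Y f r - Y (u n) r.
    rewrite /Y -mulrBr -sumrB; congr (_ * _); apply: eq_bigr => b _.
    by case: asboolP => _; ring.
  ring.
(* One quarter for the deviation of the orbit average from [S1], a diagonal kernel, and one for the
   error [f - u n]. *)
have -> : 1 / 2 = 1 / 4 + 1 / 4 :> R by lra.
apply: kbound_kadd; [lra|lra| |].
- have val r : ksub (gen 0 L j q q) (kscale (S1^-1)%:C (Y f)) r =
      if `[< r.1 = r.2 /\ inU L j q r.1 >] then (1 - S1^-1 * sumP1 r.1)%:C else 0.
    rewrite /ksub /kscale Yf cornerE//; case: asboolP => _; last by rewrite mulr0 subr0.
    by rewrite [RHS]rmorphB [in RHS]rmorphM.
  apply: kbound_partial; first lra.
  + move=> r; rewrite val; case: asboolP => [[_ hx]|_]; last by rewrite Normc.normc0; lra.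
    have := sum1 hx; rewrite normc_real /sumP1.
    move: (\sum_(b < B) _) => s hs.
    have -> : 1 - S1^-1 * (B%:R^-1 * s) = - ((s - B%:R * S1) / (B%:R * S1)).
      by field; rewrite !gt_eqF.
    rewrite normrN normrM [`|(_)^-1|]ger0_norm ?invr_ge0 ?mulr_ge0 ?(ltW BR0) ?(ltW S10)//.
    rewrite ler_pdivrMr ?mulr_gt0//; apply: le_trans hs _.
    by rewrite mulrCA ler_pM2l// div1r mulrC.
  + move=> x y y'; rewrite !val /=; case: asboolP => // -[<- _] _.
    by case: asboolP => // -[].
  move=> x x' y; rewrite !val /=; case: asboolP => // -[-> _] _.
  by case: asboolP => // -[].
apply: kbound_le (kbound_kscale _ (_ : kbound (eps * Num.sqrt ((S1 + eta) * (S0 + eta))) _)).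
- by rewrite mulr_ge0 ?normc_ge0// mulr_ge0// sqrtr_ge0.
- rewrite nS mulrC ler_pdivrMr//; apply: le_trans eps_small _; lra.
apply: corner_average_bound => //.
- by rewrite addr_ge0// ltW.
- by rewrite addr_ge0.
- move=> x hx; have := sum1 hx.
  under [X in _ -> X <= _]eq_bigr => b _ do
    rewrite /c1 normcM normc_conj normcX normc_zeta expr1n mulr1.
  by rewrite ler_norml => /andP[_]; rewrite lerBlDl -mulrDr.
- move=> x hx; have := sum0 hx.
  by rewrite ler_norml => /andP[_]; rewrite lerBlDl -mulrDr.
by apply: kbound_ksubC; exact: hN0.
Qed.

End Corner.

End MainArgument.

(** * Choice of the constants, and the unit as a sum of corner projections *)

Section Unit.
Context {R : realType} (c : planeOf R) (T : tilesetOf R).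
Context {hc : interior_puncture c} {hT : pinwheel_hull c T}.

Local Open Scope complex_scope.

Local Notation plane := (planeOf R).
Local Notation tile := (tileOf R).
Local Notation Cc := (Cc c T).
Local Notation conv := (Defs.conv c T).
Local Notation cstar := (Defs.cstar c T).
Local Notation AT_pin := (@Defs.AT_pin R c T).
Local Notation kadd := (@Defs.kadd R).
Local Notation gen := (gen c T).
Local Notation zeta := (zeta c).
Local Notation normc := (@Normc.normc R).

(** Adding [eta] costs a factor [9 / 8] twice, and [S0 <= 2 * S1 / v ^+ 2] with [v >= 7 / 8 * k].
    The square of the left side is therefore at most [1 / 64 * (81 / 64) * (128 / 49) * S1 ^+ 2],
    that is [81 / 1568 * S1 ^+ 2], below [S1 ^+ 2 / 16]. *)
Lemma sqrt_margin (k v eps eta S0 S1 : R) : 0 < k -> 7 / 8 * k <= v -> eps = k / 8 ->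
  0 <= eta -> eta <= S0 / 8 -> eta <= S1 / 8 -> 0 < S0 -> 0 < S1 ->
  v ^+ 2 / 2 * S0 <= S1 -> eps * Num.sqrt ((S1 + eta) * (S0 + eta)) <= S1 / 4.
Proof.
move=> k0 kv -> eta0 h0 h1 S00 S10 hS.
have e0 : 0 <= k / 8 by lra.
have h : (k / 8) ^+ 2 * (81 / 64 * (S1 * S0)) <= (S1 / 4) ^+ 2.
  have kv2 : (7 / 8 * k) ^+ 2 <= v ^+ 2 by rewrite ler_pXn2r ?nnegrE//; lra.
  have hk : 81 / 4 * (k / 8) ^+ 2 * S0 <= S1.
    apply: le_trans hS; rewrite ler_pM2r//; nra.
  have := ler_wpM2r (ltW S10) hk; lra.
rewrite -(ler_pXn2r (n := 2)) ?nnegrE ?mulr_ge0 ?sqrtr_ge0//; try lra.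
rewrite exprMn sqr_sqrtr; last by rewrite mulr_ge0; lra.
apply: le_trans h; rewrite ler_wpM2l ?sqr_ge0//.
have : (S1 + eta) * (S0 + eta) <= (9 / 8 * S1) * (9 / 8 * S0) by apply: ler_pM; lra.
lra.
Qed.

Section Ideal.
Variable I : set cstar.
Hypothesis hI : closed_ideal AT_pin I.

(** The level is chosen before the corner, because the unit is assembled from all corners of one
    level. *)
Lemma ideal_corners a : I a -> a <> Defs.czero c T -> exists L, forall j q,
  omega_iter_proto c L j q -> ideal_seq I (fun=> gen 0 L j q q).
Proof.
move=> Ia nz; have ha := repr_crepr a; set u := crepr a in ha.
have iu : ideal_seq I u by exists a.
have IS : I `<=` AT_pin by case: hI.
have [p0 [k [N0 [hp0 k0 hk]]]] := nonzero_value ha nz.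
have e0 : 0 < k / 8 by lra.
have [N [f [sf hu]]] := AT_approx (IS _ Ia) ha e0.
have fp0 : 7 / 8 * k <= normc (f p0).
  have [N1 hN1] := hu; pose n := maxn N0 N1.
  have h1 : k <= normc (u n p0) by apply: hk; exact: leq_maxl.
  have h2 : normc (u n p0 - f p0) <= k / 8.
    apply: (@kbound_point _ c T _ (ksub (u n) f) p0); first exact: ltW.
      by apply: hN1; exact: leq_maxr.
    exact: hp0.
  have h3 : normc (u n p0) <= normc (u n p0 - f p0) + normc (f p0).
    by rewrite -{1}[u n p0](subrK (f p0)); exact: le_normcD.
  lra.
have fn0 : f p0 <> 0 by move=> e; move: fp0; rewrite e Normc.normc0; lra.
have [i [t [t' [ht ht' hV]]]] := span_support sf fn0.
have [d [p hp]] := span_laurent sf ht ht'.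
have z1 : normc (zeta p0.1) = 1 by exact: normc_zeta.
have pv : normc p.[zeta p0.1] = normc (f p0).
  by rewrite -hp// normcM normcX z1 expr1n mul1r.
have v0 : 0 < normc (f p0) by lra.
have t0 : 0 < normc (f p0) ^+ 2 / 2 by rewrite divr_gt0// exprn_gt0.
have [|M [S00 hS]] := coef_sq_pow_ratio (P := p) z1 t0.
  by rewrite pv mulrCA divff ?mulr1// pnatr_eq0.
have S10 : 0 < coef_sq (p ^+ M.+1) by apply: lt_le_trans hS; exact: mulr_gt0.
(* Small against both mean squares, as [sqrt_margin] requires. *)
pose eta := Num.min (coef_sq (p ^+ M)) (coef_sq (p ^+ M.+1)) / 8.
have eta0 : 0 < eta by rewrite divr_gt0// lt_min S00.
have etaS0 : eta <= coef_sq (p ^+ M) / 8 by rewrite ler_pM2r ?invr_gt0// ge_min lexx.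
have etaS1 : eta <= coef_sq (p ^+ M.+1) / 8.
  by rewrite ler_pM2r ?invr_gt0// ge_min lexx orbT.
(* One bound for both chiralities, so that [B] does not depend on [j]. *)
have avg P : exists2 K : R, 0 <= K & forall (j : bool) B (x : R[i]), normc x = 1 ->
    `|\sum_(b < B) normc P.[x * rot_unit j ^+ b] ^+ 2 - B%:R * coef_sq P| <= K.
  have o j := orbit_average P (normc_expi (step_angle j)) (@theta_irrational_sign R j).
  have [K1 K10 h1] := o true; have [K2 K20 h2] := o false.
  exists (K1 + K2); first exact: addr_ge0.
  move=> [] B x x1; [apply: le_trans (h1 _ _ x1) _|apply: le_trans (h2 _ _ x1) _]; lra.
have [K1 K10 h1] := avg (p ^+ M.+1); have [K0 K00 h0] := avg (p ^+ M).
(* The discrepancies of [orbit_average] do not grow with [B], so a long progression makes them at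
   most [B * eta]. *)
have [B B0 hB] : exists2 B, (0 < B)%N & K1 + K0 <= B%:R * eta.
  exists (Num.trunc ((K1 + K0) / eta)).+1 => //; rewrite -ler_pdivrMr//.
  exact/ltW/truncnS_gt.
exists (N + B.+1)%N => j q hq.
have [C0 hC] := reach_progression c i j B.
have /choice[wv hwv] : forall b, exists w : plane, (b < B)%N ->
    omega_iter_proto c B.+1 j (placed c i (C0 - (2 * b)%:R * (orient j * theta)) w).
  move=> b; have [bB|bB] := boolP (b < B)%N; last by exists 0.
  by have [w hw] := hC _ bB; exists w.
apply: (corner_in_ideal hI iu sf ht ht' hp B0 S10 (ltW e0) (ltW eta0) hu _ _ _ _ hq hwv).
- by move=> j' x x1; apply: le_trans (h1 _ _ _ x1) _; lra.
- by move=> j' x x1; apply: le_trans (h0 _ _ _ x1) _; lra.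
- lra.
exact: sqrt_margin k0 fp0 erefl (ltW eta0) etaS0 etaS1 S00 S10 hS.
Qed.

Definition kone : @pairfun R :=
  fun p => if `[< p.1 = p.2 /\ hull_punc c T p.1 >] then 1 else 0.

Lemma conv_kone g : Cc g -> conv g kone = g.
Proof.
move=> Cg; apply/funext => -[x y].
have [gxy|/eqP gxy] := eqVneq (g (x, y)) 0.
  rewrite gxy; apply: contrapT => /conv_neq0[z _ [/= gz]]; rewrite /kone /=.
  by case: asboolP => // -[ez _] _; apply: gz; rewrite ez.
have hR := Cc_supp Cg gxy.
rewrite (conv_single_r _ (z := y)) /kone /=.
- by rewrite asboolT ?mulr1//; split=> //; exact: Rpunc_hull1 (Rpunc_sym hR).
- exact: hR.
by move=> z; case: asboolP => // -[].
Qed.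

(** Every punctured tiling has exactly one address of level [L], so the supports of the corner
    projections partition the diagonal. *)
Lemma kone_corners L : exists s : seq (bool * tile),
  (forall jq, jq \in s -> omega_iter_proto c L jq.1 jq.2) /\
  kone = fun p => \sum_(jq <- s) gen 0 L jq.1 jq.2 jq.2 p.
Proof.
have /finite_seqP[s0 e0] := finite_omega_iter_proto c L false.
have /finite_seqP[s1 e1] := finite_omega_iter_proto c L true.
pose s := undup ([seq (false, q) | q <- s0] ++ [seq (true, q) | q <- s1]).
have sP j q : (j, q) \in s <-> omega_iter_proto c L j q.
  rewrite mem_undup mem_cat; case: j.
    rewrite e1; split=> [/orP[/mapP[]//|/mapP[q' h [->]]]//|h].
    by apply/orP; right; apply/mapP; exists q.
  rewrite e0; split=> [/orP[/mapP[q' h [->]]//|/mapP[]//]|h].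
  by apply/orP; left; apply/mapP; exists q.
exists s; split=> [[j q] /sP//|]; apply/funext => -[x y]; rewrite /kone /=.
rewrite big_seq; case: asboolP => [[<- hx]|hN]; last first.
  rewrite big1// => -[j q] /sP hq; rewrite cornerE//; case: asboolP => // -[exy hU].
  by exfalso; apply: hN; split=> //; exact: inU_punc hU.
have [j0 [ph [q0 a]]] := addr_exists L hx; have h0 := addr_sub a.
rewrite -big_seq (bigD1_seq (j0, q0)) ?undup_uniq//=; last exact/sP.
rewrite cornerE// asboolT; last by split=> //; exists ph.
rewrite big_seq_cond big1 ?addr0// => -[j q] /andP[/sP hq /eqP ne].
rewrite cornerE//; case: asboolP => // -[_ [ph' a']]; exfalso; apply: ne.
by have /= [-> _ ->] := addr_unique a' a.
Qed.

Lemma ideal_all a : I a -> a <> Defs.czero c T -> I = AT_pin.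
Proof.
move=> Ia nz; have [L hL] := ideal_corners Ia nz.
have [s [sP e]] := kone_corners L.
have i1 : ideal_seq I (fun=> kone).
  rewrite e; elim: s sP {e} => [_|[j q] s IH hs].
    rewrite (_ : (fun _ _ => _) = fun=> @Defs.kzero R); first exact: (ideal_seq0 hI).
    by apply/funext => n; apply/funext => p; rewrite big_nil.
  rewrite (_ : (fun _ _ => _) = fun=> kadd (gen 0 L j q q)
      (fun p => \sum_(jq <- s) gen 0 L jq.1 jq.2 jq.2 p)); last first.
    by apply/funext => n; apply/funext => p; rewrite big_cons.
  apply: (ideal_seq_add hI).
    by apply: hL; apply: (hs (j, q)); rewrite mem_head.
  by apply: IH => jq hjq; apply: hs; rewrite in_cons hjq orbT.
apply/seteqP; split=> [|b Sb]; first by case: hI.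
have hb := repr_crepr b.
have := ideal_seq_mul hI Sb hb i1.
have -> : (fun n => conv (crepr b n) kone) = crepr b.
  by apply/funext => n; apply: conv_kone; case: hb => -[].
by move=> [b' Ib' hb']; rewrite (repr_inj hb hb' (same_refl _ _ _)).
Qed.

End Ideal.

(** A projection of level [0] has the value [1] at a diagonal point, whereas by [kbound_point] a
    null sequence tends to [0] at every point. *)
Lemma AT_nonzero : exists2 a, AT_pin a & a <> Defs.czero c T.
Proof.
have [X hX] : hull_punc c T !=set0 by exact: hull_punc_nonempty.
have [i [ph [t a]]] := addr_exists 0 hX; have ht := addr_sub a.
exists (cembed c T (gen 0 0 i t t)); first by apply: span_AT; exact: kspan_gen.
move=> e; have h1 : repr (Defs.czero c T) (fun=> gen 0 0 i t t).
  by rewrite -e; apply: repr_cembed; exact: Cc_gen.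
have h2 : (0 : R) < 1 / 2 by lra.
have [N hN] := repr_same h1 (repr_czero c T) h2.
have := kbound_point (ltW h2) (hN N (leqnn N)) (Rpunc_refl hX).
rewrite /ksub /Defs.kzero subr0 cornerE// asboolT; last by split=> //; exists ph.
by rewrite Normc.normc1; lra.
Qed.

Lemma AT_simple : simple_algebra AT_pin.
Proof.
split=> [|I hI]; first exact: AT_nonzero.
have [[a Ia nz]|hN] := pselect (exists2 a, I a & a <> Defs.czero c T).
  by right; exact: ideal_all Ia nz.
left; apply/seteqP; split=> [a Ia|_ ->]; last by case: hI => _ [].
by apply: contrapT => nz; apply: hN; exists a.
Qed.

End Unit.

Theorem theorem5p1 (R : realType) (c : 'cV[R]_2) (T : set (set 'cV[R]_2))
  (hc : interior (@scaledDelta R) c)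
  (hT : pinwheel_tiling c T)
  (hrot : hull_rotation_invariant c T)
  (hflc : hull_flc c T)
  (haper : hull_strongly_aperiodic c T)
  (homegabij : set_bij (hull c T) (hull c T) (omega c))
  (homegacont : omega_hull_continuous c T) :
  simple_algebra (@AT_pin R c T).
Proof.
have hP : interior_puncture c := hc; have [hT1 _] := hT.
have hH : pinwheel_hull c T := Build_pinwheel_hull hT1 hrot hflc haper homegabij.
exact: AT_simple.
Qed.
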